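(* Let $c_1,c_2$ be admissible central charges. The Virasoro nets $\mathcal{A}_{\mathrm{Vir},c_1}$ and $\mathcal{A}_{\mathrm{Vir},c_2}$ are isomorphic as Möbius covariant nets if and only if $c_1=c_2$.
   Context: Let $S^1=\{z\in\mathbb{C}:|z|=1\}$, and let $\mathcal{I}$ be the set of open, nonempty, nondense arcs of $S^1$. For $I\in\mathcal{I}$, $I'$ is the interior of $S^1\setminus I$. $\mathrm{Diff}^+(S^1)$ is the group of orientation preserving smooth diffeomorphisms of $S^1$ with the $C^\infty$ topology, and $\text{Möb}\simeq \mathrm{PSL}(2,\mathbb{R})$ is its subgroup of maps $z\mapsto\frac{az+b}{\bar b z+\bar a}$, $|a|^2-|b|^2=1$. Möbius covariant net. A Möbius covariant net $(\mathcal{A},U)$ on $S^1$ assigns to each $I\in\mathcal{I}$ a von Neumann algebra $\mathcal{A}(I)$ on a fixed complex infinite dimensional separable Hilbert space $\mathcal{H}_{\mathcal{A}}$, together with a strongly continuous unitary representation $U$ of $\text{Möb}$ on $\mathcal{H}_{\mathcal{A}}$, such that: (i) $I_1\subset I_2\Rightarrow\mathcal{A}(I_1)\subset\mathcal{A}(I_2)$; (ii) $I_1\cap I_2=\emptyset\Rightarrow[\mathcal{A}(I_1),\mathcal{A}(I_2)]=0$; (iii) $U(\varphi)\mathcal{A}(I)U(\varphi)^{-1}=\mathcal{A}(\varphi(I))$ for $\varphi\in\text{Möb}$; (iv) the conformal Hamiltonian $L_0$, defined by $U(\theta_\alpha)=e^{i\alpha L_0}$ with $\theta_\alpha$ the anticlockwise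 rotation by $\alpha$, is positive; (v) there is a unique (up to phase) $U$-invariant unit vector $\Omega$ (the vacuum vector); (vi) $\Omega$ is cyclic for $\mathcal{A}(S^1):=\bigvee_{I\in\mathcal{I}}\mathcal{A}(I)$. Isomorphism. Two Möbius covariant nets $(\mathcal{A}_1,U_1)$, $(\mathcal{A}_2,U_2)$ are isomorphic as Möbius covariant nets if there is a unitary $W:\mathcal{H}_{\mathcal{A}_1}\to\mathcal{H}_{\mathcal{A}_2}$ with $W\mathcal{A}_1(I)W^*=\mathcal{A}_2(I)$ for all $I\in\mathcal{I}$ and $WU_1(\varphi)W^*=U_2(\varphi)$ for all $\varphi\in\text{Möb}$. Projective representations. A strongly continuous projective unitary representation of $\mathrm{Diff}^+(S^1)$ on $\mathcal{H}$ is a strongly continuous homomorphism into $\mathcal{U}(\mathcal{H})/\mathbb{T}$; $V(\gamma)$ also denotes a unitary representing its class. Its restriction to $\text{Möb}$ lifts uniquely to a strongly continuous unitary representation of the universal cover of $\text{Möb}$; the generator of rotations of the lift is the conformal Hamiltonian $L_0$, and $V$ is of positive energy if $L_0\ge 0$. Virasoro nets. The admissible central charges are $c\in\{1-\frac{6}{(m+2)(m+3)}: m=1,2,3,\dots\}$ and $c\ge 1$. For such $c$, $V_c=V_{(c,0)}$ is the irreducible positive energy projective representation of $\mathrm{Diff}^+(S^1)$ on $\mathcal{H}_{(c,0)}$ determined by closed operators $L_n$ ($n\in\mathbb{Z}$) such that: the linear span $\mathcal{D}_{fin}$ of the eigenvectors of the conformal Hamiltonian $L_0$ is dense and is an invariant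 core for every $L_n$; $L_n^*=L_{-n}$; $[L_n,L_m]=(n-m)L_{n+m}+\frac{c}{12}(n^3-n)\delta_{-m,n}\mathbf{1}$ on $\mathcal{D}_{fin}$; the lowest eigenvalue of $L_0$ is $0$ with one-dimensional eigenspace spanned by a unit vector $\Omega$, and $L_n\Omega=0$ for $n>0$; and for every real smooth vector field $f(e^{i\vartheta})\frac{d}{d\vartheta}$, with $\hat f_n=\frac1{2\pi}\int_0^{2\pi} e^{-in\alpha}f(e^{i\alpha})\,d\alpha$, the closure $T(f)$ of $\sum_n\hat f_nL_n$ on $\mathcal{D}_{fin}$ is self-adjoint and $e^{iT(f)}=V_c(\mathrm{Exp}(f))$ up to phase, $\mathrm{Exp}(f)$ being the time-one flow of $f$. The Virasoro net is $\mathcal{A}_{\mathrm{Vir},c}(I)=\{V_c(\gamma):\gamma|_{I'}=\mathrm{id}_{I'}\}''$, $I\in\mathcal{I}$; with the restriction of $V_c$ to $\text{Möb}$ it is a Möbius covariant net with vacuum vector $\Omega$. *)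

(* Defs.v *)
From HB Require Import structures.
From mathcomp Require Import all_boot all_order all_algebra.
From mathcomp Require Import finmap complex.
From mathcomp Require Import all_classical all_reals all_analysis.
From mathcomp Require Import summability.

Set Implicit Arguments.
Unset Strict Implicit.
Unset Printing Implicit Defensive.

Import Order.TTheory GRing.Theory Num.Theory numFieldNormedType.Exports.
Local Open Scope classical_set_scope.
Local Open Scope complex_scope.
Local Open Scope ring_scope.

(* The ascription gives R[i] its normed topology. *)
Notation Cplx R := (R[i] : numFieldType).

Section Circle.
Variable R : realType.

Definition circle : Type := [set z : Cplx R | `|z| = 1].

Definition cval (z : circle) : Cplx R := \val z.

Definition expi (t : R) : R[i] := cos t +i* sin t.

Lemma norm_expi (t : R) : `|expi t| = 1.
Proof.
by rewrite /expi normc_def cos2Dsin2 sqrtr1.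
Qed.

Lemma rot_subproof (t : R) (z : circle) :
  expi t * cval z \in [set z : Cplx R | `|z| = 1].
Proof.
apply/mem_set; have /= hz := set_valP z.
by rewrite /= normrM norm_expi mul1r.
Qed.

Definition rot (t : R) (z : circle) : circle := SigSub (rot_subproof t z).

Lemma cis_subproof (t : R) : expi t \in [set z : Cplx R | `|z| = 1].
Proof. by apply/mem_set; exact: norm_expi. Qed.

Definition cis (t : R) : circle := SigSub (cis_subproof t).

Definition is_arc (I : set circle) : Prop :=
  [/\ open I, I !=set0, connected I & ~ dense I].

Definition opposite (I : set circle) : set circle := (~` I)^°.

Definition smooth (f : R -> R) : Prop :=
  forall (k : nat) (t : R), derivable (derive1n k f) t 1.

Definition re_trace (g : circle -> circle) (t : R) : R :=
  complex.Re (cval (g (cis t))).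
Definition im_trace (g : circle -> circle) (t : R) : R :=
  complex.Im (cval (g (cis t))).

Definition smooth_map (g : circle -> circle) : Prop :=
  smooth (re_trace g) /\ smooth (im_trace g).

(* With g(e^(it)) = x + iy, the quantity x y' - y x' is the derivative of the
   argument of g(e^(it)). *)
Definition orientation_preserving (g : circle -> circle) : Prop :=
  forall t : R, 0 < re_trace g t * derive1 (im_trace g) t
                    - im_trace g t * derive1 (re_trace g) t.

Definition diff_plus : set (circle -> circle) :=
  [set g | [/\ smooth_map g, orientation_preserving g &
     exists h, [/\ smooth_map h, cancel g h & cancel h g]]].

Definition mob : set (circle -> circle) :=
  [set g | exists a b : R[i], `|a| ^+ 2 - `|b| ^+ 2 = 1 /\
     forall z, cval (g z) = (a * cval z + b) / (b^* * cval z + a^*)].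

(* The C^infty topology: uniform convergence of every derivative with respect
   to the angle. It is only meaningful on smooth maps, derive1n being a total
   function, and is only used through subspaces of diff_plus. *)
Definition derivatives (g : circle -> circle) :
    prod_topology (fun _ : nat => {uniform R -> Cplx R}) :=
  fun k t => derive1n k (re_trace g) t +i* derive1n k (im_trace g) t.

Definition circle_map : Type := initial_topology derivatives.
HB.instance Definition _ :=
  Topological.copy circle_map (initial_topology derivatives).

(* The universal cover of mob, realised as the group of the lifts to the real
   line of its elements. *)
Definition mob_cover : set {uniform R -> R} :=
  [set a | continuous (a : R -> R) /\
     exists2 g, mob g & forall t, cis (a t) = g (cis t)].

Definition time_one_flow (f : circle -> R) (g : circle -> circle) : Prop :=
  exists F : R -> circle -> circle,
    [/\ F 0 = id, F 1 = g &
      forall (t : R) (z : circle),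
        let w := 'i * (f (F t z))%:C * cval (F t z) in
        is_derive t 1 (fun s => complex.Re (cval (F s z))) (complex.Re w) /\
        is_derive t 1 (fun s => complex.Im (cval (F s z))) (complex.Im w)].

Definition fourier (f : circle -> R) (n : int) : R[i] :=
  let h (t : R) : R[i] := expi (- (n%:~R * t)) * (f (cis t))%:C in
  ((2 * pi)^-1)%:C *
  ((\int[lebesgue_measure]_(t in `[0, 2 * pi]) complex.Re (h t))
   +i* (\int[lebesgue_measure]_(t in `[0, 2 * pi]) complex.Im (h t))).

End Circle.

Record hilbert (R : realType) := Hilbert {
  hilbert_sort :> completeNormedModType R[i];
  hdot : {dot hilbert_sort for Num.conj};
  hdotE : forall x : hilbert_sort, hdot x x = `|x| ^+ 2 }.

Arguments hdot {R h}.

Section Operators.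
Variable R : realType.
Implicit Types H : hilbert R.

Definition separable H : Prop := exists2 D : set H, countable D & dense D.

Definition infinite_dim H : Prop :=
  forall (n : nat) (e : 'I_n -> H),
    ~ (forall x : H, exists a : 'I_n -> R[i], x = \sum_i a i *: e i).

Definition linspan H (S : set H) : set H :=
  [set v | exists (n : nat) (a : 'I_n -> R[i]) (e : 'I_n -> H),
     (forall i, S (e i)) /\ v = \sum_i a i *: e i].

Definition bounded_op H : set (H -> H) :=
  [set a | linear a /\ continuous a].

Definition unitary (H1 H2 : hilbert R) (W : H1 -> H2) : Prop :=
  [/\ linear W, forall x y, hdot (W x) (W y) = hdot x y
    & forall y, exists x, W x = y].

Definition adj (H1 H2 : hilbert R) (W : H1 -> H2) (y : H2) : H1 :=
  xget 0 [set z | forall x, hdot (W x) y = hdot x z].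

Definition commutant H (S : set (H -> H)) : set (H -> H) :=
  [set a | bounded_op a /\ forall b, S b -> a \o b = b \o a].

Definition von_neumann H (M : set (H -> H)) : Prop :=
  [/\ M `<=` @bounded_op H, forall a, M a -> M (adj a)
    & commutant (commutant M) = M].

Definition up_to_phase H (u v : H -> H) : Prop :=
  exists l : R[i], `|l| = 1 /\ forall x, u x = l *: v x.

(* Unbounded operators are represented by their graphs. *)
Definition is_operator H (T : set (H * H)) : Prop :=
  [/\ T (0, 0),
      forall (a : R[i]) p q, T p -> T q -> T (a *: p.1 + q.1, a *: p.2 + q.2)
    & forall y, T (0, y) -> y = 0].

Definition closed_operator H (T : set (H * H)) : Prop :=
  is_operator T /\ closed T.

Definition op_dom H (T : set (H * H)) : set H := fst @` T.

Definition app H (T : set (H * H)) (x : H) : H := xget 0 [set y | T (x, y)].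

Definition op_restr H (T : set (H * H)) (D : set H) : set (H * H) :=
  [set p | D p.1 /\ T p].

Definition op_adjoint H (T : set (H * H)) : set (H * H) :=
  [set p | forall q, T q -> hdot q.2 p.1 = hdot q.1 p.2].

Definition self_adjoint H (T : set (H * H)) : Prop :=
  [/\ is_operator T, dense (op_dom T) & op_adjoint T = T].

Definition positive_op H (T : set (H * H)) : Prop :=
  forall p, T p -> 0 <= hdot p.2 p.1.

Definition eigenvector H (T : set (H * H)) (l : R[i]) (x : H) : Prop :=
  x != 0 /\ T (x, l *: x).

Definition finite_energy H (T : set (H * H)) : set H :=
  linspan [set x | exists l, eigenvector T l x].

(* Strongly continuous unitary representation of the group G with law mul. *)
Definition unitary_rep H (X : topologicalType) (G : set X) (mul : X -> X -> X)
    (U : X -> H -> H) : Prop :=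
  [/\ forall g, G g -> unitary (U g),
      forall g h, G g -> G h -> U (mul g h) = U g \o U h
    & forall x, {within G, continuous (fun g => U g x)}].

(* The graph of the T such that W t = e^(itT) for all t (Stone's theorem). *)
Definition generator H (W : R -> H -> H) : set (H * H) :=
  [set p | (('i * t%:C)^-1 *: (W t p.1 - p.1)) @[t --> 0^'] --> p.2].

Definition is_exp_i H (T : set (H * H)) (u : H -> H) : Prop :=
  exists W : R -> H -> H,
    [/\ unitary_rep setT +%R W, generator W = T & W 1 = u].

Definition mob_rep H (U : circle_map R -> H -> H) : Prop :=
  unitary_rep (@mob R : set (circle_map R)) (fun g h => g \o h) U.

Definition mob_cover_rep H (U : {uniform R -> R} -> H -> H) : Prop :=
  unitary_rep (@mob_cover R) (fun a b => a \o b) U.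

(* The last clause is continuity for the quotient of the strong operator
   topology on U(H)/T: a neighbourhood of the class of u is the set of the
   classes of the elements of a neighbourhood of u. *)
Definition proj_rep H (V : circle_map R -> H -> H) : Prop :=
  [/\ forall g, diff_plus g -> unitary (V g),
      forall g h, diff_plus g -> diff_plus h ->
        up_to_phase (V (g \o h)) (V g \o V h)
    & forall g, diff_plus g -> forall (s : seq H) (e : R), 0 < e ->
        \forall h \near within (@diff_plus R : set (circle_map R))
                               (nbhs (g : circle_map R)),
          exists l : R[i], `|l| = 1 /\
            forall x, x \in s -> `|l *: V h x - V g x| < e%:C].

Definition irreducible H (V : circle_map R -> H -> H) : Prop :=
  forall K : set H,
    closed K -> K 0 ->
    (forall (a : R[i]) x y, K x -> K y -> K (a *: x + y)) ->
    (forall g x, diff_plus g -> K x -> K (V g x)) ->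
    K = [set 0] \/ K = setT.

Definition mob_cover_lift H (V : circle_map R -> H -> H)
    (U : {uniform R -> R} -> H -> H) : Prop :=
  mob_cover_rep U /\
  forall a g, mob_cover a -> mob g -> (forall t, cis (a t) = g (cis t)) ->
    up_to_phase (U a) (V g).

Definition cover_hamiltonian H (U : {uniform R -> R} -> H -> H) : set (H * H) :=
  generator (fun t => U (fun s => s + t)).

Definition hamiltonian H (U : circle_map R -> H -> H) : set (H * H) :=
  generator (fun t => U (rot t)).

Definition stress_core H (L : int -> set (H * H)) (D : set H)
    (f : circle R -> R) : set (H * H) :=
  [set p | D p.1 /\
     (\sum_(n <- (A : {fset int})) fourier f n *: app (L n) p.1)
       @[A --> totally] --> p.2].

Definition stress H (L : int -> set (H * H)) (D : set H) (f : circle R -> R) :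
    set (H * H) :=
  closure (stress_core L D f).

End Operators.

Record mobius_net (R : realType) := MobiusNet {
  net_space : hilbert R;
  net_alg : set (circle R) -> set (net_space -> net_space);
  net_rep : circle_map R -> net_space -> net_space;
  net_vac : net_space;
  net_infinite_dim : infinite_dim net_space;
  net_separable : separable net_space;
  net_von_neumann : forall I, is_arc I -> von_neumann (net_alg I);
  net_mob_rep : mob_rep net_rep;
  net_isotony : forall I J, is_arc I -> is_arc J -> I `<=` J ->
    net_alg I `<=` net_alg J;
  net_locality : forall I J, is_arc I -> is_arc J -> I `&` J = set0 ->
    forall a b, net_alg I a -> net_alg J b -> a \o b = b \o a;
  net_covariance : forall g I, mob g -> is_arc I ->
    (fun a => net_rep g \o a \o adj (net_rep g)) @` net_alg I
    = net_alg (g @` I);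
  net_positive : positive_op (hamiltonian net_rep);
  net_vac_unit : `|net_vac| = 1;
  net_vac_inv : forall g, mob g -> net_rep g net_vac = net_vac;
  net_vac_unique : forall x, `|x| = 1 ->
    (forall g, mob g -> net_rep g x = x) ->
    exists l : R[i], `|l| = 1 /\ x = l *: net_vac;
  net_cyclic : dense [set a net_vac | a in
    commutant (commutant (\bigcup_(I in @is_arc R) net_alg I))] }.

Arguments net_alg {R} m I.
Arguments net_rep {R} m g.
Arguments net_vac {R} m.

Section Nets.
Variable R : realType.

Definition net_iso (N1 N2 : mobius_net R) : Prop :=
  exists W : net_space N1 -> net_space N2,
    [/\ unitary W,
        forall I, is_arc I ->
          (fun a => W \o a \o adj W) @` net_alg N1 I = net_alg N2 I
      & forall g, mob g ->
          W \o net_rep N1 g \o adj W = net_rep N2 g].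

Definition admissible (c : R) : Prop :=
  (exists m : nat, (0 < m)%N /\ c = 1 - 6 / ((m%:R + 2) * (m%:R + 3)))
  \/ 1 <= c.

(* V is the representation V_(c,0), with the operators L n, the lowest weight
   vector Om, and the lift Ut of its restriction to mob. *)
Record virasoro_rep (c : R) (H : hilbert R) (V : circle_map R -> H -> H)
    (Ut : {uniform R -> R} -> H -> H) (L : int -> set (H * H)) (Om : H) :
    Prop := VirasoroRep {
  vir_proj_rep : proj_rep V;
  vir_irreducible : irreducible V;
  vir_lift : mob_cover_lift V Ut;
  vir_positive : positive_op (cover_hamiltonian Ut);
  vir_L0 : L 0 = cover_hamiltonian Ut;
  vir_closed : forall n, closed_operator (L n);
  vir_dense : dense (finite_energy (L 0));
  vir_invariant : forall n v, finite_energy (L 0) v ->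
    op_dom (L n) v /\ finite_energy (L 0) (app (L n) v);
  vir_core : forall n, closure (op_restr (L n) (finite_energy (L 0))) = L n;
  vir_adjoint : forall n, op_adjoint (L n) = L (- n);
  vir_comm : forall (n m : int) v, finite_energy (L 0) v ->
    app (L n) (app (L m) v) - app (L m) (app (L n) v)
    = (n - m)%:~R *: app (L (n + m)) v
      + (if - m == n then (c / 12 * (n ^+ 3 - n)%:~R)%:C else 0) *: v;
  vir_lowest : forall l x, eigenvector (L 0) l x -> 0 <= l;
  vir_unit : `|Om| = 1;
  vir_ground : [set x | L 0 (x, 0)] = [set a *: Om | a in [set: R[i]]];
  vir_annihil : forall n : int, 0 < n -> L n (Om, 0);
  vir_stress_cvg : forall f, smooth (f \o @cis R) ->
    forall v, finite_energy (L 0) v ->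
      exists w, stress_core L (finite_energy (L 0)) f (v, w);
  vir_stress_sa : forall f, smooth (f \o @cis R) ->
    self_adjoint (stress L (finite_energy (L 0)) f);
  vir_exp : forall f g, smooth (f \o @cis R) -> time_one_flow f g ->
    exists2 u, is_exp_i (stress L (finite_energy (L 0)) f) u
             & up_to_phase u (V g) }.

Definition is_virasoro_net (c : R) (N : mobius_net R) : Prop :=
  exists (V : circle_map R -> net_space N -> net_space N) Ut L,
    [/\ virasoro_rep c V Ut L (net_vac N),
        forall I, is_arc I ->
          net_alg N I = commutant (commutant
            [set V g | g in [set g | diff_plus g /\
                                     forall z, opposite I z -> g z = z]])
      & forall g, mob g -> up_to_phase (net_rep N g) (V g)].

End Nets.

(* Main.v *)
From HB Require Import structures.
From mathcomp Require Import all_boot all_order all_algebra.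
From mathcomp Require Import finmap complex.
From mathcomp Require Import all_classical all_reals all_analysis.
From mathcomp Require Import summability ring lra zify.
Require Import Defs.

Set Implicit Arguments.
Unset Strict Implicit.
Unset Printing Implicit Defensive.

Import Order.TTheory GRing.Theory Num.Theory numFieldNormedType.Exports.
Local Open Scope classical_set_scope.
Local Open Scope complex_scope.
Local Open Scope ring_scope.

(** The central charge is the only parameter of the vacuum representation, and the net
    remembers it.

    If the central charges agree, the commutation relations of the modes L(n) and the
    fact that L(- n) is the adjoint of L(n) determine the inner products of the words in
    the modes applied to the vacuum (words_gram), and these words span a dense subspace
    (words_dense). Hence there is a unitary W between the two spaces that matches vacua
    and modes. It matches the stress tensors, hence the flows of the fields conjugate to
    the rotation field (flow_intertwine). For an arbitrary diffeomorphism g, the unitary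
    W^-1 V2(g)^-1 W V1(g) commutes up to phases with all these flows, and such a unitary
    is a scalar (schur): by positivity of the energy it has the translates of the vacuum
    as eigenvectors, its eigenvalue on them is constant because the group of
    diffeomorphisms is connected, and irreducibility does the rest. Thus W V1(g) and V2(g) W agree up to a phase, which is
    enough to match the local algebras. On Moebius maps both sides fix the vacuum and
    there is no phase (same_charge_iso).

    Conversely, an isomorphism of the nets matches the Moebius representations. Moving
    everything to one space, one gets two families of modes, L and L', with the same
    members of index - 1 and 0 (mobius_mode0, mobius_modeN1). This forces
    L'(n) Om = lam L(n) Om for all n <= - 2 with one constant lam (modes_proportional), and
    lam = 1 suffices, because the square norm of L(-2) Om is half of the central charge
    (vm_norm_mode). Let g be a field equal to the rotation field outside a small arc, with
    stress tensors T and T'. For small r and s, exp(i s T) exp(- i s L(0)) belongs to the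
    algebra of the arc, and so does exp(i s T') exp(- i s L(0)); they commute with the
    copies of exp(i r T) exp(- i r L(0)) rotated by a quarter to three quarters of a turn.
    The derivatives in s and r of this commutation, between the vacuum and v = L(-2) Om
    (local_pairing), show that exp(i t L(0)) T Om is orthogonal to the vector
    y = (T' - L(0)) v - conj(lam) (T - L(0)) v for all t with cos t <= 0. Since the energy
    is positive, this pairing is a power series in exp(i t). It vanishes on half of the
    circle, hence identically (half_circle_uniqueness). Its coefficient of index 2 is a
    nonzero multiple of the conjugate of <y, v> = 2 (g_0 - 1) (1 - conj(lam)) |v|^2, where
    the mean g_0 of g is not 1 (fourier_bumped), whence lam = 1 (central_charge_eq). *)

(** * Smooth functions on the line *)

Section Smooth.
Variable R : realType.
Implicit Types (f g a b : R -> R).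

(** Sealing smoothness in a datatype stops its unfolding into limits. *)
Variant Csmooth f : Prop := CsmoothI of smooth f.

Lemma CsmoothW f : Csmooth f -> smooth f.
Proof. by case. Qed.

(** A class of functions closed under derivation consists of smooth functions: the
    way in which all the smoothness statements below are obtained. *)
Lemma smooth_class (C : set (R -> R)) :
  (forall f, C f -> exists2 g, C g & forall t, is_derive t (1 : R) f (g t)) ->
  C `<=` Csmooth.
Proof.
move=> CC f Cf; constructor=> k.
suff [g Cg <-] : exists2 g, C g & g = derive1n k f.
  move=> t; have [g' _ dg] := CC _ Cg; exact: (@ex_derive _ _ _ _ _ _ _ (dg t)).
elim: k => [|k [g Cg gE]]; first by exists f.
have [g' Cg' dg] := CC _ Cg; exists g' => //.
rewrite derive1nS -gE; apply/funext => t; rewrite derive1E.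
by have := dg t => -[_ <-].
Qed.

Lemma smooth_derive f : Csmooth f -> Csmooth (derive1 f).
Proof.
case=> sf; constructor=> k t; have := sf k.+1 t.
by rewrite /derive1n iterSr.
Qed.

Lemma smooth_is_derive f : Csmooth f -> forall t, is_derive t (1 : R) f (derive1 f t).
Proof. by case=> sf t; apply: DeriveDef; [exact: (sf 0%N t)|rewrite derive1E]. Qed.

Lemma is_derive_derive1 f g : (forall t, is_derive t (1 : R) f (g t)) -> derive1 f = g.
Proof. by move=> fg; apply/funext => t; rewrite derive1E; case: (fg t). Qed.

Lemma smooth_primitive f g : Csmooth g -> (forall t, is_derive t (1 : R) f (g t)) ->
  Csmooth f.
Proof.
move=> sg fg; apply: (@smooth_class [set h | h = f \/ Csmooth h]); last by left.
move=> h /= [->|sh]; first by exists g => //; right.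
exists (derive1 h); first by right; exact: smooth_derive.
exact: smooth_is_derive.
Qed.

(** Being closed under derivation, this class makes one induction prove all the
    closure properties of smooth functions. *)
Inductive smooth_expr : (R -> R) -> Prop :=
| SBase f of Csmooth f : smooth_expr f
| SAdd f g of smooth_expr f & smooth_expr g : smooth_expr (fun t => f t + g t)
| SMul f g of smooth_expr f & smooth_expr g : smooth_expr (fun t => f t * g t)
| SInv f of smooth_expr f & (forall t, f t != 0) : smooth_expr (fun t => (f t)^-1)
| SComp f g of Csmooth f & smooth_expr g : smooth_expr (fun t => f (g t)).

Lemma smooth_cst (c : R) : Csmooth (fun=> c : R).
Proof.
apply: (@smooth_class [set h | exists c : R, h = fun=> c]); last by exists c.
move=> _ /= [d ->]; exists (fun=> 0); first by exists 0.
move=> t; exact: is_derive_cst.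
Qed.

Lemma smooth_exprP f : smooth_expr f -> Csmooth f.
Proof.
apply: smooth_class => {}f; elim=> {f}.
- move=> f sf; exists (derive1 f); last exact: smooth_is_derive.
  exact/SBase/smooth_derive.
- move=> f g _ [f' sf' df] _ [g' sg' dg].
  by exists (fun t => f' t + g' t); [exact: SAdd|move=> t; exact: is_deriveD].
- move=> f g sf [f' sf' df] sg [g' sg' dg].
  exists (fun t => f t * g' t + g t * f' t); first by apply: SAdd; apply: SMul.
  by move=> t; exact: is_deriveM.
- move=> f sf [f' sf' df] f0.
  exists (fun t => -1 * ((f t)^-1 * (f t)^-1) * f' t).
    apply: SMul => //; apply: SMul; first exact/SBase/smooth_cst.
    by apply: SMul; apply: SInv.
  move=> t; have := @is_deriveV R f t (f' t) 1 (f0 t) (df t).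
  move/is_derive_eq; apply; by rewrite /GRing.scale /= mulN1r expr2 invfM.
- move=> f g sf sg [g' sg' dg]; exists (fun t => derive1 f (g t) * g' t).
    by refine (SMul (SComp _ sg) sg'); exact: smooth_derive.
  by move=> t; apply: is_derive1_comp; exact: smooth_is_derive.
Qed.

Lemma smooth_id : Csmooth (id : R -> R).
Proof. apply: (@smooth_primitive id (fun=> 1)); first exact: smooth_cst. Qed.

Lemma smoothD f g : Csmooth f -> Csmooth g -> Csmooth (fun t => f t + g t).
Proof. by move=> sf sg; apply/smooth_exprP/SAdd; apply: SBase. Qed.

Lemma smoothM f g : Csmooth f -> Csmooth g -> Csmooth (fun t => f t * g t).
Proof. by move=> sf sg; apply/smooth_exprP/SMul; apply: SBase. Qed.

Lemma smoothN f : Csmooth f -> Csmooth (fun t => - f t).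
Proof.
move=> sf; rewrite (_ : (fun=> _) = fun t => -1 * f t).
  exact: smoothM (smooth_cst (-1)) sf.
by apply/funext => t; rewrite mulN1r.
Qed.

Lemma smoothB f g : Csmooth f -> Csmooth g -> Csmooth (fun t => f t - g t).
Proof. move=> sf sg; exact: smoothD sf (smoothN sg). Qed.

Lemma smoothV f : Csmooth f -> (forall t, f t != 0) -> Csmooth (fun t => (f t)^-1).
Proof. by move=> sf f0; apply/smooth_exprP/SInv => //; apply: SBase. Qed.

Lemma smooth_comp f g : Csmooth f -> Csmooth g -> Csmooth (fun t => f (g t)).
Proof. by move=> sf sg; apply/smooth_exprP/SComp => //; apply: SBase. Qed.

Lemma smooth_sincos : Csmooth (@sin R) /\ Csmooth (@cos R).
Proof.
have H : [set h : R -> R | exists a b : R, h = fun t => a * sin t + b * cos t]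
   `<=` Csmooth.
  apply: smooth_class => _ /= [x [y ->]].
  exists (fun t => (- y) * sin t + x * cos t); first by exists (- y), x.
  move=> t; apply: is_derive_eq.
  by rewrite /GRing.scale /=; ring.
split; apply: H; [exists 1, 0|exists 0, 1]; apply/funext => t; ring.
Qed.

Lemma smooth_sin : Csmooth (@sin R). Proof. by case: smooth_sincos. Qed.
Lemma smooth_cos : Csmooth (@cos R). Proof. by case: smooth_sincos. Qed.

Lemma smooth_continuous f : Csmooth f -> continuous f.
Proof.
case=> sf t; apply: differentiable_continuous; apply/derivable1_diffP.
exact: (sf 0%N t).
Qed.

(** The derivative of F o b is (F' / a') o b, so that the functions of b form a class
    closed under derivation. *)
Lemma smooth_inverse a b : Csmooth a -> (forall t, derive1 a t != 0) ->
  cancel a b -> cancel b a -> Csmooth b /\ forall t, is_derive t (1 : R) b (derive1 a (b t))^-1.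
Proof.
move=> sa a0 ab ba.
have db t : is_derive t (1 : R) b (derive1 a (b t))^-1.
  rewrite -{1}(ba t); apply: is_derive_inverse => //.
  - by near=> x; exact: ab.
  - near=> x; exact: smooth_continuous.
  - exact: smooth_is_derive.
split; last exact: db.
apply: (@smooth_class [set h | exists2 F, Csmooth F & h = F \o b]); last first.
  by exists id; first exact: smooth_id.
move=> _ /= [F sF ->]; exists ((fun t => derive1 F t * (derive1 a t)^-1) \o b).
  eexists; last by reflexivity.
  apply: smoothM; first exact: smooth_derive.
  apply: smoothV; [exact: smooth_derive|exact: a0].
move=> t; apply: (@is_derive1_comp _ F b) => //; exact: smooth_is_derive.
Unshelve. all: by end_near. Qed.

Lemma mono_derive a : Csmooth a -> (forall t, 0 < derive1 a t) -> {homo a : x y / x < y}.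
Proof.
move=> sa a0 x y xy.
have [||c _ E] := @MVT R a (derive1 a) x y xy.
- by move=> z _; exact: smooth_is_derive.
- exact/continuous_subspaceT/smooth_continuous.
- by rewrite -subr_gt0 E mulr_gt0 // subr_gt0.
Qed.

Lemma derive0_cst f g : (forall t, is_derive t (1 : R) f (g t)) -> (forall t, g t = 0) ->
  forall x y, f x = f y.
Proof. by move=> fg g0 x y; apply: is_derive_0_is_cst => t; rewrite -(g0 t). Qed.

Lemma MVT_closed f g (x y : R) : x <= y ->
  (forall t, x <= t <= y -> is_derive t (1 : R) f (g t)) ->
  exists2 c, x <= c <= y & f y - f x = g c * (y - x).
Proof.
move=> xy fg.
have [||c cxy E] := @MVT_segment R f g x y xy.
- by move=> t /subset_itv_oo_cc; rewrite in_itv; exact: fg.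
- apply: derivable_within_continuous => t; rewrite in_itv => /fg [].
  by [].
- by exists c => //; move: cxy; rewrite in_itv.
Qed.

(** The integral from - n to x is a primitive on ]- n, +oo[; normalized
    to vanish at 0, these primitives agree on their common domain. *)
Lemma continuous_primitive f : continuous f ->
  exists F : R -> R, forall t, is_derive t (1 : R) F (f t).
Proof.
move=> cf; pose G (n x : R) := \int[lebesgue_measure]_(t in `[- n, x]) f t.
have dG (n x : R) : - n < x -> is_derive x (1 : R) (G n) (f x).
  move=> nx; have := @continuous_FTC1_closed R f (- n) x (x + 1).
  rewrite ltrDl ltr01 => /(_ isT); case.
  - apply: continuous_compact_integrable; first exact: segment_compact.
    exact: continuous_subspaceT.
  - exact: nx.
  - exact: cf.
  by move=> d E; apply: DeriveDef; [exact: d|rewrite -derive1E E].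
have GG (n m y : R) : `|y| < n -> `|y| < m -> G m y - G m 0 = G n y - G n 0.
  move=> yn ym; pose D x := G m x - G n x.
  suff : D y = D 0 by rewrite /D => E; lra.
  have dD (x : R) : - n < x -> - m < x -> is_derive x (1 : R) D 0.
    move=> nx mx; rewrite -(subrr (f x)).
    by apply: is_deriveB; apply: dG.
  have [n0 m0] : 0 < n /\ 0 < m by have := normr_ge0 y; lra.
  have /andP[yn1 _] : - n < y < n by rewrite -ltr_norml.
  have /andP[ym1 _] : - m < y < m by rewrite -ltr_norml.
  have [y0|/ltW y0] := leP y 0.
    have [|c _] := MVT_closed (g := fun=> 0) (f := D) y0.
      by move=> t /andP[? ?]; apply: dD; lra.
    by rewrite mul0r => /eqP; rewrite subr_eq0 => /eqP ->.
  have [|c _] := MVT_closed (g := fun=> 0) (f := D) y0.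
    by move=> t /andP[? ?]; apply: dD; lra.
  by rewrite mul0r => /eqP; rewrite subr_eq0 => /eqP.
pose F x := G (`|x| + 1) x - G (`|x| + 1) 0.
exists F => x.
apply: (@near_eq_is_derive R R^o R^o (fun y => G (`|x| + 1) y - G (`|x| + 1) 0)).
  have xp : `|x| < `|x| + 1 by rewrite ltrDl.
  near=> y; apply: GG; first by rewrite ltrDl.
  near: y.
  have := @norm_continuous _ R^o x.
  by move/cvgrPdist_lt => /(_ 1 ltr01); apply: filterS => y /=; rewrite ltr_distl; lra.
rewrite -[f x]subr0; apply: is_deriveB; apply: dG.
have := ler_normr x (`|x|); have := ler_norm (- x); rewrite normrN; lra.
Unshelve. all: by end_near. Qed.

(** From 1 + x <= exp x at x = y / n. *)
Lemma exprn_le_expR (n : nat) (y : R) : 0 <= y -> y ^+ n <= n%:R ^+ n * expR y.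
Proof.
move=> y0; case: n => [|n]; first by rewrite !expr0 mul1r -expR0 ler_expR.
have n0 : 0 < (n.+1%:R : R) by rewrite ltr0n.
have -> : y = (y / n.+1%:R) * n.+1%:R by rewrite divfK // gt_eqF.
rewrite exprMn mulrC expRM_natr ler_pM2l ?exprn_gt0 //.
apply: lerXn2r; rewrite ?nnegrE ?expR_ge0 ?divr_ge0 //.
by apply: le_trans (expR_ge1Dx _); rewrite lerDr.
Qed.

(** Flat at the origin: the standard smooth function with support [0, +oo[. *)
Definition bump (x : R) : R := if 0 < x then expR (- x^-1) else 0.

Definition poly_bump (p : {poly R}) (x : R) : R := p.[x^-1] * bump x.

(** The exponential beats every power of 1 / x at the origin. *)
Lemma poly_bump_small (p : {poly R}) : exists2 M : R, 0 <= M &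
  forall x, `|poly_bump p x| <= M * x ^+ 2.
Proof.
exists (\sum_(i < size p) `|p`_i| * i.+2%:R ^+ i.+2).
  by apply: sumr_ge0 => i _; rewrite mulr_ge0 // exprn_ge0.
move=> x; rewrite /poly_bump /bump; case: ltP => x0; last first.
  rewrite mulr0 normr0 mulr_ge0 ?sqr_ge0 //.
  by apply: sumr_ge0 => i _; rewrite mulr_ge0 // exprn_ge0.
rewrite normrM (ger0_norm (expR_ge0 _)) horner_coef.
apply: (@le_trans _ _ ((\sum_(i < size p) `|p`_i| * x^-1 ^+ i) * expR (- x^-1))).
  rewrite ler_wpM2r ?expR_ge0 //; apply: (le_trans (ler_norm_sum _ _ _)).
  apply: ler_sum => i _; rewrite normrM normrX (@ger0_norm _ x^-1) //.
  by rewrite invr_ge0 ltW.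
rewrite !mulr_suml; apply: ler_sum => i _.
rewrite -[X in X <= _]mulrA -[X in _ <= X]mulrA ler_wpM2l //.
have xV : 0 <= x^-1 by rewrite invr_ge0 ltW.
have := exprn_le_expR i.+2 xV; move: (i.+2%:R ^+ i.+2) => K.
rewrite expRN -(ler_pM2r (exprn_gt0 2 x0)) => H.
rewrite ler_pdivrMr ?expR_gt0 //; apply: le_trans (_ : _ <= x^-1 ^+ i.+2 * x ^+ 2) _.
  by rewrite -addn2 exprD -mulrA -exprMn mulVf ?gt_eqF // expr1n mulr1.
by rewrite [X in _ <= X]mulrAC.
Qed.

Lemma is_derive_small f (M : R) : (forall x, `|f x| <= M * x ^+ 2) ->
  is_derive (0 : R) (1 : R) f 0.
Proof.
move=> fM; have M0 : 0 <= M by have := fM 1; rewrite expr1n mulr1; apply: le_trans.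
have f0 : f 0 = 0 by apply/eqP; rewrite -normr_le0 (le_trans (fM 0)) // expr0n mulr0.
have H : (fun h : R => h^-1 *: ((f \o shift 0) (h *: 1) - f 0)) @ 0^' --> (0 : R).
  apply/cvgr0Pnorm_lt => e e0.
  have M1 : 0 < M + 1 by rewrite ltr_wpDl.
  near=> h.
  have h0 : h != 0 by near: h; exact: nbhs_dnbhs_neq.
  rewrite /= addr0 f0 subr0 /GRing.scale /= mulr1.
  rewrite normrM normfV ltr_pdivrMl ?normr_gt0 //.
  apply: (le_lt_trans (fM h)); rewrite -real_normK ?num_real // expr2 mulrCA.
  rewrite ltr_pM2l ?normr_gt0 //.
  apply: (@le_lt_trans _ _ ((M + 1) * `|h|)); first by rewrite ler_wpM2r // lerDl.
  rewrite mulrC -ltr_pdivlMr //; near: h.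
  apply: dnbhs0_lt; exact: divr_gt0.
by split; [apply/cvg_ex; exists 0|exact: cvg_lim H].
Unshelve. all: by end_near. Qed.

(** The products of bump by the polynomials in 1 / x are closed under derivation. *)
Lemma bump_smooth : Csmooth bump.
Proof.
apply: (@smooth_class [set h | exists p, h = poly_bump p]); last first.
  by exists 1; apply/funext => x; rewrite /poly_bump hornerC mul1r.
move=> _ /= [p ->]; pose q := ('X^2 * (p - p^`()%R)) : {poly R}.
exists (poly_bump q); first by exists q.
move=> x; have [x0|x0|->] := ltgtP x 0.
- apply: (@near_eq_is_derive R R^o R^o (fun=> 0)).
    near=> y; rewrite /poly_bump /bump ifF ?mulr0 //; apply/negbTE; rewrite -leNgt.
    by apply: ltW; near: y; exact: lt_nbhsl.
  rewrite /poly_bump /bump ifF ?mulr0; last by rewrite lt_gtF.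
  exact: is_derive_cst.
- apply: (@near_eq_is_derive R R^o R^o (fun y => p.[y^-1] * expR (- y^-1))).
    near=> y; rewrite /poly_bump /bump ifT //.
    by near: y; exact: lt_nbhsr.
  have dV : is_derive x (1 : R) (fun y => y^-1) (- x ^- 2).
    have := @is_deriveV R id x 1 1 (lt0r_neq0 x0) (is_derive_id _ _).
    by rewrite /GRing.scale /= mulr1.
  have dp : is_derive x (1 : R) (fun y => p.[y^-1]) (p^`()%R.[x^-1] * (- x ^- 2)).
    by apply: (@is_derive1_comp _ (horner p) (fun y => y^-1)).
  have de : is_derive x (1 : R) (fun y => expR (- y^-1)) (expR (- x^-1) * (x ^- 2)).
    apply: (@is_derive1_comp _ expR (fun y => - y^-1)).
    by rewrite -[x ^- 2]opprK; apply: is_deriveN.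
  have /is_derive_eq := is_deriveM dp de; apply.
  rewrite /poly_bump /bump x0 /q hornerM hornerXn hornerD hornerN exprVn /GRing.scale /=.
  ring.
- have [M _ H] := poly_bump_small p.
  rewrite {2}/poly_bump /bump ltxx mulr0; exact: (is_derive_small H).
Unshelve. all: by end_near. Qed.

Lemma bump_gt0 x : 0 < x -> 0 < bump x.
Proof. by move=> x0; rewrite /bump x0 expR_gt0. Qed.

Lemma bump_eq0 x : x <= 0 -> bump x = 0.
Proof. by rewrite /bump ltNge => ->. Qed.

Lemma bump_ge0 x : 0 <= bump x.
Proof. by case: (leP x 0) => [/bump_eq0 ->|/bump_gt0/ltW]. Qed.

End Smooth.

(** * Circle diffeomorphisms and their lifts *)

Section CircleBasics.
Variable R : realType.
Implicit Types (s t : R) (z w : circle R).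

Lemma cval_inj : injective (@cval R).
Proof. exact: val_inj. Qed.

Lemma eq_cis z t : complex.Re (cval z) = cos t -> complex.Im (cval z) = sin t ->
  z = cis t.
Proof.
by move=> zr zi; apply: cval_inj; apply/eqP; rewrite eq_complex /= zr zi !eqxx.
Qed.

Lemma norm_cval z : `|cval z| = 1.
Proof. exact: set_valP z. Qed.

Lemma expiD s t : expi (s + t) = expi s * expi t.
Proof.
apply/eqP; rewrite eq_complex /= cosD sinD eqxx /= addrC.
by rewrite [sin s * _]mulrC.
Qed.

Lemma expi0 : expi (0 : R) = 1.
Proof. by rewrite /expi cos0 sin0. Qed.

Lemma expi2pi t : expi (t + 2 * pi) = expi t.
Proof. by rewrite /expi mulr_natl cosD2pi sinD2pi. Qed.

Lemma cis2pi t : cis (t + 2 * pi) = cis t.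
Proof. by apply: cval_inj; exact: expi2pi. Qed.

Lemma rot_cis s t : rot s (cis t) = cis (s + t).
Proof. by apply: cval_inj; rewrite /= /cval /= expiD. Qed.

Lemma cis_surj z : exists t, z = cis t.
Proof.
have := norm_cval z; case E : (cval z) => [x y]; rewrite normc_def /=.
move=> /(congr1 (@complex.Re R)) /= xy1.
have xy : x ^+ 2 + y ^+ 2 = 1.
  by rewrite -[LHS]sqr_sqrtr ?addr_ge0 ?sqr_ge0 // xy1 expr1n.
have x1 : -1 <= x <= 1.
  by rewrite -ler_norml -(@expr_le1 _ 2) // real_normK ?num_real // -xy lerDl sqr_ge0.
have cx : cos (acos x) = x by rewrite acosK // in_itv.
have sx : sin (acos x) = `|y| by rewrite sin_acos // -xy [x ^+ 2 + _]addrC addrK sqrtr_sqr.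
have [y0|y0] := leP 0 y.
  exists (acos x); apply: cval_inj; rewrite E /= /cval /= /expi cx sx.
  by rewrite ger0_norm.
exists (- acos x); apply: cval_inj; rewrite E /= /cval /= /expi cosN sinN cx sx.
by rewrite ltr0_norm // opprK.
Qed.

Lemma cos_eq1_lt2pi t : 0 <= t < 2 * pi -> cos t = 1 -> t = 0.
Proof.
move=> /andP[t0 t2] ct; apply/eqP; rewrite eq_le t0 andbT leNgt; apply/negP => tp.
have := @sin_gt0_pi R (t / 2); have := pi_gt0 R.
move=> p0 /(_ ltac:(lra)) s0.
have : cos t = 1 - 2 * sin (t / 2) ^+ 2.
  rewrite [in LHS](_ : t = t / 2 + t / 2); last lra.
  by rewrite cosD; have := cos2Dsin2 (t / 2); lra.
rewrite ct => E.
suff : sin (t / 2) ^+ 2 > 0 by lra.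
by rewrite exprn_gt0.
Qed.

Lemma periodic_int (T : Type) (f : R -> T) : (forall t, f (t + 2 * pi) = f t) ->
  forall (k : int) t, f (t + 2 * pi * k%:~R) = f t.
Proof.
move=> f2 k t.
have fn (n : nat) u : f (u + 2 * pi * n%:R) = f u.
  elim: n u => [|n IH] u; first by rewrite mulr0 addr0.
  by rewrite -[n.+1%:R]natr1 mulrDr mulr1 addrA f2 IH.
case: k => n; first exact: fn.
rewrite NegzE -(fn n.+1 (t + _)); congr f; rewrite mulrNz mulrN addrNK //.
Qed.

Lemma cis_int (k : int) t : cis (t + 2 * pi * k%:~R) = cis t.
Proof. by apply: periodic_int => u; exact: cis2pi. Qed.

Lemma cis_eq s t : cis s = cis t -> exists k : int, s = t + 2 * pi * k%:~R.
Proof.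
move=> st.
have p0 : 0 < 2 * pi :> R by rewrite mulr_gt0 // pi_gt0.
pose d := (s - t) / (2 * pi); pose r := s - t - 2 * pi * (Num.floor d)%:~R.
exists (Num.floor d).
suff : r = 0 by rewrite /r; lra.
have dE : s - t = d * (2 * pi) by rewrite divfK // gt_eqF.
apply: cos_eq1_lt2pi.
  have /andP[d1 d2] := floor_itv d.
  rewrite /r dE mulrC -mulrBr.
  rewrite pmulr_rge0 // subr_ge0 d1 /= gtr_pMr // ltrBlDl.
  by move: d2; rewrite intrD addrC.
have : cis (r + t) = cis t.
  by rewrite -[RHS]st -(cis_int (Num.floor d)); congr cis; rewrite /r; lra.
move=> /(congr1 (@cval R)); rewrite /cval /= expiD => E.
have /(congr1 (@complex.Re R)) : expi r = 1.
  apply: (@mulIf _ (expi t)); last by rewrite mul1r.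
  by rewrite -normr_eq0 norm_expi oner_eq0.
by [].
Qed.

Definition angle z : R := sval (cid (cis_surj z)).

Lemma angleK z : cis (angle z) = z.
Proof. by rewrite /angle; case: cid. Qed.

Lemma angle_cis t : exists k : int, angle (cis t) = t + 2 * pi * k%:~R.
Proof. exact/cis_eq/angleK. Qed.

Lemma rotD s t z : rot s (rot t z) = rot (s + t) z.
Proof. by rewrite -(angleK z) !rot_cis addrA. Qed.

Lemma rot0 z : rot 0 z = z.
Proof. by rewrite -(angleK z) rot_cis add0r. Qed.

(** Diffeomorphisms are handled through their lifts: increasing maps of the line
    that commute with the translation by one turn. *)
Record is_lift (b : R -> R) : Prop := IsLift {
  lift_smooth : Csmooth b;
  lift_gt0 : forall t, 0 < derive1 b t;
  lift2pi : forall t, b (t + 2 * pi) = b t + 2 * pi }.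

Lemma lift_int (b : R -> R) (k : int) t : is_lift b ->
  b (t + 2 * pi * k%:~R) = b t + 2 * pi * k%:~R.
Proof.
move=> [_ _ b2]; have := @periodic_int R (fun t => b t - t) _ k t.
move=> H; have := H (fun u => ltac:(rewrite b2; lra)); lra.
Qed.

Definition circle_of_lift (b : R -> R) z := cis (b (angle z)).

Lemma circle_of_lift_cis (b : R -> R) t : is_lift b ->
  circle_of_lift b (cis t) = cis (b t).
Proof.
move=> bl; rewrite /circle_of_lift; have [k ->] := angle_cis t.
by rewrite lift_int // cis_int.
Qed.

(** Quasi-periodicity makes a lift unbounded on both sides, hence onto. *)
Lemma lift_inverse (b : R -> R) : is_lift b ->
  exists a, [/\ is_lift a, cancel a b, cancel b a &
    forall t, is_derive t (1 : R) a (derive1 b (a t))^-1].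
Proof.
move=> bl; have [sb b0 b2] := bl.
have p0 : 0 < 2 * pi :> R by rewrite mulr_gt0 // pi_gt0.
have mb := mono_derive sb b0.
have binj : injective b.
  by move=> x y E; have [/mb|/mb|] := ltgtP x y; rewrite ?E ?ltxx.
have bsurj y : exists x, b x = y.
  pose n := Num.bound ((y - b 0) / (2 * pi)).
  have yn : `|y - b 0| <= 2 * pi * n%:R.
    rewrite mulrC -ler_pdivrMr // -(gtr0_norm p0) -normf_div ltW //.
    exact: unstable.ltr_norm_bound.
  have := lift_int n 0 bl; have := lift_int (- n%:Z) 0 bl.
  rewrite mulrNz !add0r -!pmulrn => bn1 bn2.
  have nn : 2 * pi * - n%:R <= 2 * pi * n%:R :> R.
    by rewrite ler_pM2l //; have : 0 <= (n%:R : R) by []; lra.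
  have [||c _ cE] := @IVT R b (2 * pi * - n%:R) (2 * pi * n%:R) y nn.
  - exact/continuous_subspaceT/smooth_continuous.
  - move: yn; rewrite ler_norml bn1 bn2 ge_min le_max => /andP[y1 y2].
    by apply/andP; split; apply/orP; [left|right]; lra.
  - by exists c.
pose a y := sval (cid (bsurj y)).
have ab : cancel a b by move=> y; rewrite /a; case: cid.
have ba : cancel b a by move=> x; apply: binj; rewrite ab.
have b0' t : derive1 b t != 0 by rewrite gt_eqF.
have [sa da] := smooth_inverse sb b0' ba ab.
exists a; split => //; split => //.
- by move=> t; rewrite (is_derive_derive1 da) invr_gt0.
- by move=> t; apply: binj; rewrite b2 !ab.
Qed.

Lemma lift_translation s : is_lift (fun t => t + s).
Proof.
have D t : is_derive t (1 : R) (fun t => t + s) 1.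
  by rewrite -[X in is_derive _ _ _ X]addr0; apply: is_deriveD.
split.
- exact: smoothD (smooth_id _) (smooth_cst _).
- by move=> t; rewrite (is_derive_derive1 D).
- by move=> t; rewrite addrAC.
Qed.

Lemma lift_comp (a b : R -> R) : is_lift a -> is_lift b -> is_lift (a \o b).
Proof.
move=> [sa a0 a2] [sb b0 b2].
have D t : is_derive t (1 : R) (a \o b) (derive1 a (b t) * derive1 b t).
  by apply: is_derive1_comp; exact: smooth_is_derive.
split.
- exact: smooth_comp.
- by move=> t; rewrite (is_derive_derive1 D) mulr_gt0.
- by move=> t /=; rewrite b2 a2.
Qed.

Lemma circle_of_lift_comp (a b : R -> R) : is_lift a -> is_lift b ->
  circle_of_lift (a \o b) = circle_of_lift a \o circle_of_lift b.
Proof.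
move=> la lb; apply/funext => z; rewrite -(angleK z) /=.
by rewrite !circle_of_lift_cis //; exact: lift_comp.
Qed.

Lemma circle_of_lift_rot s : circle_of_lift (fun t => t + s) = rot s.
Proof.
apply/funext => z; rewrite -(angleK z) circle_of_lift_cis ?rot_cis 1?addrC //.
exact: lift_translation.
Qed.

Lemma smooth_map_lift (b : R -> R) : is_lift b -> smooth_map (circle_of_lift b).
Proof.
move=> lb; split; apply: CsmoothW.
- rewrite (_ : re_trace _ = fun t => cos (b t)).
    exact: smooth_comp (smooth_cos _) (lift_smooth lb).
  by apply/funext => t; rewrite /re_trace circle_of_lift_cis.
- rewrite (_ : im_trace _ = fun t => sin (b t)).
    exact: smooth_comp (smooth_sin _) (lift_smooth lb).
  by apply/funext => t; rewrite /im_trace circle_of_lift_cis.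
Qed.

Lemma trace_wronskian (g : circle R -> circle R) (b : R -> R) (d t : R) :
  re_trace g = cos \o b -> im_trace g = sin \o b -> is_derive t (1 : R) b d ->
  re_trace g t * derive1 (im_trace g) t - im_trace g t * derive1 (re_trace g) t = d.
Proof.
move=> -> -> db /=; rewrite !derive1E.
have [_ ->] := @is_derive1_comp _ cos b t _ _ (is_derive_cos _) db.
have [_ ->] := @is_derive1_comp _ sin b t _ _ (is_derive_sin _) db.
transitivity ((cos (b t) ^+ 2 + sin (b t) ^+ 2) * d); first by ring.
by rewrite cos2Dsin2 mul1r.
Qed.

Lemma re_trace_lift (b : R -> R) : is_lift b ->
  re_trace (circle_of_lift b) = cos \o b.
Proof. by move=> lb; apply/funext => t; rewrite /re_trace circle_of_lift_cis. Qed.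

Lemma im_trace_lift (b : R -> R) : is_lift b ->
  im_trace (circle_of_lift b) = sin \o b.
Proof. by move=> lb; apply/funext => t; rewrite /im_trace circle_of_lift_cis. Qed.

Lemma lift_wronskian (b : R -> R) (g := circle_of_lift b) t : is_lift b ->
  re_trace g t * derive1 (im_trace g) t - im_trace g t * derive1 (re_trace g) t
  = derive1 b t.
Proof.
move=> lb; apply: (trace_wronskian (re_trace_lift lb) (im_trace_lift lb)).
exact/smooth_is_derive/lift_smooth.
Qed.

Lemma diff_plus_lift (b : R -> R) : is_lift b -> diff_plus (circle_of_lift b).
Proof.
move=> lb; split; first exact: smooth_map_lift.
  by move=> t; rewrite lift_wronskian //; exact: lift_gt0.
have [a [la ab ba _]] := lift_inverse lb.
exists (circle_of_lift a); split; first exact: smooth_map_lift.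
- by move=> z; rewrite -(angleK z) !circle_of_lift_cis // ba.
- by move=> z; rewrite -(angleK z) !circle_of_lift_cis // ab.
Qed.

Lemma is_derive_translate f (d s t : R) : is_derive (t + s) (1 : R) f d ->
  is_derive t (1 : R) (fun t => f (t + s)) d.
Proof.
move=> df; rewrite -[d]mulr1; apply: (@is_derive1_comp _ f (fun t => t + s)) => //.
by rewrite -[X in is_derive _ _ _ X]addr0; apply: is_deriveD.
Qed.

Lemma derive1_shift (f : R -> R) (c s : R) : Csmooth f ->
  (forall t, f (t + s) = f t + c) -> forall t, derive1 f (t + s) = derive1 f t.
Proof.
move=> /smooth_is_derive df fs t.
have := is_derive_translate (df (t + s)).
rewrite (_ : (fun t => f (t + _)) = fun t => f t + c); last exact/funext.
have : is_derive t (1 : R) (fun t => f t + c) (derive1 f t + 0).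
  exact: is_deriveD.
by rewrite addr0 => -[_ <-] -[_ <-].
Qed.

Lemma derive1_lift2pi (b : R -> R) t : is_lift b ->
  derive1 b (t + 2 * pi) = derive1 b t.
Proof. by case=> sb _ b2; exact: derive1_shift b2 _. Qed.

Lemma re_im_trace_sqr (g : circle R -> circle R) t :
  re_trace g t ^+ 2 + im_trace g t ^+ 2 = 1.
Proof.
have := add_Re2_Im2 (cval (g (cis t))).
by rewrite norm_cval expr1n => /(congr1 (@complex.Re R)).
Qed.

Lemma eq_is_derive (f : R -> R) (t d d' : R) : is_derive t (1 : R) f d -> d = d' ->
  is_derive t (1 : R) f d'.
Proof. by move=> df <-. Qed.

(** Both (x, y) and (cos b, sin b) turn at the speed p on the unit circle, so that
    their scalar and exterior products are constant. *)
Lemma polar_angle (x y p : R -> R) : Csmooth p ->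
  (forall t, x t ^+ 2 + y t ^+ 2 = 1) ->
  (forall t, is_derive t (1 : R) x (- p t * y t)) ->
  (forall t, is_derive t (1 : R) y (p t * x t)) ->
  exists b, [/\ forall t, is_derive t (1 : R) b (p t),
    x = cos \o b & y = sin \o b].
Proof.
move=> sp xy dx dy.
have [P dP] := continuous_primitive (smooth_continuous sp).
have [z zE] : exists z : circle R, cval z = x 0 +i* y 0.
  have h : x 0 +i* y 0 \in [set z : Cplx R | `|z| = 1].
    by apply/mem_set; rewrite /= normc_def /= xy sqrtr1.
  by exists (SigSub h).
pose b t := angle z + (P t - P 0).
have db t : is_derive t (1 : R) b (p t).
  rewrite (_ : p t = 0 + (p t - 0)); last by rewrite subr0 add0r.
  by apply: is_deriveD; apply: is_deriveB.
have [x0 y0] : x 0 = cos (b 0) /\ y 0 = sin (b 0).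
  rewrite /b subrr addr0; move: zE; rewrite -{1}(angleK z) /cval /=.
  by rewrite /expi => -[-> ->].
have dcos t : is_derive t (1 : R) (fun t => cos (b t)) (- sin (b t) * p t).
  exact: is_derive1_comp.
have dsin t : is_derive t (1 : R) (fun t => sin (b t)) (cos (b t) * p t).
  exact: is_derive1_comp.
pose u t := x t * cos (b t) + y t * sin (b t).
pose v t := y t * cos (b t) - x t * sin (b t).
have u1 t : u t = 1.
  have -> : u t = u 0.
    apply: is_derive_0_is_cst => s.
    have /is_derive_eq := is_deriveD (is_deriveM (dx s) (dcos s)) (is_deriveM (dy s) (dsin s)).
    by apply; rewrite /GRing.scale /=; ring.
  by rewrite /u x0 y0 -!expr2 cos2Dsin2.
have v0 t : v t = 0.
  have -> : v t = v 0.
    apply: is_derive_0_is_cst => s.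
    have /is_derive_eq := is_deriveB (is_deriveM (dy s) (dcos s)) (is_deriveM (dx s) (dsin s)).
    by apply; rewrite /GRing.scale /=; ring.
  by rewrite /v x0 y0 mulrC subrr.
exists b; split=> //; apply/funext => t /=.
  have := cos2Dsin2 (b t); have := u1 t; have := v0 t; rewrite /u /v.
  set c := cos _; set d := sin _ => E1 E2 E3.
  rewrite -[LHS]mulr1 -E3.
  rewrite (_ : _ * _ = (x t * c + y t * d) * c - (y t * c - x t * d) * d); last by ring.
  by rewrite E1 E2; ring.
have := cos2Dsin2 (b t); have := u1 t; have := v0 t; rewrite /u /v.
set c := cos _; set d := sin _ => E1 E2 E3.
rewrite -[LHS]mulr1 -E3.
rewrite (_ : _ * _ = (x t * c + y t * d) * d + (y t * c - x t * d) * c); last by ring.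
by rewrite E1 E2; ring.
Qed.

(** The angle of a circle diffeomorphism is the primitive of x y' - y x'; its
    increase over a period is a positive multiple of 2 pi, and injectivity
    forces that multiple to be one. *)
Lemma lift_of_diff_plus g : diff_plus g ->
  exists2 b, is_lift b & g = circle_of_lift b.
Proof.
move=> [[/CsmoothI sx /CsmoothI sy] op [h [_ gh _]]].
set x := re_trace g in sx *; set y := im_trace g in sy *.
pose p t := x t * derive1 y t - y t * derive1 x t.
have sp : Csmooth p.
  by apply: smoothB; apply: smoothM => //; exact: smooth_derive.
have p0 t : 0 < p t by exact: op.
have xy t : x t ^+ 2 + y t ^+ 2 = 1 by exact: re_im_trace_sqr.
have dx := smooth_is_derive sx; have dy := smooth_is_derive sy.
have xy' t : x t * derive1 x t + y t * derive1 y t = 0.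
  have D : is_derive t (1 : R) (fun t => x t * x t + y t * y t)
     ((x t * derive1 x t + x t * derive1 x t)
       + (y t * derive1 y t + y t * derive1 y t)).
    by apply: is_deriveD; apply: is_deriveM.
  have : derive1 (fun t => x t * x t + y t * y t) t = 0.
    rewrite (_ : (fun _ => _) = fun=> 1) ?derive1_cst //.
    by apply/funext => u; rewrite -(xy u) !expr2.
  by rewrite derive1E; case: D => _ -> ; lra.
have x'E t : derive1 x t = - p t * y t.
  rewrite -[LHS]mulr1 -(xy t) /p.
  by have := congr1 ( *%R (x t)) (xy' t); rewrite mulr0; lra.
have y'E t : derive1 y t = p t * x t.
  rewrite -[LHS]mulr1 -(xy t) /p.
  by have := congr1 ( *%R (y t)) (xy' t); rewrite mulr0; lra.
have [b [db xE yE]] := polar_angle sp xy (fun t => eq_is_derive (dx t) (x'E t))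
  (fun t => eq_is_derive (dy t) (y'E t)).
have sb : Csmooth b by exact: smooth_primitive db.
have gcis t : g (cis t) = cis (b t).
  by apply: eq_cis; [exact: (congr1 (@^~ t) xE)|exact: (congr1 (@^~ t) yE)].
have b'E : derive1 b = p by exact: is_derive_derive1.
have b0 t : 0 < derive1 b t by rewrite b'E.
have mb := mono_derive sb b0.
have p2 : 0 < 2 * pi :> R by rewrite mulr_gt0 // pi_gt0.
have [k kE] : exists k : int, b (0 + 2 * pi) = b 0 + 2 * pi * k%:~R.
  by apply: cis_eq; rewrite -!gcis cis2pi.
have k0 : (0 < k%:~R :> R).
  have : b 0 < b (0 + 2 * pi) by apply: mb; rewrite ltrDl.
  by rewrite kE ltrDl pmulr_rgt0.
have k1 : k = 1.
  apply/eqP; rewrite eq_le -gtz0_ge1 -(ltr0z R) k0 andbT leNgt; apply/negP => k1.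
  have k2 : (1 < k%:~R :> R) by rewrite -[1]/(1%:~R) ltr_int.
  have [||c] := @IVT R b 0 (2 * pi) (b 0 + 2 * pi) (ltW p2).
  - exact/continuous_subspaceT/smooth_continuous.
  - rewrite add0r in kE; rewrite kE ge_min le_max lerDl (ltW p2) /=.
    by rewrite lerD2l ler_pMr // (ltW k2) orbT.
  rewrite in_itv /= => /andP[c0 c2] cE.
  have cis0 : cis c = cis 0.
    by apply: (can_inj gh); rewrite !gcis cE cis2pi.
  have clt : c < 2 * pi.
    rewrite lt_neqAle c2 andbT; apply/eqP => cpi.
    move: cE; rewrite cpi -[2 * pi in LHS]add0r kE => /addrI E.
    by move: k2; rewrite -(ltr_pM2l p2) E mulr1 ltxx.
  have cz : c = 0.
    apply: cos_eq1_lt2pi; first by rewrite c0.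
    by move: cis0 => /(congr1 (@cval R)); rewrite /cval /= => -[-> _]; rewrite cos0.
  by move: cE; rewrite cz => /eqP; rewrite eq_sym -subr_eq0 addrAC subrr add0r gt_eqF.
have lb : is_lift b.
  split => // t.
  have pp s : p (s + 2 * pi) = p s.
    have xp q : x (q + 2 * pi) = x q by rewrite /x /re_trace cis2pi.
    have yp q : y (q + 2 * pi) = y q by rewrite /y /im_trace cis2pi.
    rewrite /p xp yp (@derive1_shift x 0) // => [|q]; last by rewrite addr0.
    by rewrite (@derive1_shift y 0) // => q; rewrite addr0.
  have : b (t + 2 * pi) - b t = b (0 + 2 * pi) - b 0.
    pose e s := b (s + 2 * pi) - b s.
    apply: (@derive0_cst R e (fun s => p (s + 2 * pi) - p s)); last first.
      by move=> s; rewrite pp subrr.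
    move=> s; apply: is_deriveB => //.
    exact: is_derive_translate.
  by rewrite kE k1 mulr1; lra.
exists b => //; apply/funext => z.
by rewrite -(angleK z) gcis circle_of_lift_cis.
Qed.

End CircleBasics.

(** * Conjugates of the rotation flow *)

Section CircleFlows.
Variable R : realType.
Implicit Types (s t : R) (z w : circle R) (a b : R -> R).

(** The image of the rotation field under the diffeomorphism with inverse lift
    b; its flow is the conjugate of the rotation group. *)
Definition lift_field b z : R := (derive1 b (angle z))^-1.

Lemma lift_field_cis b t : is_lift b -> lift_field b (cis t) = (derive1 b t)^-1.
Proof.
move=> bl; rewrite /lift_field; have [k ->] := angle_cis t; congr (_^-1).
by apply: periodic_int => u; exact: derive1_lift2pi.
Qed.

Lemma smooth_lift_field b : is_lift b -> Csmooth (lift_field b \o @cis R).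
Proof.
move=> bl; rewrite (_ : _ \o _ = fun t => (derive1 b t)^-1); last first.
  by apply/funext => t /=; rewrite lift_field_cis.
by case: bl => sb b0 _; apply: smoothV; [exact: smooth_derive|move=> t; rewrite gt_eqF].
Qed.

Definition lift_flow a b s : circle R -> circle R :=
  circle_of_lift (fun t => a (b t + s)).

Lemma lift_flow_lift a b s : is_lift a -> is_lift b ->
  is_lift (fun t => a (b t + s)).
Proof.
by move=> la lb; exact: lift_comp la (lift_comp (lift_translation s) lb).
Qed.

Lemma lift_flowE a b s : is_lift a -> is_lift b ->
  lift_flow a b s = circle_of_lift a \o rot s \o circle_of_lift b.
Proof.
move=> la lb; rewrite -circle_of_lift_rot -compA -!circle_of_lift_comp //.
- exact: lift_comp (lift_translation s) lb.
- exact: lift_translation.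
Qed.

(** In the coordinate b the flow is the translation. *)
Lemma time_one_lift_flow a b (r : R) : is_lift a -> is_lift b ->
  cancel b a -> (forall t, is_derive t (1 : R) a (derive1 b (a t))^-1) ->
  time_one_flow (fun z => r * lift_field b z) (lift_flow a b r).
Proof.
move=> la lb ba da.
exists (fun s => lift_flow a b (r * s)); split.
- apply/funext => z; rewrite -(angleK z) mulr0 /lift_flow circle_of_lift_cis.
    by rewrite addr0 ba.
  exact: lift_flow_lift.
- by rewrite mulr1.
move=> s z; rewrite -(angleK z); set t := angle z.
have E u : lift_flow a b u (cis t) = cis (a (b t + u)).
  by rewrite /lift_flow circle_of_lift_cis //; exact: lift_flow_lift.
set w := 'i * _ * _; set e := a (b t + r * s).
have wE : w = (- (r / derive1 b e) * sin e) +i* ((r / derive1 b e) * cos e).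
  rewrite /w E -/e lift_field_cis //; apply/eqP.
  by rewrite eq_complex /=; apply/andP; split; apply/eqP; ring.
have dr : is_derive s (1 : R) (fun s => b t + r * s) r.
  have := is_deriveD (is_derive_cst (b t) s (1 : R)) (is_deriveZ r (is_derive_id s (1 : R))).
  by rewrite add0r /GRing.scale /= mulr1.
have de : is_derive s (1 : R) (fun s => a (b t + r * s)) (r / derive1 b e).
  by rewrite mulrC; apply: (@is_derive1_comp _ a (fun s => b t + r * s)).
split.
- rewrite (_ : (fun _ => _) = fun s => cos (a (b t + r * s))); last first.
    by apply/funext => u; rewrite E.
  have dcos := @is_derive1_comp _ cos (fun s => a (b t + r * s)) s _ _ (is_derive_cos _) de.
  by apply: eq_is_derive dcos _; rewrite wE /= -/e; ring.
- rewrite (_ : (fun _ => _) = fun s => sin (a (b t + r * s))); last first.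
    by apply/funext => u; rewrite E.
  have dsin := @is_derive1_comp _ sin (fun s => a (b t + r * s)) s _ _ (is_derive_sin _) de.
  by apply: eq_is_derive dsin _; rewrite wE /= -/e; ring.
Qed.

Lemma diff_plus_rot s : diff_plus (@rot R s).
Proof. by rewrite -circle_of_lift_rot; exact/diff_plus_lift/lift_translation. Qed.

Lemma diff_plus_id : diff_plus (id : circle R -> circle R).
Proof.
rewrite (_ : id = rot 0); first exact: diff_plus_rot.
by apply/funext => z; rewrite rot0.
Qed.

Lemma diff_plus_comp (g h : circle R -> circle R) : diff_plus g -> diff_plus h ->
  diff_plus (g \o h).
Proof.
move=> /lift_of_diff_plus [a la ->] /lift_of_diff_plus [b lb ->].
by rewrite -circle_of_lift_comp //; exact/diff_plus_lift/lift_comp.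
Qed.

Lemma diff_plus_inv (g : circle R -> circle R) : diff_plus g ->
  exists h, [/\ diff_plus h, cancel g h & cancel h g].
Proof.
move=> /lift_of_diff_plus [b lb ->].
have [a [la ab ba _]] := lift_inverse lb.
exists (circle_of_lift a); split; first exact: diff_plus_lift.
- by move=> z; rewrite -(angleK z) !circle_of_lift_cis // ba.
- by move=> z; rewrite -(angleK z) !circle_of_lift_cis // ab.
Qed.

End CircleFlows.

(** * Moebius maps *)

Section Moebius.
Variable R : realType.
Implicit Types (a b c d : R[i]) (z : circle R).

Definition mobius_of a b (g : circle R -> circle R) : Prop :=
  `|a| ^+ 2 - `|b| ^+ 2 = 1 /\
  forall z, cval (g z) = (a * cval z + b) / (b^* * cval z + a^*).

Lemma mobius_den_neq0 a b (x : R[i]) : `|a| ^+ 2 - `|b| ^+ 2 = 1 -> `|x| = 1 ->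
  b^* * x + a^* != 0.
Proof.
move=> ab x1; apply/eqP => /eqP; rewrite addr_eq0 => /eqP E.
have : `|b| = `|a| by rewrite -[RHS]norm_conjC -[RHS]normrN -E normrM x1 mulr1 norm_conjC.
by move=> E'; move: ab; rewrite E' subrr => /eqP; rewrite eq_sym oner_eq0.
Qed.

Lemma mobius_exists a b : `|a| ^+ 2 - `|b| ^+ 2 = 1 -> exists g, mobius_of a b g.
Proof.
move=> ab.
have H z : (a * cval z + b) / (b^* * cval z + a^*) \in [set z : Cplx R | `|z| = 1].
  have z1 := norm_cval z.
  have D0 := mobius_den_neq0 ab z1.
  apply/mem_set; rewrite /= normrM normfV.
  have -> : a * cval z + b = cval z * (b^* * cval z + a^*)^*.
    rewrite rmorphD rmorphM /= !conjCK mulrDr mulrCA.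
    have -> : cval z * (cval z)^* = 1 by rewrite -normCK z1 expr1n.
    by rewrite mulr1 addrC mulrC.
  by rewrite normrM z1 mul1r norm_conjC divff // normr_eq0.
by exists (fun z => SigSub (H z)).
Qed.

Lemma mobius_ofP (g : circle R -> circle R) : mob g <-> exists a b, mobius_of a b g.
Proof. by []. Qed.

Lemma mobius_of_comp a b c d (g h : circle R -> circle R) :
  mobius_of a b g -> mobius_of c d h ->
  mobius_of (a * c + b * d^*) (a * d + b * c^*) (g \o h).
Proof.
move=> [ab gE] [cd hE]; split.
  rewrite !normCK !rmorphD !rmorphM /= !conjCK.
  move: ab cd; rewrite !normCK => ab cd.
  by rewrite -[RHS]mulr1 -{1}ab -cd; ring.
move=> z; rewrite /= gE hE !rmorphD !rmorphM /= !conjCK.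
have D0 := mobius_den_neq0 cd (norm_cval z).
have z1 : `|(c * cval z + d) / (d^* * cval z + c^*)| = 1 by rewrite -hE norm_cval.
have D1 := mobius_den_neq0 ab z1.
set w := cval z in D0 D1 *.
have D2 : b^* * (c * w + d) + a^* * (d^* * w + c^*) != 0.
  have -> : b^* * (c * w + d) + a^* * (d^* * w + c^*) =
     (b^* * ((c * w + d) / (d^* * w + c^*)) + a^*) * (d^* * w + c^*).
    by field.
  by rewrite mulf_neq0.
have D3 : (a^* * d^* + b^* * c) * w + (a^* * c^* + b^* * d) != 0.
  by rewrite (_ : _ + _ = b^* * (c * w + d) + a^* * (d^* * w + c^*)) //; ring.
by field; rewrite ?D0 ?D2 ?D3.
Qed.

Lemma mobius_of_rot (t : R) : mobius_of (expi (t / 2)) 0 (rot t).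
Proof.
split; first by rewrite norm_expi normr0 expr1n expr0n subr0.
move=> z; rewrite addr0 rmorph0 mul0r add0r /cval /= -/(cval z).
rewrite mulrAC; congr (_ * _).
have -> : t = t / 2 + t / 2 by lra.
rewrite expiD -[t / 2 + t / 2](_ : t = _); last by lra.
congr (_ * _); apply: (@mulIf _ (expi (t / 2))^*).
  by rewrite -normr_eq0 norm_conjC norm_expi oner_eq0.
rewrite -normCK norm_expi expr1n mulVf //.
by rewrite -normr_eq0 norm_conjC norm_expi oner_eq0.
Qed.

Lemma mob_comp (g h : circle R -> circle R) : mob g -> mob h -> mob (g \o h).
Proof.
move=> [a [b gE]] [c [d hE]].
by do 2 eexists; exact: mobius_of_comp gE hE.
Qed.

Lemma mob_rot (t : R) : mob (@rot R t).
Proof. by do 2 eexists; exact: mobius_of_rot. Qed.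

Lemma mobius_of_inv a b (g h : circle R -> circle R) :
  mobius_of a b g -> mobius_of a^* (- b) h -> cancel g h /\ cancel h g.
Proof.
have H (c d : R[i]) (k l : circle R -> circle R) : mobius_of c d k -> mobius_of c^* (- d) l -> cancel k l.
  move=> kE lE z; apply: cval_inj.
  have [_ /(_ z)] := mobius_of_comp lE kE.
  rewrite /= => ->; have [cd _] := kE.
  rewrite (_ : c^* * d + - d * c^* = 0); last by ring.
  rewrite rmorph0 addr0 mul0r add0r.
  have -> : c^* * c + - d * d^* = 1 by rewrite -cd !normCK; ring.
  by rewrite rmorph1 divr1 mul1r.
move=> gE hE; split; first exact: H gE hE.
apply: (H a^* (- b)) => //; rewrite conjCK opprK //.
Qed.

(** A Moebius map multiplies exp(it) by the phase of the inverse square of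
    D = conj(b) exp(it) + conj(a), so that its angle increases at the speed
    |D| ^ -2. *)
Lemma mobius_trace a b (g : circle R -> circle R) (n := fun t : R =>
    complex.Re (`|b^* * expi t + a^*| ^+ 2)) : mobius_of a b g ->
  exists e, [/\ Csmooth e, re_trace g = cos \o e, im_trace g = sin \o e,
    forall t, is_derive t (1 : R) e (n t)^-1 & forall t, 0 < n t].
Proof.
rewrite /n => {n}; case: a => a1 a2; case: b => b1 b2 gE; have [ab gz] := gE.
pose p (t : R) := b1 * cos t + b2 * sin t + a1.
pose q (t : R) := b1 * sin t - b2 * cos t - a2.
pose p' (t : R) := b2 * cos t - b1 * sin t.
pose q' (t : R) := b1 * cos t + b2 * sin t.
pose n t := p t ^+ 2 + q t ^+ 2.
have DE t : (b1 +i* b2)^* * expi t + (a1 +i* a2)^* = p t +i* q t.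
  by apply/eqP; rewrite eq_complex /=; apply/andP; split; apply/eqP; rewrite /p /q; ring.
have nE t : `|(b1 +i* b2)^* * expi t + (a1 +i* a2)^*| ^+ 2 = (n t)%:C.
  by rewrite DE -add_Re2_Im2.
have n0 t : 0 < n t.
  rewrite -ltcR -nE exprn_gt0 // normr_gt0; apply: mobius_den_neq0 ab _.
  exact: norm_expi.
have n0' t : n t != 0 by rewrite gt_eqF.
have ab' : a1 ^+ 2 + a2 ^+ 2 - (b1 ^+ 2 + b2 ^+ 2) = 1.
  by move: ab; rewrite -!add_Re2_Im2 => /(congr1 (@complex.Re R)).
pose x t := (cos t * (p t ^+ 2 - q t ^+ 2) + 2 * sin t * p t * q t) / n t.
pose y t := (sin t * (p t ^+ 2 - q t ^+ 2) - 2 * cos t * p t * q t) / n t.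
have gxy t : cval (g (cis t)) = x t +i* y t.
  rewrite gz /cval /= DE.
  have -> : (a1 +i* a2) * expi t + (b1 +i* b2) = expi t * (p t -i* q t).
    have := cos2Dsin2 t => cs.
    apply/eqP; rewrite eq_complex /=; apply/andP; split; apply/eqP; rewrite /p /q.
      transitivity (a1 * cos t - a2 * sin t + b1 * (cos t ^+ 2 + sin t ^+ 2)).
        by rewrite cs; ring.
      by ring.
    transitivity (a1 * sin t + a2 * cos t + b2 * (cos t ^+ 2 + sin t ^+ 2)).
      by rewrite cs; ring.
    by ring.
  apply/eqP; rewrite eq_complex /=; apply/andP; split; apply/eqP;
    by rewrite /x /y /n; field; exact: n0'.
have xE : re_trace g = x by apply/funext => t; rewrite /re_trace gxy.
have yE : im_trace g = y by apply/funext => t; rewrite /im_trace gxy.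
have sn : Csmooth n.
  have sp : Csmooth p.
    apply: smoothD (smooth_cst _); apply: smoothD.
      exact: smoothM (smooth_cst _) (smooth_cos _).
    exact: smoothM (smooth_cst _) (smooth_sin _).
  have sq : Csmooth q.
    apply: smoothB (smooth_cst _); apply: smoothB.
      exact: smoothM (smooth_cst _) (smooth_sin _).
    exact: smoothM (smooth_cst _) (smooth_cos _).
  rewrite (_ : n = fun t => p t * p t + q t * q t); first exact: smoothD (smoothM sp sp) (smoothM sq sq).
  by apply/funext => t; rewrite /n !expr2.
have dp t : is_derive t (1 : R) p (p' t).
  by apply: is_derive_eq; rewrite /GRing.scale /= /p'; ring.
have dq t : is_derive t (1 : R) q (q' t).
  by apply: is_derive_eq; rewrite /GRing.scale /= /q'; ring.
have dn t : is_derive t (1 : R) n (2 * p t * p' t + 2 * q t * q' t).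
  by apply: is_derive_eq; rewrite /GRing.scale /=; ring.
have dnV t : is_derive t (1 : R) (fun t => (n t)^-1)
    (- (n t) ^- 2 * (2 * p t * p' t + 2 * q t * q' t)).
  by have := @is_deriveV R n t _ 1 (n0' t) (dn t).
have key t : n t - 2 * (p t * q' t - q t * p' t) = 1.
  rewrite -[RHS]ab' /n /p /q /p' /q'.
  have := congr1 ( *%R (b1 ^+ 2 + b2 ^+ 2)) (cos2Dsin2 t).
  rewrite mulr1; set c := cos t; set s := sin t; lra.
have nV t : (n t)^-1 = (n t - 2 * (p t * q' t - q t * p' t)) / n t.
  by rewrite key mul1r.
have dx t : is_derive t (1 : R) x (- (n t)^-1 * y t).
  have dX : is_derive t (1 : R)
      (fun t => cos t * (p t ^+ 2 - q t ^+ 2) + 2 * sin t * p t * q t)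
      (- sin t * (p t ^+ 2 - q t ^+ 2) + cos t * (2 * p t * p' t - 2 * q t * q' t)
       + 2 * cos t * p t * q t + 2 * sin t * (p' t * q t + p t * q' t)).
    by apply: is_derive_eq; rewrite /GRing.scale /=; ring.
  have /is_derive_eq := is_deriveM dX (dnV t); apply.
  rewrite /GRing.scale /= [in RHS]nV /y /n.
  by field; exact: n0'.
have dy t : is_derive t (1 : R) y ((n t)^-1 * x t).
  have dY : is_derive t (1 : R)
      (fun t => sin t * (p t ^+ 2 - q t ^+ 2) - 2 * cos t * p t * q t)
      (cos t * (p t ^+ 2 - q t ^+ 2) + sin t * (2 * p t * p' t - 2 * q t * q' t)
       + 2 * sin t * p t * q t - 2 * cos t * (p' t * q t + p t * q' t)).
    by apply: is_derive_eq; rewrite /GRing.scale /=; ring.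
  have /is_derive_eq := is_deriveM dY (dnV t); apply.
  rewrite /GRing.scale /= [in RHS]nV /x /n.
  by field; exact: n0'.
have xy t : x t ^+ 2 + y t ^+ 2 = 1 by rewrite -xE -yE re_im_trace_sqr.
have [e [de xe ye]] := polar_angle (smoothV sn n0') xy dx dy.
exists e; split.
- exact: smooth_primitive (smoothV sn n0') de.
- by rewrite xE.
- by rewrite yE.
- by move=> t; rewrite nE; exact: de.
- by move=> t; rewrite nE; exact: n0.
Qed.

Lemma mob_diff_plus (g : circle R -> circle R) : mob g -> diff_plus g.
Proof.
have S (c d : R[i]) k : mobius_of c d k -> smooth_map k.
  move=> /mobius_trace [e [se xe ye _ _]]; split; apply: CsmoothW.
    by rewrite xe; exact: smooth_comp (smooth_cos _) se.
  by rewrite ye; exact: smooth_comp (smooth_sin _) se.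
move=> [a [b gE]]; split; first exact: S gE.
  move=> t; have [e [_ xe ye de n0]] := mobius_trace gE.
  by rewrite (trace_wronskian xe ye (de t)) invr_gt0.
have [h hE] : exists h, mobius_of a^* (- b) h.
  by apply: mobius_exists; rewrite norm_conjC normrN; case: gE.
have [gh hg] := mobius_of_inv gE hE.
by exists h; split => //; exact: S hE.
Qed.

Lemma mobius_lift_derive a b (e : R -> R) t : is_lift e ->
  mobius_of a b (circle_of_lift e) ->
  (derive1 e t)^-1 = complex.Re (`|b^* * expi t + a^*| ^+ 2).
Proof.
move=> le /mobius_trace [d [_ xd yd dd _]].
by rewrite -lift_wronskian // (trace_wronskian xd yd (dd t)) invrK.
Qed.

End Moebius.

(** * Connectedness of the diffeomorphism group *)

Section LiftPath.
Variable R : realType.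
Implicit Types (s t : R) (z w : circle R) (a b : R -> R).

Lemma periodic_bounded (q : R -> R) : continuous q ->
  (forall t, q (t + 2 * pi) = q t) -> exists M, forall t, `|q t| <= M.
Proof.
move=> cq q2; have p0 : 0 < 2 * pi :> R by rewrite mulr_gt0 // pi_gt0.
have cn : continuous (fun t => `|q t|).
  by move=> t; apply: continuous_comp; [exact: cq|exact: norm_continuous].
have [c _ cM] := EVT_max (ltW p0) (continuous_subspaceT cn).
exists `|q c| => t.
have /andP[d1 d2] := floor_itv (t / (2 * pi)).
have <- := @periodic_int R R q q2 (- Num.floor (t / (2 * pi))) t.
apply: cM; rewrite in_itv /= mulrNz mulrN subr_ge0 mulrC -ler_pdivlMr // d1 /=.
by move: d2; rewrite intrD ltr_pdivrMr // mulrDl mul1r => d2; lra.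
Qed.

Lemma sin_lipschitz (x y : R) : `|sin x - sin y| <= `|x - y|.
Proof.
wlog xy : x y / y <= x.
  move=> H; have [/H //|/ltW/H] := leP y x.
  by rewrite distrC [X in _ <= X]distrC.
have [c _ ->] := @MVT_closed R sin cos y x xy.
rewrite normrM ler_piMl // ler_norml; have := cos2Dsin2 c; nra.
Qed.

Lemma cos_lipschitz (x y : R) : `|cos x - cos y| <= `|x - y|.
Proof.
rewrite -!sinDpihalf; apply: (le_trans (sin_lipschitz _ _)).
by rewrite opprD addrACA subrr addr0.
Qed.

(** Continuity into circle_map is the uniform convergence of every derivative of the
    two traces, for which Lipschitz bounds uniform in the angle suffice. *)
Lemma circle_path_continuous (c : R -> circle R -> circle R) :
  (forall k, exists K, forall s s' t,
     `|derive1n k (re_trace (c s')) t - derive1n k (re_trace (c s)) t| <= K * `|s' - s|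
  /\ `|derive1n k (im_trace (c s')) t - derive1n k (im_trace (c s)) t| <= K * `|s' - s|) ->
  continuous (c : R -> circle_map R).
Proof.
move=> cK; apply: continuous_comp_initial => s.
apply/(@cvg_sup _ _ (fun i => Topological.class (initial_topology
  (fun f : (nat -> {uniform R -> Cplx R}) => f i)))) => k.
suff H : (fun s => @derivatives R (c s) k) @ s --> (@derivatives R (c s) k).
  move=> U [_ [[W oW <-] /= Ws]] WU.
  have /H := open_nbhs_nbhs (conj oW Ws).
  by rewrite /= !nbhs_simpl /=; apply: filterS => s' /WU.
move=> U /uniform_nbhs [E [entE EU]].
have := entE; rewrite -(@entourage_ballE _ (Cplx R)) => -[e /= e0 eE].
have [r [r0 re]] : exists r : R, 0 < r /\ r%:C = e.
  exists (complex.Re e); case: e e0 {eE} => x y; rewrite ltcE /= => /andP[/eqP -> x0].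
  by [].
have [K KP] := cK k.
have K1 : 0 < `|K| + 1 by rewrite ltr_wpDl.
have d0 : 0 < r / (2 * (`|K| + 1)) by rewrite divr_gt0 // mulr_gt0.
change (\forall s' \near s, U (@derivatives R (c s') k)); near=> s'.
apply: EU => t _; apply: eE; rewrite /= -ball_normE /= /derivatives -re.
have ss' : `|s' - s| < r / (2 * (`|K| + 1)).
  rewrite distrC; near: s'; exact: (@nbhsx_ballx _ R^o s _ d0).
rewrite distrC; have [xK yK] := KP s s' t.
set x' := derive1n k (re_trace _) t in xK *; set x := derive1n k (re_trace _) t in xK *.
set y' := derive1n k (im_trace _) t in yK *; set y := derive1n k (im_trace _) t in yK *.
have -> : x' +i* y' - x +i* y = (x' - x)%:C + 'i * (y' - y)%:C.
  by apply/eqP; rewrite eq_complex /= !mul0r !mul1r subr0 !add0r addr0 !eqxx.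
apply: (le_lt_trans (ler_normD _ _)); rewrite normrM.
have -> : `|'i%C| = 1 :> R[i] by rewrite normc_def /= expr0n expr1n add0r sqrtr1.
rewrite mul1r !normc_def /= expr0n !addr0 !sqrtr_sqr -rmorphD ltcR.
have ks : K * `|s' - s| < r / 2.
  apply: (@le_lt_trans _ _ ((`|K| + 1) * `|s' - s|)).
    by rewrite ler_wpM2r // (le_trans (ler_norm _)) // lerDl.
  by rewrite mulrC -ltr_pdivlMr // -mulrA -invfM.
lra.
Unshelve. all: by end_near. Qed.

(** The lifts form a convex set; the square of the sine keeps the parameter of
    the segment in [0, 1]. *)
Definition lift_path b s t : R := t + sin s ^+ 2 * (b t - t).

Lemma lift_path_lift b s : is_lift b -> is_lift (lift_path b s).
Proof.
move=> [sb b0 b2].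
have db := smooth_is_derive sb.
have D t : is_derive t (1 : R) (lift_path b s)
    (1 + (sin s ^+ 2 * (derive1 b t - 1))).
  by apply: is_derive_eq; rewrite /GRing.scale /=; ring.
split.
- apply: smoothD; first exact: smooth_id.
  apply: smoothM; first exact: smooth_cst.
  exact: smoothB sb (smooth_id _).
- move=> t; rewrite (is_derive_derive1 D).
  have := b0 t; have := sqr_ge0 (sin s); have := sqr_ge0 (cos s); have := cos2Dsin2 s.
  set u := _ ^+ 2; set v := sin s ^+ 2; set w := derive1 b t => uv u0 v0 w0.
  have -> : 1 + v * (w - 1) = u + v * w.
    by transitivity (u + v + v * (w - 1)); [rewrite uv|ring].
  by have := mulr_ge0 v0 (ltW w0); have [/eqP vE|vn] := eqVneq v 0; nra.
- by move=> t; rewrite /lift_path b2; ring.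
Qed.

Section PathClass.
Variable b : R -> R.
Hypothesis lb : is_lift b.

(** A class of functions of (s, t) that are Lipschitz in s uniformly in t, closed
    under derivation in t, and containing the coordinates of the path. *)
Inductive path_expr : (R -> R -> R) -> Prop :=
| PPer q of Csmooth q & (forall t, q (t + 2 * pi) = q t) : path_expr (fun _ => q)
| PSin : path_expr (fun s _ => sin s)
| PCosLift : path_expr (fun s t => cos (lift_path b s t))
| PSinLift : path_expr (fun s t => sin (lift_path b s t))
| PAdd F G of path_expr F & path_expr G : path_expr (fun s t => F s t + G s t)
| PMul F G of path_expr F & path_expr G : path_expr (fun s t => F s t * G s t).

Lemma path_expr_bounds F : path_expr F -> exists M K, [/\ 0 <= M, 0 <= K,
  forall s t, `|F s t| <= M & forall s s' t, `|F s' t - F s t| <= K * `|s' - s|].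
Proof.
have [sb b0 b2] := lb.
have [N Nb] : exists M, forall t, `|b t - t| <= M.
  apply: periodic_bounded => [t|t]; last by rewrite b2; lra.
  exact: (smooth_continuous (smoothB sb (smooth_id _))).
have N0 : 0 <= N by exact: le_trans (Nb 0).
have sin1 (x : R) : `|sin x| <= 1 by rewrite ler_norml; have := cos2Dsin2 x; nra.
have cos1 (x : R) : `|cos x| <= 1 by rewrite ler_norml; have := cos2Dsin2 x; nra.
have lip s s' t : `|lift_path b s' t - lift_path b s t| <= 2 * N * `|s' - s|.
  rewrite /lift_path (_ : _ - _ =
    (b t - t) * ((sin s' + sin s) * (sin s' - sin s))); last by ring.
  rewrite normrM mulrAC [X in _ <= X]mulrC ler_pM //.
  rewrite normrM ler_pM //; last exact: sin_lipschitz.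
  by apply: (le_trans (ler_normD _ _)); have := sin1 s; have := sin1 s'; lra.
elim=> {F}.
- move=> q sq q2; have [M Mq] := periodic_bounded (smooth_continuous sq) q2.
  exists M, 0; split => //; first exact: le_trans (Mq 0).
  by move=> *; rewrite subrr normr0 mul0r.
- exists 1, 1; split => // s s' _; rewrite mul1r; exact: sin_lipschitz.
- exists 1, (2 * N); split => //; first by rewrite mulr_ge0.
  by move=> s s' t; apply: (le_trans (cos_lipschitz _ _)).
- exists 1, (2 * N); split => //; first by rewrite mulr_ge0.
  by move=> s s' t; apply: (le_trans (sin_lipschitz _ _)).
- move=> F G _ [M [K [M0 K0 FM FK]]] _ [M' [K' [M'0 K'0 GM GK]]].
  exists (M + M'), (K + K'); split; rewrite ?addr_ge0 //.
    by move=> s t; apply: (le_trans (ler_normD _ _)); exact: lerD.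
  move=> s s' t; rewrite opprD addrACA mulrDl.
  by apply: (le_trans (ler_normD _ _)); exact: lerD.
- move=> F G _ [M [K [M0 K0 FM FK]]] _ [M' [K' [M'0 K'0 GM GK]]].
  exists (M * M'), (K * M' + M * K'); split; rewrite ?addr_ge0 ?mulr_ge0 //.
    by move=> s t; rewrite normrM; exact: ler_pM.
  move=> s s' t.
  rewrite (_ : _ - _ = (F s' t - F s t) * G s' t + F s t * (G s' t - G s t)); last by ring.
  apply: (le_trans (ler_normD _ _)); rewrite !normrM mulrDl; apply: lerD.
    by rewrite mulrAC; exact: ler_pM.
  by rewrite -mulrA; exact: ler_pM.
Qed.

Lemma path_expr_derive F : path_expr F ->
  exists2 G, path_expr G & forall s t, is_derive t (1 : R) (F s) (G s t).
Proof.
have [sb b0 b2] := lb; have db := smooth_is_derive sb.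
pose p t := derive1 b t - 1.
have Pp : path_expr (fun s t => 1 + sin s * sin s * p t).
  apply: PAdd; first by apply: PPer => //; exact: smooth_cst.
  apply: PMul; first by apply: PMul; exact: PSin.
  apply: PPer; first exact: smoothB (smooth_derive sb) (smooth_cst _).
  by move=> t; rewrite /p derive1_lift2pi.
have D s t : is_derive t (1 : R) (lift_path b s) (1 + sin s * sin s * p t).
  by apply: is_derive_eq; rewrite /GRing.scale /= /p; ring.
elim=> {F}.
- move=> q sq q2; exists (fun _ => derive1 q).
    apply: PPer; first exact: smooth_derive.
    by move=> t; apply: (@derive1_shift _ q 0) => // u; rewrite addr0.
  by move=> _ t; exact: smooth_is_derive.
- exists (fun _ _ => 0); first by apply: PPer => //; exact: smooth_cst.
  by move=> s t; exact: is_derive_cst.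
- exists (fun s t => -1 * (sin (lift_path b s t) * (1 + sin s * sin s * p t))).
    by do ![apply: PMul; try exact: PSinLift]; [apply: PPer => //; exact: smooth_cst|].
  move=> s t.
  have := @is_derive1_comp _ cos (lift_path b s) t _ _ (is_derive_cos _) (D s t).
  by move/eq_is_derive; apply; ring.
- exists (fun s t => cos (lift_path b s t) * (1 + sin s * sin s * p t)).
    by apply: PMul => //; exact: PCosLift.
  by move=> s t; exact: is_derive1_comp.
- move=> F G _ [F' PF' dF] _ [G' PG' dG].
  exists (fun s t => F' s t + G' s t); first exact: PAdd.
  by move=> s t; exact: is_deriveD.
- move=> F G PF [F' PF' dF] PG [G' PG' dG].
  exists (fun s t => F s t * G' s t + G s t * F' s t).
    by apply: PAdd; exact: PMul.
  by move=> s t; exact: is_deriveM.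
Qed.

Lemma path_expr_derive1n F k : path_expr F ->
  exists2 G, path_expr G & forall s, derive1n k (F s) = G s.
Proof.
move=> PF; elim: k => [|k [G PG GE]]; first by exists F.
have [G' PG' dG] := path_expr_derive PG.
by exists G' => // s; rewrite derive1nS GE; exact: is_derive_derive1.
Qed.

End PathClass.

Lemma lift_path_continuous b : is_lift b ->
  continuous ((fun s => circle_of_lift (lift_path b s)) : R -> circle_map R).
Proof.
move=> lb; apply: circle_path_continuous => k.
have [F PF FE] := path_expr_derive1n lb k (PCosLift b).
have [G PG GE] := path_expr_derive1n lb k (PSinLift b).
have [_ [K [_ K0 _ FK]]] := path_expr_bounds lb PF.
have [_ [K' [_ K'0 _ GK]]] := path_expr_bounds lb PG.
exists (K + K') => s s' t.
have -> u : derive1n k (re_trace (circle_of_lift (lift_path b u))) = F u.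
  by rewrite re_trace_lift; [exact: FE|exact: lift_path_lift].
have -> : derive1n k (re_trace (circle_of_lift (lift_path b s))) = F s.
  by rewrite re_trace_lift; [exact: FE|exact: lift_path_lift].
have -> : derive1n k (im_trace (circle_of_lift (lift_path b s'))) = G s'.
  by rewrite im_trace_lift; [exact: GE|exact: lift_path_lift].
have -> : derive1n k (im_trace (circle_of_lift (lift_path b s))) = G s.
  by rewrite im_trace_lift; [exact: GE|exact: lift_path_lift].
split.
  by apply: (le_trans (FK _ _ _)); rewrite ler_wpM2r // lerDl.
by apply: (le_trans (GK _ _ _)); rewrite ler_wpM2r // lerDr.
Qed.

(** The segment from the identity to a lift is a continuous path of diffeomorphisms,
    along which f is locally constant. *)
Lemma diff_plus_locally_constant (T : Type) (f : (circle R -> circle R) -> T) :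
  (forall g, diff_plus g -> \forall h \near within (@diff_plus R : set (circle_map R))
     (nbhs (g : circle_map R)), f h = f g) ->
  forall g, diff_plus g -> f g = f id.
Proof.
move=> fc g dg; have [b lb ->] := lift_of_diff_plus dg.
pose c s := circle_of_lift (lift_path b s).
have dc s : diff_plus (c s) by exact/diff_plus_lift/lift_path_lift.
have c0 : c 0 = id.
  apply/funext => z; rewrite /c -(angleK z) circle_of_lift_cis.
    by rewrite /lift_path sin0 expr0n mul0r addr0.
  exact: lift_path_lift.
have c1 : c (pi / 2) = circle_of_lift b.
  apply/funext => z; rewrite /c -(angleK z) !circle_of_lift_cis //.
    by rewrite /lift_path sin_pihalf expr1n mul1r addrC subrK.
  exact: lift_path_lift.
rewrite -c0 -c1.
have loc s : \forall s' \near s, f (c s') = f (c s).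
  have := fc _ (dc s); rewrite near_withinE => /(lift_path_continuous lb).
  by rewrite /= !nbhs_simpl /=; apply: filterS => s'; apply; exact: dc.
pose h s : R := `[< f (c s) = f (c 0) >]%:R.
have dh s : is_derive s (1 : R) h 0.
  apply: (@near_eq_is_derive R R^o R^o (fun=> h s)).
  by apply: filterS (loc s) => s' E; rewrite /h E.
have := is_derive_0_is_cst (pi / 2) 0 dh; rewrite /h.
rewrite (asboolT (erefl (f (c 0)))); case: asboolP => // _ /eqP.
by rewrite eq_sym oner_eq0.
Qed.

End LiftPath.

(** * A field and a flow localized in an arc *)

Section LocalField.
Variable R : realType.
Implicit Types (s t : R) (z w : circle R).

(** The rotation field, increased in the arc cos t < - 4 / 5. *)
Definition bumped t : R := 1 + bump (- cos t - 4 / 5).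

Lemma bumped_ge1 t : 1 <= bumped t.
Proof. by rewrite lerDl bump_ge0. Qed.

Lemma bumped_eq1 t : - (4 / 5) <= cos t -> bumped t = 1.
Proof. by move=> ct; rewrite /bumped bump_eq0 ?addr0 //; lra. Qed.

Lemma bumped2pi t : bumped (t + 2 * pi) = bumped t.
Proof. by rewrite /bumped mulr_natl cosD2pi. Qed.

Lemma bumped_smooth : Csmooth bumped.
Proof.
apply: smoothD; first exact: smooth_cst.
apply: (smooth_comp (bump_smooth R)).
by apply: smoothB; [exact: smoothN (smooth_cos _)|exact: smooth_cst].
Qed.

(** A field without zeros is the image of a multiple of the rotation field: the
    coordinate is its travel time, normalized by the period. *)
Lemma bumped_lift : exists (b : R -> R) (C : R), [/\ 0 < C, is_lift b &
  forall t, derive1 b t = C / bumped t].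
Proof.
have g0 t : 0 < bumped t by exact: lt_le_trans (bumped_ge1 t).
have sV : Csmooth (fun t => (bumped t)^-1).
  by apply: smoothV bumped_smooth _ => t; rewrite gt_eqF.
have [P dP] := continuous_primitive (smooth_continuous sV).
have sP := smooth_primitive sV dP.
have P'E : derive1 P = fun t => (bumped t)^-1 by exact: is_derive_derive1.
have p0 : 0 < 2 * pi :> R by rewrite mulr_gt0 // pi_gt0.
pose T := P (2 * pi) - P 0.
have PT t : P (t + 2 * pi) - P t = T.
  have -> : T = P (0 + 2 * pi) - P 0 by rewrite add0r.
  pose e u := P (u + 2 * pi) - P u; rewrite -/(e t) -/(e 0).
  apply: is_derive_0_is_cst => u; rewrite -(subrr (bumped u)^-1).
  apply: is_deriveB; apply: is_derive_translate.
  rewrite -(bumped2pi u).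
  exact: dP.
have T0 : 0 < T.
  rewrite subr_gt0; apply: mono_derive => // t.
  by rewrite P'E invr_gt0.
pose C := 2 * pi / T.
have C0 : 0 < C by rewrite divr_gt0.
have db t : is_derive t (1 : R) (fun t => C * P t) (C * (bumped t)^-1).
  exact: (is_deriveZ C (dP t)).
exists (fun t => C * P t), C; split => //.
  split.
  - exact: smoothM (smooth_cst _) sP.
  - by move=> t; rewrite (is_derive_derive1 db) divr_gt0.
  - move=> t; have /eqP := PT t; rewrite subr_eq => /eqP ->.
    by rewrite mulrDr addrC divfK // gt_eqF.
by move=> t; rewrite (is_derive_derive1 db).
Qed.

(** As long as the orbit stays where the field is the rotation field, the flow is
    undone by the opposite rotation. *)
Lemma bumped_flow_local (a b : R -> R) (C s : R) z :
  is_lift a -> is_lift b -> cancel b a ->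
  (forall t, derive1 b t = C / bumped t) ->
  `|s| <= 1 / 20 -> - (3 / 4) <= complex.Re (cval z) ->
  lift_flow a b (C * s) (rot (- s) z) = z.
Proof.
move=> la lb ba b'E s20; rewrite -(angleK z); set t := angle z => /= ct.
rewrite rot_cis /lift_flow circle_of_lift_cis; last exact: lift_flow_lift.
suff <- : b t = b (- s + t) + C * s by rewrite ba.
have db := smooth_is_derive (lift_smooth lb).
have b'C u : `|u - t| <= `|s| -> derive1 b u = C.
  move=> us; rewrite b'E bumped_eq1 ?divr1 //.
  (* The cosine is 1-Lipschitz and 4 / 5 - 3 / 4 = 1 / 20. *)
  have : `|cos t - cos u| <= 1 / 20.
    apply: (le_trans (cos_lipschitz _ _)); rewrite distrC.
    by apply: (le_trans us).
  by rewrite ler_norml => /andP[_ ?]; lra.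
have [s0|/ltW s0] := leP 0 s.
  have [|u /andP[u1 u2]] := @MVT_closed R b (derive1 b) (- s + t) t _ (fun u _ => db u).
    by lra.
  rewrite b'C; last by rewrite (ger0_norm s0) ler_norml; lra.
  by move=> E; lra.
have [|u /andP[u1 u2]] := @MVT_closed R b (derive1 b) t (- s + t) _ (fun u _ => db u).
  by lra.
rewrite b'C; last by rewrite (ler0_norm s0) ler_norml; lra.
by move=> E; lra.
Qed.

(** The arc centered at cis c where the cosine of the angular distance to the
    center exceeds r. *)
Definition cap (c r : R) : set (circle R) :=
  [set z | r < complex.Re (expi (- c) * cval z)].

Lemma cap_cis c r t : cap c r (cis t) = (r < cos (t - c)) :> Prop.
Proof. by rewrite /cap /cval /= cosN sinN cosB mulNr opprK addrC [cos t * _]mulrC [sin t * _]mulrC addrC. Qed.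

Lemma norm_complex_le (x y : R) : `|x +i* y| <= (`|x| + `|y|)%:C.
Proof.
have -> : x +i* y = x%:C + 'i%C * y%:C.
  by apply/eqP; rewrite eq_complex /= !mul0r !mul1r subr0 !add0r addr0 !eqxx.
apply: (le_trans (ler_normD _ _)); rewrite normrM.
have -> : `|'i%C| = 1 :> R[i] by rewrite normc_def /= expr0n expr1n add0r sqrtr1.
by rewrite mul1r !normc_def /= expr0n !addr0 !sqrtr_sqr -rmorphD.
Qed.

Lemma cis_continuous : continuous (@cis R).
Proof.
apply: (@continuous_comp_initial (circle R) R (Cplx R) set_val) => t.
suff H : (@expi R : R -> Cplx R) @ t --> (expi t : Cplx R) by exact: H.
apply/cvgrPdist_lt => e e0.
have [r [r0 re]] : exists r : R, 0 < r /\ r%:C = e.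
  exists (complex.Re e); case: e e0 => x y; rewrite ltcE /= => /andP[/eqP -> x0].
  by [].
have r2 : 0 < r / 2 by rewrite divr_gt0.
near=> s.
have ts : `|t - s| < r / 2.
  near: s; exact: (@nbhsx_ballx _ R^o t _ r2).
rewrite -re (_ : expi t - expi s = (cos t - cos s) +i* (sin t - sin s)) //.
apply: (le_lt_trans (norm_complex_le _ _)); rewrite ltcR.
by have := cos_lipschitz t s; have := sin_lipschitz t s; lra.
Unshelve. all: by end_near. Qed.

Lemma cap_open c r : open (cap c r).
Proof.
pose f (z : circle R) : Cplx R := cval z.
have cf : continuous f by exact: initial_continuous.
rewrite openE => z; rewrite /cap /= => rz.
have e0 : 0 < complex.Re (expi (- c) * cval z) - r by rewrite subr_gt0.
have e0' : (0 : R[i]) < (complex.Re (expi (- c) * cval z) - r)%:C by rewrite ltcR.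
have /cvgrPdist_lt /(_ _ e0') := cf z.
apply: filterS => w; rewrite -[X in X < _]mul1r -(norm_expi (- c)) -normrM.
move=> /(le_lt_trans (normc_ge_Re _)); rewrite ltcR => zw.
have : `|complex.Re (expi (- c) * cval z) - complex.Re (expi (- c) * cval w)|
    < complex.Re (expi (- c) * cval z) - r.
  rewrite (_ : _ - complex.Re (expi (- c) * cval w) = complex.Re (expi (- c) * (f z - f w))) //.
  rewrite mulrBr /f; by case: (_ * _) => ? ?; case: (_ * _).
by rewrite ltr_norml => /andP[_ ?]; rewrite /=; lra.
Qed.

Lemma cap_image c r : -1 < r < 1 ->
  cap c r = @cis R @` [set` `]c - acos r, c + acos r[ ].
Proof.
move=> r1; have rI : r \in `[(-1), 1] by rewrite in_itv /=; lra.
have rI' : -1 <= r <= 1 by lra.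
have a0 := acos_ge0 rI'; have ap := acos_lepi rI'.
apply/seteqP; split => [z|_ [t /= + <-]].
  have [u uE] : exists u, cis u = rot (- c) z /\ - pi <= u <= pi.
    have := norm_cval (rot (- c) z); case E : (cval (rot (- c) z)) => [x y].
    rewrite normc_def /= => /(congr1 (@complex.Re R)) /= xy1.
    have xy : x ^+ 2 + y ^+ 2 = 1.
      by rewrite -[LHS]sqr_sqrtr ?addr_ge0 ?sqr_ge0 // xy1 expr1n.
    have x1 : -1 <= x <= 1.
      by rewrite -ler_norml -(@expr_le1 _ 2) // real_normK ?num_real // -xy lerDl sqr_ge0.
    have cx : cos (acos x) = x by rewrite acosK // in_itv.
    have sx : sin (acos x) = `|y| by rewrite sin_acos // -xy [x ^+ 2 + _]addrC addrK sqrtr_sqr.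
    have b0 := acos_ge0 x1; have bp := acos_lepi x1.
    have [y0|y0] := leP 0 y.
      exists (acos x); split; last by lra.
      by apply/esym/eq_cis; rewrite E /= ?cx // sx ger0_norm.
    exists (- acos x); split; last by lra.
    by apply/esym/eq_cis; rewrite E /= ?cosN ?sinN ?cx // sx ltr0_norm // opprK.
  case: uE => uE ui.
  have -> : z = cis (u + c) by rewrite addrC -rot_cis uE rotD subrr rot0.
  rewrite cap_cis addrK => ru; exists (u + c) => //.
  rewrite /= in_itv /=.
  suff : `|u| < acos r by rewrite ltr_norml => /andP[? ?]; lra.
  have cu : cos `|u| = cos u by case: (ger0P u) => _ //; rewrite cosN.
  rewrite -ltr_cos ?acosK ?cu //; rewrite in_itv /= ?a0 ?ap ?normr_ge0 //=.
  by rewrite ler_norml; lra.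
rewrite in_itv /= => /andP[t1 t2]; rewrite cap_cis.
have tc : `|t - c| < acos r by rewrite ltr_norml; lra.
have cu : cos `|t - c| = cos (t - c) by case: (ger0P (t - c)) => _ //; rewrite cosN.
rewrite -cu -[X in X < _](acosK rI) ltr_cos // in_itv /= ?a0 ?ap ?normr_ge0 //=.
by lra.
Qed.

Lemma cap_arc c r : 0 < r < 1 -> is_arc (cap c r).
Proof.
move=> r01; split.
- exact: cap_open.
- by exists (cis c); rewrite cap_cis subrr cos0; lra.
- rewrite cap_image; last by lra.
  apply: connected_continuous_connected; last exact/continuous_subspaceT/cis_continuous.
  by apply/connected_intervalP; exact: interval_is_interval.
- move=> /(_ (cap (c + pi) r)) [||z [z1 z2]].
  + by exists (cis (c + pi)); rewrite cap_cis subrr cos0; lra.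
  + exact: cap_open.
  move: z1 z2; rewrite -(angleK z) !cap_cis (_ : _ - (c + pi) = angle z - c - pi); last by ring.
  by rewrite cosB cospi sinpi; lra.
Qed.

(** A common point is at an angle less than pi / 4 from both centers, as
    (3 / 4) ^ 2 > 1 / 2. *)
Lemma cap_disjoint c d : cos (c - d) <= 0 ->
  cap c (3 / 4) `&` cap d (3 / 4) = set0.
Proof.
move=> cd; apply/seteqP; split => // z [].
rewrite -(angleK z) !cap_cis; set t := angle z => tc td.
have E : cos (c - d) = cos (t - d) * cos (t - c) + sin (t - d) * sin (t - c).
  by rewrite -cosB; congr cos; ring.
have := cos2Dsin2 (t - c); have := cos2Dsin2 (t - d); move: tc td E.
set x := cos (t - c); set y := cos (t - d); set u := sin (t - c); set v := sin (t - d).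
move=> xr yr E yv xu.
have : u ^+ 2 <= 7 / 16 by nra.
have : v ^+ 2 <= 7 / 16 by nra.
have : x * y > 9 / 16 by nra.
have := sqr_ge0 (u + v).
by move: cd; rewrite E; nra.
Qed.

Lemma opposite_cap c r z : opposite (cap c r) z ->
  complex.Re (expi (- c) * cval z) <= r.
Proof. by move=> /interior_subset; rewrite /cap /= leNgt => /negP. Qed.

End LocalField.

(** * Hilbert spaces *)

Section RealNorm.
Variable R : realType.
Implicit Types (V : normedModType R[i]) (e : R).

(** The norm with values in the real field, where linear arithmetic is available. *)
Definition rnorm V (x : V) : R := complex.Re `|x|.

Lemma rnormE V (x : V) : `|x| = (rnorm x)%:C.
Proof. by have /ger0_Im := normr_ge0 x; rewrite /rnorm; case: `|x| => a b /= ->. Qed.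

Lemma rnorm_ge0 V (x : V) : 0 <= rnorm x.
Proof. by rewrite -lecR -rnormE; exact: normr_ge0. Qed.

Lemma rnorm0 V : rnorm (0 : V) = 0.
Proof. by rewrite /rnorm normr0. Qed.

Lemma rnorm_eq0 V (x : V) : rnorm x = 0 -> x = 0.
Proof. by move=> x0; apply/eqP; rewrite -normr_eq0 rnormE x0. Qed.

Lemma rnormN V (x : V) : rnorm (- x) = rnorm x.
Proof. by rewrite /rnorm normrN. Qed.

Lemma rnormBC V (x y : V) : rnorm (x - y) = rnorm (y - x).
Proof. by rewrite -rnormN opprB. Qed.

Lemma rnormD V (x y : V) : rnorm (x + y) <= rnorm x + rnorm y.
Proof. by have := ler_normD x y; rewrite !rnormE -rmorphD lecR. Qed.

Lemma rnormB V (x y : V) : rnorm (x - y) <= rnorm x + rnorm y.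
Proof. by rewrite -(rnormN y); exact: rnormD. Qed.

Lemma rnorm_dist V (x y z : V) : rnorm (x - z) <= rnorm (x - y) + rnorm (y - z).
Proof. by have := rnormD (x - y) (y - z); rewrite addrA subrK. Qed.

Definition cnorm (a : R[i]) : R := rnorm (a : R[i]^o).

Lemma cnormE (a : R[i]) : `|a| = (cnorm a)%:C.
Proof. exact: (rnormE (a : R[i]^o)). Qed.

Lemma rnormZ V (a : R[i]) (x : V) : rnorm (a *: x) = cnorm a * rnorm x.
Proof. by apply: (@complexI R); rewrite rmorphM /= -rnormE normrZ cnormE rnormE. Qed.

Lemma cnormM (a b : R[i]) : cnorm (a * b) = cnorm a * cnorm b.
Proof. exact: (rnormZ a (b : R[i]^o)). Qed.

Lemma cnorm_real (r : R) : cnorm r%:C = `|r|.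
Proof. by apply: (@complexI R); rewrite -cnormE normc_def /= expr0n addr0 sqrtr_sqr. Qed.

Lemma cnorm_i : cnorm 'i = 1.
Proof.
by apply: (@complexI R); rewrite -cnormE normc_def /= expr0n expr1n add0r sqrtr1.
Qed.

Lemma cnorm_ge0 (a : R[i]) : 0 <= cnorm a. Proof. exact: rnorm_ge0. Qed.

Lemma cnorm_eq0 (a : R[i]) : cnorm a = 0 -> a = 0.
Proof. exact: (@rnorm_eq0 (R[i]^o)). Qed.

Lemma norm1P (a : R[i]) : `|a| = 1 <-> cnorm a = 1.
Proof. by rewrite cnormE; split => [[]|->]. Qed.

Lemma pos_complex (e : R[i]) : 0 < e -> exists2 r : R, 0 < r & r%:C = e.
Proof.
case: e => x y; rewrite ltcE /= => /andP[/eqP -> x0].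
by exists x.
Qed.

Lemma cvg_rnorm V T (F : set_system T) (f : T -> V) (l : V) : Filter F ->
  f @ F --> l <-> forall e, 0 < e -> \forall x \near F, rnorm (l - f x) < e.
Proof.
move=> FF; split => [/cvgrPdist_lt fl e e0|fl].
  have /fl : (0 : R[i]) < e%:C by rewrite ltcR.
  by apply: filterS => x; rewrite rnormE ltcR.
apply/cvgrPdist_lt => _ /pos_complex [e e0 <-].
by apply: filterS (fl e e0) => x; rewrite rnormE ltcR.
Qed.

Lemma nbhs_rnorm V (x : V) (A : set V) : nbhs x A <->
  exists2 e, 0 < e & forall y, rnorm (x - y) < e -> A y.
Proof.
split => [/nbhs_normP [_ /pos_complex [e e0 <-] eA]|[e e0 eA]].
  by exists e => // y xy; apply: eA; rewrite /= rnormE ltcR.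
apply/nbhs_normP; exists e%:C; first by rewrite /= ltcR.
by move=> y /=; rewrite rnormE ltcR; exact: eA.
Qed.

Lemma dense_rnorm V (D : set V) : dense D -> forall x e, 0 < e ->
  exists2 y, D y & rnorm (x - y) < e.
Proof.
move=> dD x e e0.
have xe : ([set y | rnorm (x - y) < e]°) x by apply/nbhs_rnorm; exists e.
have [|y [/interior_subset ye Dy]] := dD _ _ (open_interior [set y | rnorm (x - y) < e]).
  by exists x.
by exists y.
Qed.

Lemma rnorm_dense V (D : set V) : (forall x e, 0 < e ->
  exists2 y, D y & rnorm (x - y) < e) -> dense D.
Proof.
move=> H O [x Ox] oO.
have /nbhs_rnorm [e e0 eO] : nbhs x O by apply: open_nbhs_nbhs.
by have [y Dy /eO Oy] := H x e e0; exists y.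
Qed.

Lemma closure_rnorm V (D : set V) x : closure D x <->
  forall e, 0 < e -> exists2 y, D y & rnorm (x - y) < e.
Proof.
split => [cD e e0|H B /nbhs_rnorm [e e0 eB]].
  have /cD [y [Dy ye]] : nbhs x [set y | rnorm (x - y) < e] by apply/nbhs_rnorm; exists e.
  by exists y.
by have [y Dy /eB By] := H e e0; exists y.
Qed.

Lemma dense_closure V (D : set V) x : dense D -> closure D x.
Proof. by move=> dD; apply/closure_rnorm; exact: dense_rnorm. Qed.

Lemma small_rnorm_eq V (x y : V) (M : R) : 0 <= M ->
  (forall e, 0 < e -> rnorm (x - y) <= M * e) -> x = y.
Proof.
move=> M0 H; apply/eqP; rewrite -subr_eq0; apply/eqP/rnorm_eq0.
apply/eqP; rewrite eq_le rnorm_ge0 andbT leNgt; apply/negP => xy.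
have := H (rnorm (x - y) / (2 * (M + 1))).
have M2 : 0 < 2 * (M + 1) by lra.
move=> /(_ (divr_gt0 xy M2)); apply/negP; rewrite -ltNge mulrA ltr_pdivrMr //.
by nra.
Qed.

Lemma cauchy_rnorm (V : completeNormedModType R[i]) (u : nat -> V) :
  (forall e, 0 < e -> exists N, forall m n, (N <= m)%N -> (N <= n)%N ->
     rnorm (u m - u n) < e) ->
  exists l, forall e, 0 < e -> exists N, forall n, (N <= n)%N -> rnorm (l - u n) < e.
Proof.
move=> uC; have /cauchy_cvg /cvg_ex [l ul] : cauchy (u @ \oo).
  apply: cauchy_exP => _ /pos_complex [e e0 <-].
  have [N NP] := uC e e0; exists (u N); exists N => // n /= Nn.
  by rewrite /= -ball_normE /= rnormE ltcR; exact: NP.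
exists l => e e0; have [N _ NP] := (cvg_rnorm _ _ _).1 ul e e0.
by exists N => n; exact: NP.
Qed.

End RealNorm.

Section InnerProduct.
Variables (R : realType) (H : hilbert R).
Implicit Types (x y z : H) (a : R[i]).

Lemma hdotDl x y z : hdot (x + y) z = hdot x z + hdot y z.
Proof. by rewrite linearDl. Qed.
Lemma hdotDr x y z : hdot x (y + z) = hdot x y + hdot x z.
Proof. by rewrite linearDr. Qed.
Lemma hdotZl a x y : hdot (a *: x) y = a * hdot x y.
Proof. by rewrite linearZl_LR. Qed.
Lemma hdotZr a x y : hdot x (a *: y) = a^* * hdot x y.
Proof. by rewrite linearZr_LR. Qed.
Lemma hdotC x y : hdot y x = (hdot x y)^*.
Proof. by rewrite hermC expr0 mul1r. Qed.
Lemma hdot0l x : hdot 0 x = 0.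
Proof. by rewrite -(scale0r x) hdotZl mul0r. Qed.
Lemma hdot0r x : hdot x 0 = 0.
Proof. by rewrite hdotC hdot0l rmorph0. Qed.
Lemma hdotNl x y : hdot (- x) y = - hdot x y.
Proof. by rewrite -scaleN1r hdotZl mulN1r. Qed.
Lemma hdotNr x y : hdot x (- y) = - hdot x y.
Proof. by rewrite -scaleN1r hdotZr rmorphN rmorph1 mulN1r. Qed.
Lemma hdotBl x y z : hdot (x - y) z = hdot x z - hdot y z.
Proof. by rewrite hdotDl hdotNl. Qed.
Lemma hdotBr x y z : hdot x (y - z) = hdot x y - hdot x z.
Proof. by rewrite hdotDr hdotNr. Qed.

Lemma hdot_suml (I : Type) (r : seq I) (F : I -> H) y :
  hdot (\sum_(i <- r) F i) y = \sum_(i <- r) hdot (F i) y.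
Proof.
elim: r => [|i r IH]; first by rewrite !big_nil hdot0l.
by rewrite !big_cons hdotDl IH.
Qed.

Lemma hdot_self x : hdot x x = (rnorm x ^+ 2)%:C.
Proof. by rewrite hdotE rnormE rmorphXn. Qed.

Lemma hdot_self_eq0 x : hdot x x = 0 -> x = 0.
Proof.
rewrite hdot_self => /(congr1 (@complex.Re R)) /= /eqP.
by rewrite expf_eq0 /= => /eqP /rnorm_eq0.
Qed.

Lemma conj_real (r : R) : (r%:C)^* = r%:C :> R[i].
Proof. by apply/eqP; rewrite eq_complex /= oppr0 !eqxx. Qed.

Lemma rnorm_sqrD x y :
  rnorm (x + y) ^+ 2 = rnorm x ^+ 2 + rnorm y ^+ 2 + 2 * complex.Re (hdot x y).
Proof.
apply: (@complexI R); rewrite -hdot_self hdotDl !hdotDr !hdot_self (hdotC x y).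
case: (hdot x y) => u v; apply/eqP; rewrite eq_complex /=.
by apply/andP; split; apply/eqP; ring.
Qed.

Lemma cnorm_conjM (a : R[i]) : a^* * a = (cnorm a ^+ 2)%:C.
Proof. by rewrite rmorphXn /= -cnormE normCK mulrC. Qed.

Lemma rnorm_sqr_proj x y (a := hdot x y / (rnorm y ^+ 2)%:C) : rnorm y != 0 ->
  rnorm (x - a *: y) ^+ 2 = rnorm x ^+ 2 - cnorm (hdot x y) ^+ 2 / rnorm y ^+ 2.
Proof.
move=> y0; rewrite rnorm_sqrD rnormN rnormZ hdotNr hdotZr.
have -> : a^* * hdot x y = (cnorm (hdot x y) ^+ 2 / rnorm y ^+ 2)%:C.
  by rewrite /a -fmorphV rmorphM /= conj_real mulrAC cnorm_conjM -rmorphM.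
have -> : cnorm a = cnorm (hdot x y) / rnorm y ^+ 2.
  by rewrite /a -fmorphV cnormM cnorm_real ger0_norm // invr_ge0 sqr_ge0.
by rewrite /=; field.
Qed.

Lemma cauchy_schwarz x y : cnorm (hdot x y) <= rnorm x * rnorm y.
Proof.
have [y0|yn0] := eqVneq (rnorm y) 0.
  by rewrite y0 (rnorm_eq0 y0) hdot0r /cnorm rnorm0 mulr0.
have yp : 0 < rnorm y by rewrite lt_neqAle eq_sym yn0 rnorm_ge0.
rewrite -(@ler_pXn2r _ 2) ?nnegrE ?mulr_ge0 ?rnorm_ge0 // exprMn.
have := sqr_ge0 (rnorm (x - (hdot x y / (rnorm y ^+ 2)%:C) *: y)).
by rewrite rnorm_sqr_proj // subr_ge0 ler_pdivrMr // exprn_gt0.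
Qed.

Lemma parallelogram x y :
  rnorm (x + y) ^+ 2 + rnorm (x - y) ^+ 2 = 2 * rnorm x ^+ 2 + 2 * rnorm y ^+ 2.
Proof. by rewrite !rnorm_sqrD rnormN hdotNr; case: (hdot x y) => u v /=; ring. Qed.

Lemma hdot_ext x y : (forall z, hdot x z = hdot y z) -> x = y.
Proof.
move=> xy; apply/eqP; rewrite -subr_eq0; apply/eqP/hdot_self_eq0.
by rewrite hdotBl xy subrr.
Qed.

(** Orthogonality to approximants passes to the limit. *)
Lemma hdot_approx0 x y (D : set H) : closure D y ->
  (forall z, D z -> hdot x z = 0) -> hdot x y = 0.
Proof.
move=> /closure_rnorm cD xD.
apply: (@small_rnorm_eq R (R[i]^o) _ _ (rnorm x)); first exact: rnorm_ge0.
move=> e e0; have [z /xD xz yz] := cD e e0.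
rewrite subr0 -[X in rnorm X]subr0 -xz -hdotBr.
by apply: (le_trans (cauchy_schwarz _ _)); rewrite ler_wpM2l ?rnorm_ge0 // ltW.
Qed.

Lemma dense_ortho (D : set H) x : dense D -> (forall z, D z -> hdot x z = 0) -> x = 0.
Proof.
by move=> dD xD; apply: hdot_self_eq0; apply: hdot_approx0 xD; exact: dense_closure.
Qed.

Lemma dense_hdot_ext (D : set H) x y : dense D ->
  (forall z, D z -> hdot x z = hdot y z) -> x = y.
Proof.
move=> dD xy; apply/eqP; rewrite -subr_eq0; apply/eqP; apply: (dense_ortho dD).
by move=> z /xy; rewrite hdotBl => ->; rewrite subrr.
Qed.

Definition subspace (K : set H) : Prop :=
  K 0 /\ forall a x y, K x -> K y -> K (a *: x + y).

Lemma subspaceD (K : set H) x y : subspace K -> K x -> K y -> K (x + y).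
Proof. by move=> [_ KZ] Kx Ky; rewrite -(scale1r x); exact: KZ. Qed.

Lemma subspaceZ (K : set H) a x : subspace K -> K x -> K (a *: x).
Proof. by move=> [K0 KZ] Kx; rewrite -(addr0 (a *: x)); exact: KZ. Qed.

Lemma subspaceB (K : set H) x y : subspace K -> K x -> K y -> K (x - y).
Proof.
by move=> sK Kx Ky; apply: subspaceD => //; rewrite -scaleN1r; exact: subspaceZ.
Qed.

Lemma subspace_sum (K : set H) n (F : 'I_n -> H) : subspace K -> (forall i, K (F i)) ->
  K (\sum_i F i).
Proof.
by move=> sK KF; elim/big_ind: _ => //; [case: sK|move=> x y; exact: subspaceD].
Qed.

Lemma subspace_closure (K : set H) : subspace K -> subspace (closure K).
Proof.
move=> [K0 KZ]; split; first exact: subset_closure.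
move=> a x y /closure_rnorm cx /closure_rnorm cy; apply/closure_rnorm => e e0.
have a1 : 0 < 2 * (cnorm a + 1) by have := cnorm_ge0 a; lra.
have [x' Kx' xx'] := cx _ (divr_gt0 e0 a1).
have [y' Ky' yy'] := cy (e / 2) ltac:(lra).
exists (a *: x' + y'); first exact: KZ.
rewrite opprD addrACA -scalerBr; apply: (le_lt_trans (rnormD _ _)); rewrite rnormZ.
suff : cnorm a * rnorm (x - x') <= e / 2 by lra.
apply: (@le_trans _ _ ((cnorm a + 1) * (e / (2 * (cnorm a + 1))))).
  by rewrite ler_pM ?cnorm_ge0 ?rnorm_ge0 ?lerDl // ltW.
rewrite invfM [e * _]mulrCA mulrA mulrC [_ * 2^-1]mulrC.
rewrite le_eqVlt; apply/orP; left; apply/eqP; field; lra.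
Qed.

(** A minimizing sequence is Cauchy by the parallelogram identity; its limit is the
    foot of the perpendicular. *)
Lemma orthogonal_projection (K : set H) x : subspace K -> closed K ->
  exists2 p, K p & forall k, K k -> hdot (x - p) k = 0.
Proof.
move=> sK cK; have [K0 KZ] := sK.
pose S := [set r | exists2 k, K k & r = rnorm (x - k) ^+ 2].
have S0 : S !=set0 by exists (rnorm (x - 0) ^+ 2); exists 0.
have Slb : has_lbound S by exists 0 => _ [k _ ->]; exact: sqr_ge0.
pose d := inf S.
have dk k : K k -> d <= rnorm (x - k) ^+ 2 by move=> Kk; apply: ge_inf => //; exists k.
have Sn (n : nat) : exists k, K k /\ rnorm (x - k) ^+ 2 < d + n.+1%:R^-1.
  have n0 : 0 < (n.+1%:R : R)^-1 by rewrite invr_gt0.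
  have [_ [k Kk ->] kd] := inf_adherent n0 (conj S0 Slb).
  by exists k.
have [u uP] := choice Sn.
have mid m n : rnorm (u m - u n) ^+ 2 <= 2 * m.+1%:R^-1 + 2 * n.+1%:R^-1.
  have [Km um] := uP m; have [Kn un] := uP n.
  have := parallelogram (x - u m) (x - u n).
  rewrite (_ : x - u m - (x - u n) = u n - u m); last first.
    by rewrite opprB addrC addrA subrK.
  rewrite rnormBC => E.
  have : 4 * d <= rnorm (x - u m + (x - u n)) ^+ 2.
    have -> : x - u m + (x - u n) = 2%:C *: (x - 2^-1%:C *: (u m + u n)).
      rewrite scalerBr scalerA -rmorphM divff ?pnatr_eq0 // scale1r.
      rewrite addrACA -opprD (_ : 2%:C = 1 + 1) ?scalerDl ?scale1r //.
      by apply/eqP; rewrite eq_complex /= addr0 !eqxx.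
    rewrite rnormZ cnorm_real exprMn ger0_norm // (_ : 2 ^+ 2 = 4); last by ring.
    rewrite ler_pM2l //; apply: dk; apply: subspaceZ => //; exact: subspaceD.
  move: E um un; move: (m.+1%:R^-1) (n.+1%:R^-1) (rnorm _ ^+ 2) (rnorm _ ^+ 2) (rnorm _ ^+ 2).
  by move=> ? ? ? ? ?; lra.
have [e e0|p pu] := @cauchy_rnorm R H u.
  have e2 : 0 < e ^+ 2 / 4 by rewrite divr_gt0 // exprn_gt0.
  have [N NP] : exists N : nat, N.+1%:R^-1 < e ^+ 2 / 4.
    exists (Num.bound (e ^+ 2 / 4)^-1).
    rewrite -[ltRHS]invrK ltf_pV2 ?posrE ?ltr0n ?invr_gt0 //.
    apply: (lt_trans (unstable.ltr_bound _)).
    by rewrite ltr_nat.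
  exists N => m n Nm Nn.
  rewrite -(@ltr_pXn2r _ 2) ?nnegrE ?rnorm_ge0 ?(ltW e0) //.
  apply: (le_lt_trans (mid m n)).
  have mono k : (N <= k)%N -> (k.+1%:R : R)^-1 <= N.+1%:R^-1.
    by move=> Nk; rewrite lef_pV2 ?posrE ?ltr0n // ler_nat.
  have := mono _ Nm; have := mono _ Nn; move: NP.
  move: (m.+1%:R^-1) (n.+1%:R^-1) (N.+1%:R^-1) (e ^+ 2) => ? ? ? ?; lra.
have Kp : K p.
  apply: cK; apply/closure_rnorm => e e0.
  have [N NP] := pu e e0; exists (u N); first by case: (uP N).
  exact: NP.
have pd : rnorm (x - p) ^+ 2 <= d.
  rewrite leNgt; apply/negP => dlt.
  have d0 : 0 <= d by apply: lb_le_inf => // _ [k _ ->]; exact: sqr_ge0.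
  pose r := rnorm (x - p).
  have r0 : 0 < r.
    rewrite lt_neqAle rnorm_ge0 andbT eq_sym; apply/eqP => E.
    by move: dlt; rewrite -/r E expr2 mul0r; lra.
  pose e := (r ^+ 2 - d) / (2 * r).
  have e0 : 0 < e by rewrite divr_gt0 ?subr_gt0 // mulr_gt0.
  have er : 2 * r * e = r ^+ 2 - d by rewrite mulrC divfK // mulf_neq0 // gt_eqF.
  have [N NP] := pu (e / 2) ltac:(lra).
  pose n := maxn N (Num.bound (r * e)^-1).
  have re0 : 0 < r * e by rewrite mulr_gt0.
  have nre : n.+1%:R^-1 < r * e.
    rewrite -[ltRHS]invrK ltf_pV2 ?posrE ?ltr0n ?invr_gt0 //.
    apply: (lt_le_trans (unstable.ltr_bound _)).
    by rewrite ler_nat ltnW // ltnS leq_maxr.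
  have [_ un] := uP n; have pn := NP n (leq_maxl _ _).
  have := rnorm_dist x (u n) p; rewrite -/r (rnormBC (u n) p).
  set s := rnorm (x - u n) in un *; have s0 : 0 <= s by exact: rnorm_ge0.
  move=> rs; have se : s > r - e / 2 by lra.
  have sd : s ^+ 2 < d + r * e by apply: (lt_trans un); rewrite ltrD2l.
  have er2 : e <= r / 2 by rewrite ler_pdivrMr ?mulr_gt0 // expr2; lra.
  have : (r - e / 2) ^+ 2 < s ^+ 2 by rewrite ltr_pXn2r // nnegrE; lra.
  by have := sqr_ge0 e; nra.
exists p => // k Kk.
have [k0|kn0] := eqVneq (rnorm k) 0; first by rewrite (rnorm_eq0 k0) hdot0r.
have kp : 0 < rnorm k ^+ 2 by rewrite exprn_gt0 // lt_neqAle eq_sym kn0 rnorm_ge0.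
pose a := hdot (x - p) k / (rnorm k ^+ 2)%:C.
have := dk (p + a *: k) (subspaceD sK Kp (subspaceZ a sK Kk)).
rewrite opprD addrA rnorm_sqr_proj // => H1.
have : cnorm (hdot (x - p) k) ^+ 2 / rnorm k ^+ 2 <= 0 by lra.
rewrite ler_pdivrMr // mul0r => H2; apply: cnorm_eq0; apply/eqP.
by rewrite -sqrf_eq0 eq_le H2 sqr_ge0.
Qed.

End InnerProduct.

(** * Unitary operators *)

Section Unitaries.
Variable R : realType.
Implicit Types (H : hilbert R).

Section Basic.
Variables (H1 H2 : hilbert R) (W : H1 -> H2).
Hypothesis uW : unitary W.

Lemma unitaryZD a x y : W (a *: x + y) = a *: W x + W y.
Proof. by case: uW => lW _ _; exact: lW. Qed.
Lemma unitaryD x y : W (x + y) = W x + W y.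
Proof. by have := unitaryZD 1 x y; rewrite !scale1r. Qed.
Lemma unitary0 : W 0 = 0.
Proof. by have := unitaryZD (-1) 0 0; rewrite addr0 scaler0 scaleN1r addNr. Qed.
Lemma unitaryZ a x : W (a *: x) = a *: W x.
Proof. by have := unitaryZD a x 0; rewrite unitary0 !addr0. Qed.
Lemma unitaryN x : W (- x) = - W x.
Proof. by rewrite -scaleN1r unitaryZ scaleN1r. Qed.
Lemma unitaryB x y : W (x - y) = W x - W y.
Proof. by rewrite unitaryD unitaryN. Qed.
Lemma unitary_sum (I : Type) (r : seq I) (F : I -> H1) :
  W (\sum_(i <- r) F i) = \sum_(i <- r) W (F i).
Proof. exact: (big_morph W unitaryD unitary0). Qed.
Lemma unitary_hdot x y : hdot (W x) (W y) = hdot x y.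
Proof. by case: uW. Qed.
Lemma unitary_rnorm x : rnorm (W x) = rnorm x.
Proof.
apply/eqP; rewrite -(@eqrXn2 _ 2) ?rnorm_ge0 //; apply/eqP.
by apply: (@complexI R); rewrite -!hdot_self unitary_hdot.
Qed.
Lemma unitary_norm x : `|W x| = `|x|.
Proof. by rewrite !rnormE unitary_rnorm. Qed.
Lemma unitary_inj : injective W.
Proof.
move=> x y /eqP; rewrite -subr_eq0 -unitaryB => /eqP E.
by apply/eqP; rewrite -subr_eq0; apply/eqP/rnorm_eq0; rewrite -unitary_rnorm E rnorm0.
Qed.

Lemma unitary_inv : exists V, [/\ unitary V, cancel W V, cancel V W & V = adj W].
Proof.
have [_ _ sW] := uW; have [V VW] := choice sW.
have WV : cancel W V by move=> x; apply: unitary_inj; rewrite VW.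
exists V; split => //; last first.
  apply/funext => y; rewrite /adj; case: xgetP => [z _ zP|/(_ (V y)) []].
    apply/esym/hdot_ext => x; rewrite hdotC -zP -(VW y) unitary_hdot WV.
    by rewrite -hdotC.
  by move=> x; rewrite /= -{1}(VW y) unitary_hdot.
split.
- by move=> a x y; apply: unitary_inj; rewrite unitaryZD !VW.
- by move=> x y; rewrite -unitary_hdot !VW.
- by move=> y; exists (W y).
Qed.

Lemma unitary_continuous : continuous W.
Proof.
move=> x; apply/cvg_rnorm => e e0; apply/nbhs_rnorm; exists e => // y.
by rewrite -unitaryB unitary_rnorm.
Qed.

Lemma unitary_dense_image (D : set H1) : dense D -> dense (W @` D).
Proof.
move=> dD; apply: rnorm_dense => y e e0.
have [_ _ /(_ y) [x <-]] := uW.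
have [d Dd xd] := dense_rnorm dD x e0.
by exists (W d); [exists d|rewrite -unitaryB unitary_rnorm].
Qed.

End Basic.

Lemma unitary_comp (H1 H2 H3 : hilbert R) (W : H2 -> H3) (V : H1 -> H2) :
  unitary W -> unitary V -> unitary (W \o V).
Proof.
move=> [lW iW sW] [lV iV sV]; split.
- by move=> a x y /=; rewrite lV lW.
- by move=> x y /=; rewrite iW iV.
- by move=> z; have [y <-] := sW z; have [x <-] := sV y; exists x.
Qed.

Lemma unitary_id H : unitary (@id H).
Proof. by split => // y; exists y. Qed.

(** Approximants of x along the relation have partners that form a Cauchy sequence. *)
Lemma isometric_relation_total (V1 : normedModType R[i])
    (V2 : completeNormedModType R[i]) (G : set (V1 * V2)) x :
  (forall p q, G p -> G q -> rnorm (p.1 - q.1) = rnorm (p.2 - q.2)) ->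
  dense (fst @` G) ->
  exists y, forall e, 0 < e ->
    exists2 p, G p & rnorm (x - p.1) < e /\ rnorm (y - p.2) < e.
Proof.
move=> dG d1.
have step (n : nat) : exists p, G p /\ rnorm (x - p.1) < n.+1%:R^-1.
  have n0 : 0 < (n.+1%:R : R)^-1 by rewrite invr_gt0.
  have [_ [p Gp <-] xp] := dense_rnorm d1 x n0.
  by exists p.
have [u uP] := choice step.
have small e : 0 < e -> exists N : nat, forall n, (N <= n)%N -> (n.+1%:R : R)^-1 < e.
  move=> e0; exists (Num.bound e^-1) => n Nn.
  rewrite -[ltRHS]invrK ltf_pV2 ?posrE ?ltr0n ?invr_gt0 //.
  by apply: (lt_le_trans (unstable.ltr_bound _)); rewrite ler_nat ltnW // ltnS.
have [e e0|y yu] := @cauchy_rnorm R V2 (fun n => (u n).2).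
  have [N NP] := small (e / 2) ltac:(lra).
  exists N => m n Nm Nn; rewrite -dG; [|by case: (uP m)|by case: (uP n)].
  apply: (le_lt_trans (rnorm_dist _ x _)); rewrite rnormBC.
  have [_ xm] := uP m; have [_ xn] := uP n.
  have := lt_trans xm (NP _ Nm); have := lt_trans xn (NP _ Nn); lra.
exists y => e e0; have [N NP] := small e e0; have [N' NP'] := yu e e0.
pose n := maxn N N'; have [Gn xn] := uP n.
exists (u n) => //; split; last exact: NP' (leq_maxr _ _).
exact: lt_trans xn (NP _ (leq_maxl _ _)).
Qed.

(** The relation is isometric and total on both sides, so that it extends by limits;
    polarization recovers the inner products from the norms. *)
Lemma unitary_extension (H1 H2 : hilbert R) (G : set (H1 * H2)) :
  (forall a p q, G p -> G q -> G (a *: p.1 + q.1, a *: p.2 + q.2)) ->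
  (forall p, G p -> rnorm p.1 = rnorm p.2) ->
  dense (fst @` G) -> dense (snd @` G) ->
  exists2 W : H1 -> H2, unitary W & forall p, G p -> W p.1 = p.2.
Proof.
move=> lG iG d1 d2.
have dG p q : G p -> G q -> rnorm (p.1 - q.1) = rnorm (p.2 - q.2).
  move=> Gp Gq; have := iG _ (lG (-1) q p Gq Gp); rewrite /= !scaleN1r.
  by rewrite ![- _ + _]addrC.
pose P x y := forall e, 0 < e -> exists2 p, G p & rnorm (x - p.1) < e /\ rnorm (y - p.2) < e.
have ex x : exists y, P x y by exact: isometric_relation_total.
have [W WP] := choice ex.
have WB x x' y y' : P x y -> P x' y' -> rnorm (y - y') = rnorm (x - x').
  move=> Pxy Px'y'; apply/eqP.
  suff H a b : P a b -> forall a' b', P a' b' -> rnorm (b - b') <= rnorm (a - a') /\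
      rnorm (a - a') <= rnorm (b - b').
    by have [h1 h2] := H _ _ Pxy _ _ Px'y'; rewrite eq_le h1 h2.
  move=> Pab a' b' Pab'.
  have key e : 0 < e -> rnorm (b - b') <= rnorm (a - a') + 4 * e /\
      rnorm (a - a') <= rnorm (b - b') + 4 * e.
    move=> e0; have [p Gp [ap bp]] := Pab e e0; have [q Gq [aq bq]] := Pab' e e0.
    have E := dG _ _ Gp Gq.
    have := rnorm_dist b p.2 b'; have := rnorm_dist p.2 q.2 b'.
    have := rnorm_dist a p.1 a'; have := rnorm_dist p.1 q.1 a'.
    have := rnorm_dist p.1 a q.1; have := rnorm_dist a a' q.1.
    have := rnorm_dist p.2 b q.2; have := rnorm_dist b b' q.2.
    rewrite (rnormBC q.2 b') (rnormBC q.1 a') (rnormBC p.1 a) (rnormBC p.2 b).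
    lra.
  split; rewrite leNgt; apply/negP => lt.
    by have [+ _] := key ((rnorm (b - b') - rnorm (a - a')) / 8) ltac:(lra); lra.
  by have [_ +] := key ((rnorm (a - a') - rnorm (b - b')) / 8) ltac:(lra); lra.
have Wu x y : P x y -> W x = y.
  move=> Pxy; apply/eqP; rewrite -subr_eq0; apply/eqP/rnorm_eq0.
  by rewrite (WB _ _ _ _ (WP x) Pxy) subrr rnorm0.
have GP p : G p -> P p.1 p.2.
  by move=> Gp e e0; exists p => //; rewrite !subrr !rnorm0.
have PZ a x y x' y' : P x y -> P x' y' -> P (a *: x + x') (a *: y + y').
  move=> Pxy Pxy' e e0.
  have a1 : 0 < cnorm a + 1 by have := cnorm_ge0 a; lra.
  have e1 : 0 < e / (2 * (cnorm a + 1)) by rewrite divr_gt0 // mulr_gt0.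
  have e2 : 0 < e / 2 by lra.
  have [p Gp [xp yp]] := Pxy _ e1; have [q Gq [xq yq]] := Pxy' _ e2.
  exists (a *: p.1 + q.1, a *: p.2 + q.2); first exact: lG.
  have bound (V : normedModType R[i]) (u v u' v' : V) : rnorm (u - u') < e / (2 * (cnorm a + 1)) ->
      rnorm (v - v') < e / 2 -> rnorm (a *: u + v - (a *: u' + v')) < e.
    move=> uu' vv'; rewrite opprD addrACA -scalerBr.
    apply: (le_lt_trans (rnormD _ _)); rewrite rnormZ.
    suff : cnorm a * rnorm (u - u') <= e / 2 by lra.
    apply: (@le_trans _ _ ((cnorm a + 1) * (e / (2 * (cnorm a + 1))))).
      by rewrite ler_pM ?cnorm_ge0 ?rnorm_ge0 ?lerDl // ltW.
    by rewrite le_eqVlt; apply/orP; left; apply/eqP; field; lra.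
  by split; exact: bound.
exists W; last by move=> p Gp; apply: Wu; exact: GP.
have lW a x y : W (a *: x + y) = a *: W x + W y by apply: Wu; exact: PZ.
have P0 : P 0 0 by move=> e e0; have := PZ (-1) _ _ _ _ (WP 0) (WP 0);
  rewrite !scaleN1r !addNr; apply.
have nW x : rnorm (W x) = rnorm x.
  by have := WB _ _ _ _ (WP x) P0; rewrite !subr0.
split.
- exact: lW.
- move=> x y.
  have reW u v : complex.Re (hdot (W u) (W v)) = complex.Re (hdot u v).
    have := rnorm_sqrD (W u) (W v); have := rnorm_sqrD u v.
    have -> : W u + W v = W (u + v) by have := lW 1 u v; rewrite !scale1r.
    by rewrite !nW; lra.
  have W0 : W 0 = 0 by exact: Wu.
  have := reW ('i *: x) y; have := reW x y.
  have -> : W ('i *: x) = 'i *: W x by have := lW 'i x 0; rewrite W0 !addr0.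
  rewrite !hdotZl; case: (hdot (W x) (W y)) => a b; case: (hdot x y) => c d /= -> E.
  by congr (_ +i* _); lra.
- move=> y.
  have [x Pxy] : exists x, P x y; last by exists x; exact: Wu.
  have [||x xP] := @isometric_relation_total H2 H1 [set p | G (p.2, p.1)] y.
  - by move=> p q /dG H /H /esym.
  - rewrite (_ : _ @` _ = snd @` G) //; apply/seteqP; split => [_ [[u v] Gp <-]|_ [[u v] Gp <-]].
      by exists (v, u).
    by exists (v, u).
  by exists x => e /xP [[u v] Gp [yp xp]]; exists (v, u).
Qed.

End Unitaries.

(** * One-parameter unitary groups *)

Section Phases.
Variables (R : realType) (H : hilbert R).
Implicit Types (u v w : H -> H).

Lemma phase_refl u : up_to_phase u u.
Proof. by exists 1; rewrite normr1; split=> // x; rewrite scale1r. Qed.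

Lemma norm1_neq0 (l : R[i]) : `|l| = 1 -> l != 0.
Proof. by move=> l1; rewrite -normr_eq0 l1 oner_eq0. Qed.

Lemma phase_sym u v : up_to_phase u v -> up_to_phase v u.
Proof.
move=> [l [l1 uv]]; exists l^-1; rewrite normfV l1 invr1; split=> // x.
by rewrite uv scalerA mulVf ?scale1r // norm1_neq0.
Qed.

Lemma phase_trans v u w : up_to_phase u v -> up_to_phase v w -> up_to_phase u w.
Proof.
move=> [l [l1 uv]] [m [m1 vw]]; exists (l * m); rewrite normrM l1 m1 mulr1.
by split=> // x; rewrite uv vw scalerA.
Qed.

Lemma phase_comp u u' v v' : unitary u' -> up_to_phase u u' -> up_to_phase v v' ->
  up_to_phase (u \o v) (u' \o v').
Proof.
move=> uu [l [l1 uE]] [m [m1 vE]]; exists (l * m); rewrite normrM l1 m1 mulr1.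
by split=> // x /=; rewrite uE vE unitaryZ // scalerA.
Qed.

Lemma phase_compl u v v' : unitary u -> up_to_phase v v' ->
  up_to_phase (u \o v) (u \o v').
Proof. by move=> uu; apply: phase_comp => //; exact: phase_refl. Qed.

Lemma phase_compr u u' v : up_to_phase u u' -> up_to_phase (u \o v) (u' \o v).
Proof. by move=> [l [l1 uE]]; exists l; split=> // x /=; exact: uE. Qed.

(** A common fixed vector forces the phase to be 1. *)
Lemma phase_fix u v x : up_to_phase u v -> u x = x -> v x = x -> rnorm x != 0 ->
  forall y, u y = v y.
Proof.
move=> [l [l1 uv]] ux vx x0 y; suff l1' : l = 1 by rewrite uv l1' scale1r.
have : (1 - l) *: x = 0 by rewrite scalerBl scale1r -{2}vx -uv ux subrr.
move=> /(congr1 (@rnorm _ _)); rewrite rnormZ rnorm0 => /eqP.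
by rewrite mulf_eq0 (negbTE x0) orbF => /eqP /cnorm_eq0 /eqP; rewrite subr_eq0 => /eqP.
Qed.

End Phases.

Section Curves.
Variable R : realType.
Implicit Types (V : normedModType R[i]) (e : R).

Lemma half_gt0 e : 0 < e -> 0 < e / 2.
Proof. by move=> e0; rewrite divr_gt0. Qed.

(** Differentiability of a curve in explicit form, which composes with isometries and
    with products of groups without limits of quotients. *)
Definition has_deriv V (f : R -> V) (t : R) (d : V) : Prop :=
  forall e, 0 < e -> exists2 r, 0 < r & forall h : R, `|h| < r ->
    rnorm (f (t + h) - f t - h%:C *: d) <= e * `|h|.

Lemma norm_i : `|'i%C| = 1 :> R[i].
Proof. by rewrite cnormE cnorm_i. Qed.

Lemma has_deriv0_Re (f : R -> (R[i])^o) t : has_deriv f t 0 ->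
  is_derive t (1 : R) (fun s => complex.Re (f s)) 0 /\
  is_derive t (1 : R) (fun s => complex.Im (f s)) 0.
Proof.
move=> fd.
have gen (g : R[i] -> R) : (forall a b, g (a - b) = g a - g b) ->
    (forall a, `|g a| <= cnorm a) -> is_derive t (1 : R) (fun s => g (f s)) 0.
  move=> gB gn; have Hc : (fun h : R => h^-1 *: (((fun s => g (f s)) \o shift t) (h *: 1)
      - g (f t))) @ 0^' --> (0 : R).
    apply/cvgr0Pnorm_lt => e e0.
    have [r r0 fr] := fd (e / 2) (half_gt0 e0).
    near=> h.
    have h0 : h != 0 by near: h; exact: nbhs_dnbhs_neq.
    have hr : `|h| < r by near: h; exact: dnbhs0_lt.
    rewrite /GRing.scale /= mulr1 normrM normfV ltr_pdivrMl ?normr_gt0 //.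
    rewrite [h + t]addrC -gB; apply: (le_lt_trans (gn _)).
    have := fr h hr; rewrite scaler0 subr0 => /le_lt_trans; apply.
    by rewrite mulrC ltr_pM2l ?normr_gt0 //; lra.
  by split; [apply/cvg_ex; exists 0|exact: cvg_lim Hc].
split; apply: gen.
- by move=> [? ?] [? ?].
- by move=> a; rewrite -lecR -cnormE; exact: normc_ge_Re.
- by move=> [? ?] [? ?].
- move=> a; have := normc_ge_Re (a * - 'i%C).
  rewrite normrM normrN norm_i mulr1 cnormE lecR.
  by case: a => x y /=; rewrite !oppr0 !mulr0 sub0r mulrN1 opprK.
Unshelve. all: by end_near. Qed.

Lemma has_deriv0_cst (H : hilbert R) (f : R -> H) : (forall t, has_deriv f t 0) ->
  forall s t, f s = f t.
Proof.
move=> fd s t; apply: hdot_ext => z.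
have gd u : has_deriv ((fun u => hdot (f u) z) : R -> (R[i])^o) u 0.
  move=> e e0; have z0 : 0 < rnorm z + 1 by have := rnorm_ge0 z; lra.
  have [r r0 fr] := fd u _ (divr_gt0 e0 z0).
  exists r => // h hr; rewrite scaler0 subr0.
  have := fr h hr; rewrite scaler0 subr0 => fh.
  rewrite -hdotBl; apply: (le_trans (cauchy_schwarz _ _)).
  apply: (@le_trans _ _ (e / (rnorm z + 1) * `|h| * (rnorm z + 1))).
    by rewrite ler_pM ?rnorm_ge0 // lerDl.
  by rewrite mulrAC divfK // gt_eqF.
apply/eqP; rewrite eq_complex; apply/andP; split; apply/eqP.
  apply: (@is_derive_0_is_cst R (fun u => complex.Re (hdot (f u) z))) => u.
  by have [] := has_deriv0_Re (gd u).
apply: (@is_derive_0_is_cst R (fun u => complex.Im (hdot (f u) z))) => u.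
by have [] := has_deriv0_Re (gd u).
Qed.

Lemma has_deriv_unique V (f : R -> V) t d d' : has_deriv f t d -> has_deriv f t d' ->
  d = d'.
Proof.
move=> fd fd'; apply: (@small_rnorm_eq R V _ _ 2) => // e e0.
have [r r0 fr] := fd e e0; have [r' r'0 fr'] := fd' e e0.
pose h := Num.min r r' / 2.
have h0 : 0 < h by rewrite divr_gt0 // lt_min r0.
have hr : `|h| < r /\ `|h| < r'.
  rewrite gtr0_norm // /h; have : Num.min r r' <= r /\ Num.min r r' <= r'.
    by rewrite !ge_min !lexx orbT.
  by rewrite /h in h0; move: (Num.min r r') h0 => m m0 [? ?]; lra.
have := fr h hr.1; have := fr' h hr.2; rewrite (gtr0_norm h0).
set a := f (t + h) - f t => ad' ad.
have : rnorm (h%:C *: (d - d')) <= 2 * e * h.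
  rewrite scalerBr (_ : _ - _ = (a - h%:C *: d') - (a - h%:C *: d)); last first.
    by rewrite opprD opprK addrACA subrr add0r addrC.
  by apply: (le_trans (rnormB _ _)); lra.
by rewrite rnormZ cnorm_real gtr0_norm // mulrC ler_pM2r.
Qed.

Lemma has_deriv_hdotl (H : hilbert R) (f : R -> H) t d z : has_deriv f t d ->
  has_deriv ((fun s => hdot (f s) z) : R -> (R[i])^o) t (hdot d z).
Proof.
move=> fd e e0; have z0 : 0 < rnorm z + 1 by have := rnorm_ge0 z; lra.
have [r r0 fr] := fd _ (divr_gt0 e0 z0).
exists r => // h hr; rewrite /GRing.scale /= -hdotZl -!hdotBl.
apply: (le_trans (cauchy_schwarz _ _)).
apply: (@le_trans _ _ (e / (rnorm z + 1) * `|h| * (rnorm z + 1))).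
  by rewrite ler_pM ?rnorm_ge0 ?fr // lerDl.
by rewrite mulrAC divfK // gt_eqF.
Qed.

Lemma has_deriv_isometry V V' (A : V -> V') (f : R -> V) t d :
  (forall a x y, A (a *: x + y) = a *: A x + A y) -> (forall x, rnorm (A x) = rnorm x) ->
  has_deriv f t d -> has_deriv (fun s => A (f s)) t (A d).
Proof.
move=> lA nA fd e e0; have [r r0 fr] := fd e e0; exists r => // h hr.
have -> : A (f (t + h)) - A (f t) - h%:C *: A d = A (f (t + h) - f t - h%:C *: d).
  have A0 : A 0 = 0 by have := lA (-1) 0 0; rewrite addr0 scaler0 scaleN1r addNr.
  have AN x : A (- x) = - A x by have := lA (-1) x 0; rewrite A0 !addr0 !scaleN1r.
  have AD x y : A (x + y) = A x + A y by have := lA 1 x y; rewrite !scale1r.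
  have AZ a x : A (a *: x) = a *: A x by have := lA a x 0; rewrite A0 !addr0.
  by rewrite !AD !AN AZ.
by rewrite nA; exact: fr.
Qed.

Lemma has_deriv_eq V (f g : R -> V) t d : (forall s, f s = g s) -> has_deriv f t d ->
  has_deriv g t d.
Proof. by move=> /funext ->. Qed.

Lemma has_deriv_near V (f g : R -> V) d (r : R) : 0 < r ->
  (forall s, `|s| < r -> f s = g s) -> has_deriv f 0 d -> has_deriv g 0 d.
Proof.
move=> r0 fg fd e e0; have [r' r'0 fr] := fd e e0.
exists (Num.min r r'); first by rewrite lt_min r0.
move=> h; rewrite lt_min => /andP[hr hr'].
rewrite -!fg ?add0r // ?normr0 //; have := fr h hr'; by rewrite add0r.
Qed.

Lemma has_deriv_cst V (x : V) t : has_deriv (fun=> x) t 0.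
Proof.
move=> e e0; exists 1 => // h _; rewrite subrr scaler0 subr0 rnorm0.
by rewrite mulr_ge0 // ltW.
Qed.

End Curves.

Section UnitaryGroups.
Variables (R : realType) (H : hilbert R).
Implicit Types (U E : R -> H -> H) (x y : H) (t s : R).

Record unitary_group U : Prop := UnitaryGroup {
  group_unitary : forall t, unitary (U t);
  groupD : forall s t x, U (s + t) x = U s (U t x) }.

Lemma unitary_rep_group U : unitary_rep setT +%R U -> unitary_group U.
Proof. by case=> uU UD _; split=> [t|s t x]; [exact: uU|rewrite UD]. Qed.

Section OneGroup.
Variable U : R -> H -> H.
Hypothesis gU : unitary_group U.
Let uU t := group_unitary gU t.

Lemma group0 x : U 0 x = x.
Proof. by apply: (unitary_inj (uU 0)); rewrite -groupD // addr0. Qed.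

Lemma groupNK t : cancel (U t) (U (- t)).
Proof. by move=> x; rewrite -groupD // addNr group0. Qed.

Lemma groupKN t : cancel (U (- t)) (U t).
Proof. by move=> x; rewrite -groupD // subrr group0. Qed.

Lemma generatorP x y : generator U (x, y) <-> has_deriv (fun t => U t x) 0 ('i *: y).
Proof.
have i0 : 'i%C != 0 :> R[i] by rewrite norm1_neq0 // cnormE cnorm_i.
have est t : t != 0 -> rnorm (U t x - x - t%:C *: ('i *: y)) =
    `|t| * rnorm (y - ('i * t%:C)^-1 *: (U t x - x)).
  move=> t0; have tC : t%:C != 0 :> R[i] by apply/eqP => /complexI /eqP; apply/negP.
  rewrite -(mul1r `|t|) -{1}cnorm_i -cnorm_real -cnormM -rnormZ rnormBC.
  by rewrite scalerBr !scalerA divff ?mulf_neq0 // scale1r mulrC.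
split=> [/cvg_rnorm gen e e0|fd].
  have [r /= r0 rP] := gen e e0; exists r => // h hr.
  rewrite add0r group0; have [->|h0] := eqVneq h 0.
    by rewrite group0 scale0r !subr0 subrr rnorm0 normr0 mulr0.
  rewrite est // mulrC ler_pM2r ?normr_gt0 // ltW //.
  by apply: (rP h) => //=; rewrite sub0r normrN.
apply/cvg_rnorm => e e0; have [r r0 fr] := fd (e / 2) (half_gt0 e0).
near=> h.
have h0 : h != 0 by near: h; exact: nbhs_dnbhs_neq.
have hr : `|h| < r by near: h; exact: dnbhs0_lt.
have := fr h hr; rewrite add0r group0 est // mulrC ler_pM2r ?normr_gt0 //.
by move=> /= H0; lra.
Unshelve. all: by end_near. Qed.

Lemma generator_group x y t : generator U (x, y) -> generator U (U t x, U t y).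
Proof.
move=> gxy; apply/generatorP.
apply: (@has_deriv_eq _ _ (fun s => U t (U s x))).
  by move=> s; rewrite -!groupD // addrC.
rewrite -(unitaryZ (uU t)); apply: has_deriv_isometry.
- exact: unitaryZD.
- exact: unitary_rnorm.
- exact/generatorP.
Qed.

Lemma generator_unique x y y' : generator U (x, y) -> generator U (x, y') -> y = y'.
Proof.
move=> /generatorP h /generatorP h'.
have /eqP := has_deriv_unique h h'; rewrite -subr_eq0 -scalerBr scaler_eq0.
by rewrite (negbTE (norm1_neq0 _)) ?cnormE ?cnorm_i // subr_eq0 => /eqP.
Qed.

End OneGroup.

(** The curve E (- t) (U t x) has a vanishing derivative, since U and E move U t x at
    the same speed. *)
Lemma group_agree U E x (y : R -> H) : unitary_group U -> unitary_group E ->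
  (forall t, generator U (U t x, y t)) -> (forall t, generator E (U t x, y t)) ->
  forall t, U t x = E t x.
Proof.
move=> gU gE Uxy Exy t.
suff Ex : E (- t) (U t x) = x by rewrite -[in RHS]Ex (groupKN gE).
transitivity (E (- 0) (U 0 x)); last by rewrite oppr0 !group0.
apply: (@has_deriv0_cst R H (fun t => E (- t) (U t x))) => {t} t e e0.
have [r r0 rP] := (generatorP gU _ _).1 (Uxy t) (e / 2) (half_gt0 e0).
have [r' r'0 rP'] := (generatorP gE _ _).1 (Exy t) (e / 2) (half_gt0 e0).
exists (Num.min r r'); first by rewrite lt_min r0.
move=> h; rewrite lt_min => /andP[hr hr'].
set z := U t x in rP rP' *.
have -> : E (- (t + h)) (U (t + h) x) - E (- t) z = E (- t) (E (- h) (U h z - E h z)).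
  rewrite opprD (groupD gE) [t + h]addrC (groupD gU) -/z.
  by rewrite (unitaryB (group_unitary gE _)) (groupNK gE) (unitaryB (group_unitary gE _)).
rewrite scaler0 subr0 !(unitary_rnorm (group_unitary gE _)).
rewrite -[U h _](subrK z) -[E h _](subrK z) opprD addrACA subrr addr0.
have := rP h hr; have := rP' h hr'; rewrite !add0r group0 // group0 //.
move: (E h _ - _) (U h _ - _) (_ *: _) => a b c ac bc.
rewrite (_ : b - a = (b - c) - (a - c)); last by rewrite opprB addrA subrK.
by apply: (le_trans (rnormB _ _)); lra.
Qed.

Definition phase_group (l : R) : R -> H -> H := fun t x => expi (l * t) *: x.

Lemma phase_group_unitary l : unitary_group (phase_group l).
Proof.
split.
- move=> t; have e1 : expi (l * t) * (expi (l * t))^* = 1 :> R[i].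
    by rewrite -normCK norm_expi expr1n.
  split.
  + by move=> a x y; rewrite /phase_group scalerDr !scalerA mulrC.
  + by move=> x y; rewrite hdotZl hdotZr mulrA e1 mul1r.
  + move=> y; exists ((expi (l * t))^* *: y).
    by rewrite /phase_group scalerA e1 scale1r.
- move=> s t x; rewrite /phase_group scalerA -[_ * _ in RHS](_ : expi (l * (s + t)) = _) //.
  by apply/eqP; rewrite eq_complex /= mulrDr cosD sinD eqxx /= addrC [sin _ * _]mulrC addrC.
Qed.

Lemma generator_phase (l : R) x : generator (phase_group l) (x, l%:C *: x).
Proof.
apply/generatorP; first exact: phase_group_unitary.
move=> e e0; rewrite /phase_group.
have x1 : 0 < rnorm x + 1 by have := rnorm_ge0 x; lra.
pose e' := e / (2 * (rnorm x + 1)).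
have e'0 : 0 < e' by rewrite divr_gt0 // mulr_gt0.
have est (f : R -> R) (d : R) : is_derive (0 : R) (1 : R) f d ->
    exists2 r, 0 < r & forall h : R, `|h| < r -> `|f h - f 0 - h * d| <= e' * `|h|.
  move=> [df fd].
  have cvf : (fun h : R => h^-1 *: ((f \o shift 0) (h *: 1) - f 0)) @ 0^' --> d.
    by rewrite -fd; exact: df.
  have /cvgrPdist_lt /(_ e' e'0) [r /= r0 rP] := cvf.
  exists r => // h hr; have [->|h0] := eqVneq h 0.
    by rewrite mul0r subr0 subrr normr0 mulr0.
  have := rP h; rewrite /= sub0r normrN hr => /(_ isT h0) /ltW.
  rewrite addr0 /GRing.scale /= mulr1 => bd.
  have -> : f h - f 0 - h * d = h * (h^-1 * (f h - f 0) - d) by field.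
  by rewrite normrM mulrC ler_wpM2r // distrC.
have dl : is_derive (0 : R) (1 : R) (fun t => l * t) l.
  by have := is_deriveZ l (is_derive_id (0 : R) (1 : R)); rewrite /GRing.scale /= mulr1.
have dc : is_derive (0 : R) (1 : R) (fun t => cos (l * t)) 0.
  have := @is_derive1_comp _ cos (fun t => l * t) 0 _ _ (is_derive_cos _) dl.
  by rewrite mulr0 sin0 oppr0 mul0r.
have ds : is_derive (0 : R) (1 : R) (fun t => sin (l * t)) l.
  have := @is_derive1_comp _ sin (fun t => l * t) 0 _ _ (is_derive_sin _) dl.
  by rewrite mulr0 cos0 mul1r.
have [r r0 rP] := est _ _ dc; have [r' r'0 rP'] := est _ _ ds.
exists (Num.min r r'); first by rewrite lt_min r0.
move=> h; rewrite lt_min => /andP[hr hr'].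
rewrite add0r mulr0 !scalerA -!scalerBl rnormZ.
have -> : expi (l * h) - expi 0 - h%:C * 'i * l%:C =
    (cos (l * h) - cos (l * 0) - h * 0) +i* (sin (l * h) - sin (l * 0) - h * l).
  by apply/eqP; rewrite eq_complex /= !mulr0; apply/andP; split; apply/eqP; ring.
set u := _ - _ - _ * 0; set v := _ - _ - _ * l.
have : cnorm (u +i* v) <= 2 * e' * `|h|.
  have -> : u +i* v = u%:C + 'i * v%:C.
    by apply/eqP; rewrite eq_complex /= !mul0r !mul1r subr0 !add0r addr0 !eqxx.
  apply: (@le_trans _ _ (cnorm u%:C + cnorm ('i * v%:C))).
    exact: (rnormD (u%:C : R[i]^o) ('i * v%:C)).
  rewrite cnormM cnorm_i mul1r !cnorm_real.
  by have := rP h hr; have := rP' h hr'; rewrite -/u -/v; lra.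
move=> bd; apply: (@le_trans _ _ (2 * e' * `|h| * (rnorm x + 1))).
  by rewrite ler_pM ?cnorm_ge0 ?rnorm_ge0 // lerDl.
rewrite /e' le_eqVlt; apply/orP; left; apply/eqP; field; lra.
Qed.

(** Both U and the scalar group exp(i l t) have the derivative i l x along the orbit. *)
Lemma group_eigen U (l : R) x : unitary_group U -> generator U (x, l%:C *: x) ->
  forall t, U t x = expi (l * t) *: x.
Proof.
move=> gU gx t; apply: (@group_agree U (phase_group l) x (fun t => U t (l%:C *: x))) => //.
- exact: phase_group_unitary.
- by move=> s; exact: generator_group.
- by move=> s; rewrite (unitaryZ (group_unitary gU s)); exact: generator_phase.
Qed.

Lemma eigen_generator U (l : R) x : unitary_group U ->
  (forall t, U t x = expi (l * t) *: x) -> generator U (x, l%:C *: x).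
Proof.
move=> gU Ux; apply/generatorP => //.
have /generatorP -/(_ (phase_group_unitary l)) := @generator_phase l x.
by apply: has_deriv_eq => s; rewrite Ux.
Qed.

End UnitaryGroups.

Lemma generator_intertwine (R : realType) (H1 H2 : hilbert R) (W : H1 -> H2)
    (U : R -> H1 -> H1) (E : R -> H2 -> H2) x y :
  unitary W -> unitary_group U -> unitary_group E -> (forall t x, W (U t x) = E t (W x)) ->
  generator U (x, y) -> generator E (W x, W y).
Proof.
move=> uW gU gE WUE /(generatorP gU) xy; apply/(generatorP gE).
apply: (@has_deriv_eq _ _ (fun s => W (U s x))); first by move=> s; exact: WUE.
rewrite -(unitaryZ uW); apply: has_deriv_isometry => //; first exact: unitaryZD.
exact: unitary_rnorm.
Qed.

(** After transport to one space, group_agree applies on the dense domain of the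
    generator. *)
Lemma group_intertwine (R : realType) (H1 H2 : hilbert R) (W : H1 -> H2)
    (U : R -> H1 -> H1) (E : R -> H2 -> H2) :
  unitary W -> unitary_group U -> unitary_group E ->
  (forall x y, generator U (x, y) -> generator E (W x, W y)) ->
  dense (op_dom (generator U)) ->
  forall t x, W (U t x) = E t (W x).
Proof.
move=> uW gU gE WUE dU t x.
have [V [uV WV VW _]] := unitary_inv uW.
have gVE : unitary_group (fun t x => V (E t (W x))).
  split=> [s|s r z].
    exact: unitary_comp uV (unitary_comp (group_unitary gE s) uW).
  by rewrite VW groupD.
have H0 z : op_dom (generator U) z -> U t z = V (E t (W z)).
  move=> [[z1 y] /= gzy <-].
  apply: (@group_agree _ _ U _ z1 (fun t => U t y) gU gVE) => s.
    exact: generator_group.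
  apply/generatorP => //.
  have /generatorP -/(_ gE) := WUE _ _ (@generator_group _ _ _ gU _ _ s gzy).
  move=> /(@has_deriv_isometry R H2 H1 V); rewrite unitaryZ // WV; apply.
    exact: unitaryZD.
  exact: unitary_rnorm.
rewrite -[RHS]VW; congr W; apply: (@small_rnorm_eq R H1 _ _ 2) => // e e0.
have [z dz xz] := dense_rnorm dU x e0.
have := rnorm_dist (U t x) (U t z) (V (E t (W x))).
rewrite [X in _ + rnorm (X - _)](H0 z dz).
rewrite -(unitaryB (group_unitary gU t)) -(unitaryB (group_unitary gVE t)).
rewrite (unitary_rnorm (group_unitary gU t)) (unitary_rnorm uV).
rewrite (unitary_rnorm (group_unitary gE t)) (unitary_rnorm uW) (rnormBC z x); lra.
Qed.

(** * Vacuum modules of the Virasoro algebra *)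

Section VacuumModules.
Variable R : realType.

(** The algebraic part of the representation: the action of the modes on the finite
    energy vectors. *)
Record vacuum_module (H : hilbert R) (D : set H) (l : int -> H -> H) (c : R)
    (Om : H) : Prop := VacuumModule {
  vm_subspace : subspace D;
  vm_dense : dense D;
  vm_stable : forall n v, D v -> D (l n v);
  vm_linear : forall n a u v, D u -> D v -> l n (a *: u + v) = a *: l n u + l n v;
  vm_adjoint : forall n u v, D u -> D v -> hdot (l n u) v = hdot u (l (- n) v);
  vm_comm : forall (n m : int) v, D v ->
    l n (l m v) - l m (l n v) = (n - m)%:~R *: l (n + m) v
      + (if - m == n then (c / 12 * (n ^+ 3 - n)%:~R)%:C else 0) *: v;
  vm_positive : forall (r : R) v, D v -> v != 0 -> l 0 v = r%:C *: v -> 0 <= r;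
  vm_ground : forall v, D v -> l 0 v = 0 -> exists a, v = a *: Om;
  vm_vacuum : D Om;
  vm_vacuum0 : l 0 Om = 0;
  vm_annihil : forall n : int, 0 < n -> l n Om = 0;
  vm_unit : rnorm Om = 1 }.

Section OneModule.
Variables (H : hilbert R) (D : set H) (l : int -> H -> H) (c : R) (Om : H).
Hypothesis M : vacuum_module D l c Om.

Lemma vm0 n : l n 0 = 0.
Proof.
have D0 : D 0 by case: (vm_subspace M).
by have := vm_linear M n (-1) D0 D0; rewrite scaler0 addr0 scaleN1r addNr.
Qed.

Lemma vmZ n a u : D u -> l n (a *: u) = a *: l n u.
Proof.
move=> Du; have D0 : D 0 by case: (vm_subspace M).
by have := vm_linear M n a Du D0; rewrite vm0 !addr0.
Qed.

Lemma vmD n u v : D u -> D v -> l n (u + v) = l n u + l n v.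
Proof. by move=> Du Dv; have := vm_linear M n 1 Du Dv; rewrite !scale1r. Qed.

Lemma vmB n u v : D u -> D v -> l n (u - v) = l n u - l n v.
Proof. by move=> Du Dv; rewrite addrC -scaleN1r (vm_linear M) // scaleN1r addrC. Qed.

Lemma vm_swap (n m : int) v : D v -> l n (l m v) = l m (l n v)
  + ((n - m)%:~R *: l (n + m) v
      + (if - m == n then (c / 12 * (n ^+ 3 - n)%:~R)%:C else 0) *: v).
Proof. by move=> Dv; rewrite -(vm_comm M) // addrC subrK. Qed.

(** The commutator with the mode 0 is multiplication by - n. *)
Lemma vm_energy (n : int) (r : R) v : D v -> l 0 v = r%:C *: v ->
  l 0 (l n v) = (r - n%:~R)%:C *: l n v.
Proof.
move=> Dv Ev; rewrite vm_swap // Ev vmZ // [0 + n]add0r expr0n subrr mulr0 if_same scale0r addr0.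
rewrite -scalerDl sub0r mulrNz rmorphB; congr ((_ - _) *: _).
by rewrite -[in LHS](mulr1 (n%:~R : R[i])) rmorph_int mulr1.
Qed.

(** Its square norm is the value at the vacuum of the commutator of the modes 1
    and - 1, in which the central term vanishes. *)
Lemma vm_vacuumN1 : l (-1) Om = 0.
Proof.
have DOm := vm_vacuum M; have Dl n := vm_stable M n DOm.
apply: hdot_self_eq0; rewrite (vm_adjoint M) //.
rewrite opprK vm_swap // (vm_annihil M) // vm0 add0r.
by rewrite /= (vm_vacuum0 M) scaler0 add0r subrr mulr0 scale0r hdot0r.
Qed.

Lemma vm_norm_mode (n : int) : 1 < n ->
  hdot (l (- n) Om) (l (- n) Om) = (c / 12 * (n ^+ 3 - n)%:~R)%:C.
Proof.
have DOm := vm_vacuum M; have Dl k := vm_stable M k DOm.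
move=> n1; rewrite (vm_adjoint M) // opprK.
rewrite vm_swap // (vm_annihil M); last by lia.
rewrite vm0 add0r subrr (vm_vacuum0 M) scaler0 add0r opprK eqxx hdotZr.
by rewrite hdot_self (vm_unit M) expr1n mulr1 conj_real.
Qed.

Lemma vm_neg_energy (r : R) v : D v -> l 0 v = r%:C *: v -> r < 0 -> v = 0.
Proof.
move=> Dv Ev r0; apply/eqP/negPn/negP => v0.
by have := vm_positive M Dv v0 Ev; rewrite leNgt r0.
Qed.

End OneModule.

Section Words.
Variables (H1 H2 : hilbert R) (D1 : set H1) (D2 : set H2).
Variables (l1 : int -> H1 -> H1) (l2 : int -> H2 -> H2) (c : R) (Om1 : H1) (Om2 : H2).
Hypotheses (M1 : vacuum_module D1 l1 c Om1) (M2 : vacuum_module D2 l2 c Om2).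

(** Two modules are compared by one induction on pairs of vectors built in the same
    way; the length k bounds the number of modes, which commutators do not increase. *)
Inductive words : nat -> H1 -> H2 -> Prop :=
| WordVacuum k a : words k (a *: Om1) (a *: Om2)
| WordMode k n x y of words k x y : words k.+1 (l1 n x) (l2 n y)
| WordComb k a x y x' y' of words k x y & words k x' y' :
    words k (a *: x + x') (a *: y + y').

Lemma words_dom k x y : words k x y -> D1 x /\ D2 y.
Proof.
elim=> {k x y}.
- by move=> _ a; split; apply: subspaceZ;
    [exact: vm_subspace M1|exact: vm_vacuum M1|exact: vm_subspace M2|exact: vm_vacuum M2].
- by move=> k n x y _ [Dx Dy]; split; [exact: (vm_stable M1)|exact: (vm_stable M2)].
- move=> k a x y x' y' _ [Dx Dy] _ [Dx' Dy'].
  by split; [exact: (vm_subspace M1).2|exact: (vm_subspace M2).2].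
Qed.

Lemma wordsS k x y : words k x y -> words k.+1 x y.
Proof.
elim=> {k x y}.
- by move=> k a; exact: WordVacuum.
- by move=> k n x y _; exact: WordMode.
- by move=> k a x y x' y' _ w _; exact: WordComb.
Qed.

Lemma words0 k : words k 0 0.
Proof. by have := WordVacuum k 0; rewrite !scale0r. Qed.

Lemma wordsZ k a x y : words k x y -> words k (a *: x) (a *: y).
Proof. by move=> w; have := WordComb a w (words0 k); rewrite !addr0. Qed.

Lemma wordsD k x y x' y' : words k x y -> words k x' y' -> words k (x + x') (y + y').
Proof. by move=> w w'; have := WordComb 1 w w'; rewrite !scale1r. Qed.

Lemma words_leq k k' x y : (k <= k')%N -> words k x y -> words k' x y.
Proof.
move=> /subnK <-; elim: (k' - k)%N => [//|j IH] w.
by rewrite addSn; apply: wordsS; exact: IH.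
Qed.

(** A mode of nonnegative index commutes down to the vacuum, which it kills; the
    commutators met on the way are shorter words with coefficients depending on c. *)
Lemma words_nonneg k (a : int) x y : 0 <= a -> words k x y -> words k (l1 a x) (l2 a y).
Proof.
move=> a0; elim=> {k x y}.
- move=> k b.
  rewrite (vmZ M1); last exact: vm_vacuum M1.
  rewrite (vmZ M2); last exact: vm_vacuum M2.
  have -> : l1 a Om1 = 0.
    have [->|an] := eqVneq a 0; first exact: vm_vacuum0 M1.
    by apply: (vm_annihil M1); rewrite lt_neqAle eq_sym an.
  have -> : l2 a Om2 = 0.
    have [->|an] := eqVneq a 0; first exact: vm_vacuum0 M2.
    by apply: (vm_annihil M2); rewrite lt_neqAle eq_sym an.
  by rewrite !scaler0; exact: words0.
- move=> k n x y w IH; have [Dx Dy] := words_dom w.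
  rewrite (vm_swap M1) // (vm_swap M2) //.
  apply: wordsD; first exact: WordMode.
  apply: WordComb; first exact: WordMode.
  by apply: wordsZ; exact: wordsS.
- move=> k b x y x' y' w IH w' IH'.
  have [Dx Dy] := words_dom w; have [Dx' Dy'] := words_dom w'.
  by rewrite (vm_linear M1) // (vm_linear M2) //; exact: WordComb.
Qed.

Lemma words_vacuum k x y : words k x y -> hdot x Om1 = hdot y Om2.
Proof.
have base a : hdot (a *: Om1) Om1 = hdot (a *: Om2) Om2.
  by rewrite !hdotZl !hdot_self (vm_unit M1) (vm_unit M2).
have comb a x1 x2 y1 y2 : hdot x1 Om1 = hdot y1 Om2 -> hdot x2 Om1 = hdot y2 Om2 ->
    hdot (a *: x1 + x2) Om1 = hdot (a *: y1 + y2) Om2.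
  by move=> E E'; rewrite !hdotDl !hdotZl E E'.
elim: k x y => [|k IHk] x y.
  move E : 0%N => k w; elim: w E => {k x y} [k a|k n x y _ _ //|k a x y x' y' _ IH _ IH' E].
    by move=> _; exact: base.
  by apply: comb; [exact: IH|exact: IH'].
move E : k.+1 => j w; elim: w E => {j x y} [j a|j n x y w _|j a x y x' y' _ IH _ IH' E].
- by move=> _; exact: base.
- move=> [jk]; rewrite -jk in w; have [Dx Dy] := words_dom w.
  have [n0|n0] := leP 0 n; first by apply: IHk; exact: words_nonneg.
  have DOm1 := vm_vacuum M1; have DOm2 := vm_vacuum M2.
  rewrite (vm_adjoint M1) // (vm_adjoint M2) //.
  by rewrite (vm_annihil M1) ?oppr_gt0 // (vm_annihil M2) ?oppr_gt0 // !hdot0r.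
- by apply: comb; [exact: IH|exact: IH'].
Qed.

(** The adjoint of a mode is a mode, so that a pairing of two words is the pairing of
    a longer word with the vacuum, computed by words_vacuum. *)
Lemma words_gram k x y k' x' y' : words k x y -> words k' x' y' ->
  hdot x x' = hdot y y'.
Proof.
move=> w; elim: w k' x' y' => {k x y}.
- move=> k a k' x' y' w'; rewrite !hdotZl; congr (_ * _).
  by rewrite (hdotC x') (words_vacuum w') -hdotC.
- move=> k n x y w IH k' x' y' w'.
  have [Dx Dy] := words_dom w; have [Dx' Dy'] := words_dom w'.
  rewrite (vm_adjoint M1) // (vm_adjoint M2) //.
  exact: IH (WordMode (- n) w').
- move=> k a x y x1 y1 _ IH _ IH1 k' x' y' w'.
  by rewrite !hdotDl !hdotZl (IH _ _ _ w') (IH1 _ _ _ w').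
Qed.

End Words.

Definition word_span (H : hilbert R) (l : int -> H -> H) (Om : H) : set H :=
  [set x | exists k, words l l Om Om k x x].

Section WordSpan.
Variables (H1 H2 : hilbert R) (l1 : int -> H1 -> H1) (l2 : int -> H2 -> H2).
Variables (Om1 : H1) (Om2 : H2).

Lemma words_left k x y : words l1 l2 Om1 Om2 k x y -> words l1 l1 Om1 Om1 k x x.
Proof.
elim=> {k x y}.
- by move=> k a; exact: WordVacuum.
- by move=> k n x y _; exact: WordMode.
- by move=> k a x y x' y' _ w _ w'; exact: WordComb.
Qed.

Lemma words_right k x y : words l1 l2 Om1 Om2 k x y -> words l2 l2 Om2 Om2 k y y.
Proof.
elim=> {k x y}.
- by move=> k a; exact: WordVacuum.
- by move=> k n x y _; exact: WordMode.
- by move=> k a x y x' y' _ w _ w'; exact: WordComb.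
Qed.

Lemma words_exr k x x' : words l1 l1 Om1 Om1 k x x' -> exists y, words l1 l2 Om1 Om2 k x y.
Proof.
elim=> {k x x'}.
- by move=> k a; eexists; exact: WordVacuum.
- by move=> k n x _ _ [y w]; eexists; exact: WordMode w.
- by move=> k a x _ x' _ _ [y w] _ [y' w']; eexists; exact: WordComb w w'.
Qed.

Lemma words_exl k y y' : words l2 l2 Om2 Om2 k y y' -> exists x, words l1 l2 Om1 Om2 k x y.
Proof.
elim=> {k y y'}.
- by move=> k a; eexists; exact: WordVacuum.
- by move=> k n y _ _ [x w]; eexists; exact: WordMode w.
- by move=> k a y _ y' _ _ [x w] _ [x' w']; eexists; exact: WordComb w w'.
Qed.

End WordSpan.

Section Singular.
Variables (H : hilbert R) (D : set H) (l : int -> H -> H) (c : R) (Om : H).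
Hypothesis M : vacuum_module D l c Om.

Lemma word_span_subspace : subspace (word_span l Om).
Proof.
split; first by exists 0%N; exact: words0.
move=> a x y [k wx] [k' wy]; exists (k + k')%N.
by apply: WordComb; [apply: words_leq wx; exact: leq_addr|apply: words_leq wy; exact: leq_addl].
Qed.

Lemma word_span_dom x : word_span l Om x -> D x.
Proof. by move=> [k /(words_dom M M) []]. Qed.

Lemma word_span_mode n x : word_span l Om x -> word_span l Om (l n x).
Proof. by move=> [k w]; exists k.+1; exact: WordMode. Qed.

Lemma word_span_vacuum : word_span l Om Om.
Proof. by exists 0%N; have := WordVacuum l l Om Om 0 1; rewrite !scale1r. Qed.

(** A word starts with a mode; a negative one goes over to u as an annihilating mode,
    and a nonnegative one shortens the word. *)
Lemma no_singular_vector u : dense (word_span l Om) -> D u -> hdot u Om = 0 ->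
  (forall n : int, 0 < n -> l n u = 0) -> u = 0.
Proof.
move=> dW Du uOm un.
suff H0 : forall k x y, words l l Om Om k x y -> hdot u x = 0.
  by apply: (dense_ortho dW) => x [k w]; exact: H0 w.
move=> k x; elim: k x => [|k IHk] x y.
  move E : 0%N => k w; elim: w E => {k x y} [k a|k n x y _ _ //|k a x y x' y' _ IH _ IH' E].
    by move=> _; rewrite hdotZr uOm mulr0.
  by rewrite hdotDr hdotZr IH // IH' // mulr0 addr0.
move E : k.+1 => j w; elim: w E => {j x y} [j a|j n x y w _|j a x y x' y' _ IH _ IH' E].
- by move=> _; rewrite hdotZr uOm mulr0.
- move=> [jk]; rewrite -jk in w; have [Dx Dy] := words_dom M M w.
  have [n0|n0] := leP 0 n; first exact: IHk (words_nonneg M M n0 w).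
  by rewrite -[n]opprK -(vm_adjoint M) // un ?oppr_gt0 // hdot0l.
- by rewrite hdotDr hdotZr IH // IH' // mulr0 addr0.
Qed.

(** The mode 1 maps u to a multiple of the vacuum, which the adjoint mode - 1 kills;
    the higher modes map u to negative energy. *)
Lemma energy1_eq0 u : dense (word_span l Om) -> D u -> l 0 u = u -> u = 0.
Proof.
move=> dW Du Eu; have Eu1 : l 0 u = 1%:C *: u by rewrite scale1r.
have En n := vm_energy M n Du Eu1.
have uOm : hdot u Om = 0.
  have DOm := vm_vacuum M.
  by rewrite -Eu (vm_adjoint M) // oppr0 (vm_vacuum0 M) hdot0r.
apply: no_singular_vector => // n n0.
have Dn : D (l n u) by exact: vm_stable M _ _ Du.
have [n1|n1] := ltP 1 n.
  by apply: (vm_neg_energy M Dn (En n)); rewrite subr_lt0 -[1]/(1%:~R) ltr_int.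
have {n0 n1 Dn} -> : n = 1 by lia.
have D1 : D (l 1 u) by exact: vm_stable M _ _ Du.
have [|a aE] := vm_ground M D1; first by rewrite En subrr scale0r.
have DOm := vm_vacuum M.
apply: hdot_self_eq0; rewrite {2}aE hdotZr (vm_adjoint M) //.
by rewrite (vm_vacuumN1 M) hdot0r mulr0.
Qed.

(** As in energy 1, the mode 2 maps u to a multiple of the vacuum, the coefficient
    being the pairing with the mode - 2 of the vacuum. *)
Lemma energy2_eq0 u : dense (word_span l Om) -> D u -> l 0 u = 2%:C *: u ->
  hdot u (l (-2) Om) = 0 -> u = 0.
Proof.
move=> dW Du Eu u2.
have En n := vm_energy M n Du Eu.
have uOm : hdot u Om = 0.
  have : hdot (l 0 u) Om = 0.
    have DOm := vm_vacuum M.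
    by rewrite (vm_adjoint M) // oppr0 (vm_vacuum0 M) hdot0r.
  rewrite Eu hdotZl => /eqP; rewrite mulf_eq0 => /orP[/eqP/complexI/eqP|/eqP //].
  by rewrite pnatr_eq0.
apply: no_singular_vector => // n n0.
have Dn : D (l n u) by exact: vm_stable M _ _ Du.
have [n2|n2] := ltP 2 n.
  by apply: (vm_neg_energy M Dn (En n)); rewrite subr_lt0 -[2]/(2%:~R) ltr_int.
have [n1|n1] := eqVneq n 1.
  apply: energy1_eq0 => //; rewrite En n1 (_ : 2 - _ = 1) ?scale1r //.
  by rewrite -[1%:~R]/1; lra.
have {n0 n1 n2} n2 : n = 2 by lia.
have [|a aE] := vm_ground M Dn; first by rewrite En n2 -[2%:~R]/2 subrr scale0r.
have DOm := vm_vacuum M.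
apply: hdot_self_eq0; rewrite {2}aE hdotZr (vm_adjoint M) //.
by rewrite n2 u2 mulr0.
Qed.

End Singular.

(** The eigenspace of energy 2 is a line, and for n >= 2 the mode - n - 1 of the vacuum
    is a multiple of the modes - 1 and - n applied in turn: two stress tensors with the
    same Moebius part are proportional on the vacuum. *)
Lemma modes_proportional (H : hilbert R) (D : set H) (l l' : int -> H -> H)
    (c c' : R) (Om : H) : vacuum_module D l c Om -> vacuum_module D l' c' Om ->
  dense (word_span l Om) -> 0 < c ->
  (forall v, D v -> l' 0 v = l 0 v) -> (forall v, D v -> l' (-1) v = l (-1) v) ->
  exists a, forall n : int, l' n Om = (if n <= -2 then a else 1) *: l n Om.
Proof.
move=> M M' dW c0 E0 E1.
have DOm := vm_vacuum M.
have D2 : D (l (-2) Om) by exact: vm_stable M _ _ DOm.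
have D2' : D (l' (-2) Om) by exact: vm_stable M' _ _ DOm.
have N2 := vm_norm_mode M (isT : (1 : int) < 2).
have N0 : hdot (l (-2) Om) (l (-2) Om) != 0.
  rewrite N2; apply/eqP => /complexI /eqP; rewrite gt_eqF //.
  have -> : ((2 ^+ 3 - 2)%:~R : R) = 6 by [].
  by rewrite mulr_gt0 // divr_gt0.
pose a := hdot (l' (-2) Om) (l (-2) Om) / hdot (l (-2) Om) (l (-2) Om).
have e2 : l 0 (l (-2) Om) = 2%:C *: l (-2) Om.
  have := vm_energy M (-2) DOm (r := 0); rewrite scale0r => -> //; last exact: vm_vacuum0 M.
  by rewrite sub0r mulrNz opprK.
have e2' : l 0 (l' (-2) Om) = 2%:C *: l' (-2) Om.
  rewrite -E0 //.
  have := vm_energy M' (-2) DOm (r := 0); rewrite scale0r => -> //; last exact: vm_vacuum0 M'.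
  by rewrite sub0r mulrNz opprK.
have base : l' (-2) Om = a *: l (-2) Om.
  apply/eqP; rewrite -subr_eq0; apply/eqP.
  have Da : D (a *: l (-2) Om) by exact: subspaceZ (vm_subspace M) D2.
  have Dd := subspaceB (vm_subspace M) D2' Da.
  apply: (energy2_eq0 M) => //.
    rewrite -scaleNr addrC (vm_linear M) // e2 e2' scalerDr !scalerA mulrC //.
  by rewrite hdotBl hdotZl /a divfK // subrr.
exists a => n; have [n2|n2] := leP n (-2); last first.
  rewrite scale1r; have [n0|n0] := ltP 0 n.
    by rewrite (vm_annihil M) // (vm_annihil M').
  have [->|n1] := eqVneq n 0; first by rewrite E0.
  by have -> : n = -1 by [lia]; rewrite E1.
have [k ->] : exists k : nat, n = - k.+2%:Z by exists (absz (n + 2)); lia.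
elim: k => [|k IH]; first exact: base.
set m : int := k.+2%:Z in IH *.
have -> : - k.+3%:Z = -1 - m by rewrite /m; lia.
have Dm : D (l (- m) Om) by exact: vm_stable M _ _ DOm.
have Dm' : D (l' (- m) Om) by exact: vm_stable M' _ _ DOm.
have step (L : int -> H -> H) cc : vacuum_module D L cc Om ->
    L (-1) (L (- m) Om) = (-1 + m)%:~R *: L (-1 - m) Om.
  move=> ML; rewrite (vm_swap ML) // (vm_vacuumN1 ML) (vm0 ML) add0r.
  have -> : (- (- m) == -1) = false by rewrite /m; lia.
  by rewrite scale0r addr0 opprK.
have mn0 : (-1 + m)%:~R != 0 :> R[i] by rewrite intr_eq0 /m; apply/eqP; lia.
apply: (scalerI mn0); rewrite -(step _ _ M') E1 // IH (vmZ M) // (step _ _ M).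
by rewrite !scalerA mulrC.
Qed.

(** Puts two modules, possibly with different central charges, on the same space. *)
Lemma vacuum_module_transport (H1 H2 : hilbert R) (W : H1 -> H2) (V : H2 -> H1)
    (D : set H2) (l : int -> H2 -> H2) (c : R) (Om : H2) (Om' : H1) (m : R[i]) :
  unitary W -> unitary V -> cancel W V -> cancel V W -> `|m| = 1 -> W Om' = m *: Om ->
  vacuum_module D l c Om ->
  vacuum_module [set x | D (W x)] (fun n x => V (l n (W x))) c Om'.
Proof.
move=> uW uV WV VW m1 WOm M.
have m0 : m != 0 by rewrite -normr_eq0 m1 oner_eq0.
have adj x y : hdot (V x) y = hdot x (W y) by rewrite -(unitary_hdot uW) VW.
split => /=.
- split=> [/=|a x y /= Dx Dy]; first by rewrite (unitary0 uW); case: (vm_subspace M).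
  by rewrite (unitaryZD uW); exact: (vm_subspace M).2.
- rewrite (_ : [set x | _] = V @` D); first exact: unitary_dense_image (vm_dense M).
  apply/seteqP; split => [x /= Dx|_ [y Dy <-]]; last by rewrite /= VW.
  by exists (W x).
- by move=> n v Dv; rewrite VW; exact: vm_stable M _ _ Dv.
- by move=> n a u v Du Dv; rewrite (unitaryZD uW) (vm_linear M) // (unitaryZD uV).
- move=> n u v Du Dv; rewrite adj (vm_adjoint M) //.
  by rewrite -[RHS](unitary_hdot uW) VW.
- move=> n k v Dv; rewrite !VW -(unitaryB uV) (vm_comm M) // (unitaryD uV) !(unitaryZ uV).
  by rewrite WV.
- move=> r v Dv v0 E; apply: (vm_positive M Dv).
    by apply: contra_neq v0 => Wv0; rewrite -(WV v) Wv0 (unitary0 uV).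
  by rewrite -(VW (l 0 (W v))) E (unitaryZ uW).
- move=> v Dv E; have [|a aE] := vm_ground M Dv.
    by rewrite -(VW (l 0 (W v))) E (unitary0 uW).
  exists (a / m); apply: (unitary_inj uW).
  by rewrite aE (unitaryZ uW) WOm scalerA divfK.
- by rewrite WOm; apply: subspaceZ (vm_vacuum M); exact: vm_subspace M.
- by rewrite WOm (vmZ M) ?(vm_vacuum0 M) ?scaler0 ?(unitary0 uV) //; exact: vm_vacuum M.
- move=> n n0; rewrite WOm (vmZ M) ?(vm_annihil M) ?scaler0 ?(unitary0 uV) //.
  exact: vm_vacuum M.
- rewrite -(unitary_rnorm uW) WOm rnormZ (vm_unit M) mulr1.
  by apply: (@complexI R); rewrite -cnormE m1.
Qed.

End VacuumModules.

(** * Fourier coefficients *)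

Section Fourier.
Variable R : realType.
Implicit Types (f g P : R -> R) (t : R).

Definition circ f : R := \int[lebesgue_measure]_(t in `[0, 2 * pi]) f t.

Lemma circ_primitive f P : continuous f -> (forall t, is_derive t (1 : R) P (f t)) ->
  circ f = P (2 * pi) - P 0.
Proof.
move=> cf dP; have p0 : 0 < 2 * pi :> R by rewrite mulr_gt0 // pi_gt0.
have cP : continuous P.
  move=> t; apply: differentiable_continuous; apply/derivable1_diffP.
  by case: (dP t).
rewrite /circ /Rintegral (continuous_FTC2 p0 (F := P)) //.
- exact: continuous_subspaceT.
- split.
  + by move=> t _; case: (dP t).
  + exact/cvg_at_right_filter/cP.
  + exact/cvg_at_left_filter/cP.
- by move=> t _; rewrite (is_derive_derive1 dP).
Qed.

Lemma circD f g : continuous f -> continuous g ->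
  circ (fun t => f t + g t) = circ f + circ g.
Proof.
move=> cf cg; have [P dP] := continuous_primitive cf; have [Q dQ] := continuous_primitive cg.
rewrite (circ_primitive cf dP) (circ_primitive cg dQ).
rewrite (@circ_primitive _ (fun t => P t + Q t)); first by ring.
by move=> t; apply: continuousD; [exact: cf|exact: cg].
Qed.

Lemma circZ (r : R) f : continuous f -> circ (fun t => r * f t) = r * circ f.
Proof.
move=> cf; have [P dP] := continuous_primitive cf; rewrite (circ_primitive cf dP).
rewrite (@circ_primitive _ (fun t => r * P t)); first by ring.
by move=> t; apply: continuousM; [exact: cvg_cst|exact: cf].
Qed.

Lemma eq_circ f g : f =1 g -> circ f = circ g.
Proof. by move=> /funext ->. Qed.

(** Otherwise a primitive would be constant on [0, 2 pi], with derivative 0 at pi. *)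
Lemma circ_gt0 f : continuous f -> (forall t, 0 <= f t) -> 0 < f pi -> 0 < circ f.
Proof.
move=> cf f0 fpi; have [P dP] := continuous_primitive cf.
have p0 := pi_gt0 R.
have mono x y : x <= y -> P x <= P y.
  move=> xy; have [c _ E] := @MVT_closed R P f x y xy.
  by rewrite -subr_ge0 E mulr_ge0 // subr_ge0.
rewrite (circ_primitive cf dP) subr_gt0 lt_neqAle mono ?andbT; last by lra.
apply/eqP => E; have : is_derive (pi : R) (1 : R) P 0.
  apply: (@near_eq_is_derive R R^o R^o (fun=> P 0)).
  have : \forall t \near (pi : R), 0 < t < 2 * pi.
    near=> t; apply/andP; split; near: t; first by exact: lt_nbhsr.
    by apply: lt_nbhsl; lra.
  apply: filterS => t /andP[t0 t2]; apply/eqP; rewrite eq_le mono ?(ltW t0) //=.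
  by rewrite E mono // ltW.
move=> [_ d0]; have [_ d1] := dP pi.
by move: fpi; rewrite -d1 d0 ltxx.
Unshelve. all: by end_near. Qed.

Definition mode_cos (n : int) t : R := cos (n%:~R * t).
Definition mode_sin (n : int) t : R := sin (n%:~R * t).

Lemma mode_smooth n : Csmooth (mode_cos n) /\ Csmooth (mode_sin n).
Proof.
have sl : Csmooth (fun t : R => n%:~R * t) by apply: smoothM; [exact: smooth_cst|exact: smooth_id].
by split; [exact: smooth_comp (smooth_cos _) sl|exact: smooth_comp (smooth_sin _) sl].
Qed.

Lemma cos_sin_2pi_int (n : int) : cos (n%:~R * (2 * pi)) = 1 :> R /\
  sin (n%:~R * (2 * pi)) = 0 :> R.
Proof.
have := cis_int n (0 : R); rewrite add0r mulrC => /(congr1 (@cval R)).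
by rewrite /cval /= /expi cos0 sin0 => -[-> ->].
Qed.

Lemma circ_cos n : circ (mode_cos n) = if n == 0 then 2 * pi else 0.
Proof.
have [sc ss] := mode_smooth n; case: eqP => [n0|/eqP n0].
  have := @circ_primitive (fun=> 1) id (fun _ => cvg_cst _) (fun t => is_derive_id t (1 : R)).
  by rewrite subr0 => <-; apply: eq_circ => t; rewrite /mode_cos n0 mul0r cos0.
have nR : n%:~R != 0 :> R by rewrite intr_eq0.
have dP t : is_derive t (1 : R) (fun t => n%:~R^-1 * mode_sin n t) (mode_cos n t).
  have dl : is_derive t (1 : R) (fun t => n%:~R * t : R) n%:~R.
    by have := is_deriveZ (n%:~R : R) (is_derive_id t (1 : R)); rewrite /GRing.scale /= mulr1.
  have := @is_derive1_comp _ sin (fun t => n%:~R * t) t _ _ (is_derive_sin _) dl.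
  move=> /(@is_deriveZ R R^o R^o _ (n%:~R^-1)) /eq_is_derive; apply.
  by rewrite /GRing.scale /= mulrCA mulVf // mulr1.
rewrite (circ_primitive (smooth_continuous sc) dP).
by rewrite /mode_sin (cos_sin_2pi_int n).2 !mulr0 sin0 mulr0 subrr.
Qed.

Lemma circ_sin n : circ (mode_sin n) = 0.
Proof.
have [sc ss] := mode_smooth n; have [n0|n0] := eqVneq n 0.
  rewrite (_ : mode_sin n = fun t => 0 * t); first by rewrite (@circZ 0 id) ?mul0r // => t; exact: cvg_id.
  by apply/funext => t; rewrite /mode_sin n0 !mul0r sin0.
have nR : n%:~R != 0 :> R by rewrite intr_eq0.
have dP t : is_derive t (1 : R) (fun t => - n%:~R^-1 * mode_cos n t) (mode_sin n t).
  have dl : is_derive t (1 : R) (fun t => n%:~R * t : R) n%:~R.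
    by have := is_deriveZ (n%:~R : R) (is_derive_id t (1 : R)); rewrite /GRing.scale /= mulr1.
  have := @is_derive1_comp _ cos (fun t => n%:~R * t) t _ _ (is_derive_cos _) dl.
  move=> /(@is_deriveZ R R^o R^o _ (- n%:~R^-1)) /eq_is_derive; apply.
  by rewrite -[LHS]/(- n%:~R^-1 * (- sin (n%:~R * t) * n%:~R)) mulrA mulrNN mulrAC mulVf // mul1r.
rewrite (circ_primitive (smooth_continuous ss) dP).
by rewrite /mode_cos (cos_sin_2pi_int n).1 mulr0 cos0 subrr.
Qed.

Lemma fourierE (f : circle R -> R) n : Csmooth (f \o @cis R) ->
  fourier f n = ((2 * pi)^-1)%:C * (circ (fun t => mode_cos n t * f (cis t))
    +i* (- circ (fun t => mode_sin n t * f (cis t)))).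
Proof.
move=> sf; rewrite /fourier; congr (_ * (_ +i* _)).
  by apply: eq_circ => t; rewrite /= cosN mulr0 subr0.
rewrite -mulN1r -circZ; last first.
  apply: smooth_continuous; exact: smoothM (mode_smooth n).2 sf.
by apply: eq_circ => t; rewrite /= sinN mulr0 add0r mulN1r mulNr.
Qed.

Lemma fourierZ (f : circle R -> R) (r : R) n : Csmooth (f \o @cis R) ->
  fourier (fun z => r * f z) n = r%:C * fourier f n.
Proof.
move=> sf; rewrite !fourierE //; last exact: smoothM (smooth_cst r) sf.
rewrite mulrCA; congr (_ * _).
have e (g : R -> R) : Csmooth g -> circ (fun t => g t * (r * f (cis t))) = r * circ (fun t => g t * f (cis t)).
  move=> sg; rewrite -circZ; last exact/smooth_continuous/(smoothM sg sf).
  by apply: eq_circ => t; rewrite mulrCA.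
rewrite !e; [|exact: (mode_smooth n).2|exact: (mode_smooth n).1].
by apply/eqP; rewrite eq_complex /= !mul0r subr0 addr0 mulrN !eqxx.
Qed.

(** The field is A + 2 Re (B z) with B = b1 + i b2; products of trigonometric functions
    are expanded into the modes n - 1, n and n + 1. *)
Lemma fourier_degree1 (f : circle R -> R) (A b1 b2 : R) n :
  (forall t, f (cis t) = A + 2 * (b1 * cos t - b2 * sin t)) ->
  fourier f n = if n == 0 then A%:C else if n == 1 then b1 +i* b2
    else if n == -1 then b1 -i* b2 else 0.
Proof.
move=> fE.
have sf : Csmooth (f \o @cis R).
  rewrite (_ : _ \o _ = fun t => A + 2 * (b1 * cos t - b2 * sin t)); last exact/funext.
  apply: smoothD (smooth_cst _) _; apply: smoothM (smooth_cst _) _.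
  apply: smoothB; apply: smoothM; try exact: smooth_cst.
    exact: smooth_cos.
  exact: smooth_sin.
have cc k : continuous (mode_cos k) by exact/smooth_continuous/(mode_smooth k).1.
have cs k : continuous (mode_sin k) by exact/smooth_continuous/(mode_smooth k).2.
have cZ (r : R) (g : R -> R) : continuous g -> continuous (fun t => r * g t).
  by move=> cg t; apply: continuousM; [exact: cvg_cst|exact: cg].
have cD (g h : R -> R) : continuous g -> continuous h -> continuous (fun t => g t + h t).
  by move=> cg ch t; apply: continuousD; [exact: cg|exact: ch].
have lin (a0 a1 a2 a3 a4 : R) (g0 g1 g2 g3 g4 : R -> R) : continuous g0 -> continuous g1 ->
    continuous g2 -> continuous g3 -> continuous g4 ->
    circ (fun t => a0 * g0 t + (a1 * g1 t + (a2 * g2 t + (a3 * g3 t + a4 * g4 t)))) =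
    a0 * circ g0 + (a1 * circ g1 + (a2 * circ g2 + (a3 * circ g3 + a4 * circ g4))).
  move=> c0 c1 c2 c3 c4; have := (cZ a0 _ c0, cZ a1 _ c1, cZ a2 _ c2, cZ a3 _ c3, cZ a4 _ c4).
  move=> [[[[d0 d1] d2] d3] d4]; have d34 := cD _ _ d3 d4; have d234 := cD _ _ d2 d34.
  by rewrite (circD d0 (cD _ _ d1 d234)) (circD d1 d234) (circD d2 d34) (circD d3 d4) !circZ.
have eqp t : (n + 1)%:~R * t = n%:~R * t + t :> R by rewrite intrD mulrDl mul1r.
have eqm t : (n - 1)%:~R * t = n%:~R * t - t :> R by rewrite intrB mulrBl mul1r.
rewrite fourierE //.
have -> : circ (fun t => mode_cos n t * f (cis t)) =
    A * circ (mode_cos n) + (b1 * circ (mode_cos (n + 1)) + (b1 * circ (mode_cos (n - 1)) +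
      (- b2 * circ (mode_sin (n + 1)) + b2 * circ (mode_sin (n - 1))))).
  rewrite -lin //.
  apply: eq_circ => t; rewrite fE /mode_cos /mode_sin eqp eqm cosD cosB sinD sinB.
  by ring.
have -> : circ (fun t => mode_sin n t * f (cis t)) =
    A * circ (mode_sin n) + (b1 * circ (mode_sin (n + 1)) + (b1 * circ (mode_sin (n - 1)) +
      (b2 * circ (mode_cos (n + 1)) + - b2 * circ (mode_cos (n - 1))))).
  rewrite -lin //.
  apply: eq_circ => t; rewrite fE /mode_cos /mode_sin eqp eqm cosD cosB sinD sinB.
  by ring.
rewrite !circ_cos !circ_sin !mulr0 !addr0 !add0r.
have pn : (pi : R) != 0 by rewrite gt_eqF // pi_gt0.
have -> : (n + 1 == 0) = (n == -1) by lia.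
have -> : (n - 1 == 0) = (n == 1) by lia.
apply/eqP; rewrite eq_complex /=.
move: pn; generalize (pi : R) => p pn.
have [n0|n0] := eqVneq n 0.
  have [-> ->] : (n == 1) = false /\ (n == -1) = false by split; lia.
  by rewrite /=; apply/andP; split; apply/eqP; field.
have [n1|n1] := eqVneq n 1.
  have -> : (n == -1) = false by lia.
  by rewrite /=; apply/andP; split; apply/eqP; field.
have [n2|n2] := eqVneq n (-1).
  by rewrite /=; apply/andP; split; apply/eqP; field.
by rewrite /=; apply/andP; split; apply/eqP; ring.
Qed.

Lemma bumped_smooth_sub : Csmooth (fun t : R => bump (- cos t - 4 / 5)).
Proof.
apply: (smooth_comp (bump_smooth R)).
by apply: smoothB; [exact: smoothN (smooth_cos _)|exact: smooth_cst].
Qed.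

(** The bump is supported where cos (2 t) > 0, so that its coefficients of index 0
    and - 2 have positive real parts. *)
Lemma fourier_bumped (f : circle R -> R) : (forall t, f (cis t) = bumped t) ->
  fourier f 0 <> 1 /\ fourier f (-2) != 0.
Proof.
move=> fE; have sf : Csmooth (f \o @cis R).
  by rewrite (_ : _ \o _ = @bumped R); [exact: bumped_smooth|exact/funext].
have p0 := pi_gt0 R; have pn : 2 * pi != 0 :> R by rewrite gt_eqF // mulr_gt0.
have sb := bumped_smooth_sub.
pose h t : R := bump (- cos t - 4 / 5).
have split n : circ (fun t => mode_cos n t * f (cis t)) =
    circ (mode_cos n) + circ (fun t => mode_cos n t * h t).
  rewrite -circD; first by apply: eq_circ => t; rewrite fE /bumped mulrDr mulr1.
    exact/smooth_continuous/(mode_smooth n).1.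
  exact/smooth_continuous/(smoothM (mode_smooth n).1 sb).
have pos n : (n == 0) || (n == -2) -> 0 < circ (fun t => mode_cos n t * h t).
  move=> n0; apply: circ_gt0.
  - exact/smooth_continuous/(smoothM (mode_smooth n).1 sb).
  - move=> t; rewrite /h; have [ct|ct] := leP (- cos t - 4 / 5) 0; first by rewrite bump_eq0 // mulr0.
    rewrite mulr_ge0 ?bump_ge0 // /mode_cos.
    case/orP: n0 => /eqP ->; first by rewrite mul0r cos0.
    rewrite mulrNz mulNr cosN (_ : 2%:~R * t = t + t); last by rewrite -[2%:~R]/(2 : R); ring.
    by rewrite cosD; have := cos2Dsin2 t; nra.
  - rewrite /h cospi opprK mulr_gt0 //; last by apply: bump_gt0; lra.
    rewrite /mode_cos; case/orP: n0 => /eqP ->; first by rewrite mul0r cos0.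
    by rewrite mulrNz mulNr cosN -[2%:~R]/(2 : R) mulr_natl cos2pi.
split.
  rewrite fourierE // => /(congr1 (@complex.Re R)) /=; rewrite mul0r subr0 split circ_cos eqxx.
  have := pos 0 isT; set X := circ (fun t => _) => X0 E.
  have : 2 * pi + X = 2 * pi by rewrite -[LHS](mulVKf pn) E mulr1.
  by move: X0; lra.
rewrite fourierE // mulf_neq0 //.
  by apply/eqP => /complexI /eqP; rewrite invr_eq0 (negbTE pn).
rewrite eq_complex /= negb_and split circ_cos add0r gt_eqF // pos //.
Qed.

End Fourier.

(** * Power series vanishing on half of the circle *)

Section PowerSeries.
Variable R : realType.
Implicit Types (c : nat -> R[i]) (z : R[i]) (p : {poly R[i]}).

Lemma cnormD (a b : R[i]) : cnorm (a + b) <= cnorm a + cnorm b.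
Proof. exact: (rnormD (a : R[i]^o) b). Qed.

Lemma cnorm_sum (I : Type) (s : seq I) (P : pred I) (F : I -> R[i]) :
  cnorm (\sum_(i <- s | P i) F i) <= \sum_(i <- s | P i) cnorm (F i).
Proof.
apply: (big_ind2 (fun a (r : R) => cnorm a <= r)) => //.
- by rewrite -[0]/(0%:C) cnorm_real normr0.
- by move=> a r b q ar bq; apply: (le_trans (cnormD a b)); exact: lerD.
Qed.

Lemma cnorm_expi (t : R) : cnorm (expi t) = 1.
Proof. exact/norm1P/norm_expi. Qed.

Lemma expiX (t : R) n : expi t ^+ n = expi (n%:R * t).
Proof.
by elim: n => [|n IH]; rewrite ?mul0r ?expi0 // exprS IH -expiD -natr1 mulrDl mul1r addrC.
Qed.

Lemma cnorm_ReIm (a : R[i]) : cnorm a <= `|complex.Re a| + `|complex.Im a|.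
Proof.
rewrite [in leLHS](_ : a = (complex.Re a)%:C + 'i * (complex.Im a)%:C).
  by apply: (le_trans (cnormD _ _)); rewrite cnormM cnorm_i mul1r !cnorm_real.
by case: a => x y; apply/eqP; rewrite eq_complex /=; apply/andP; split; apply/eqP; ring.
Qed.

Lemma normRe_cnorm (a : R[i]) : `|complex.Re a| <= cnorm a.
Proof. by have := normc_ge_Re a; rewrite cnormE lecR. Qed.

Lemma Re_sum (I : Type) (s : seq I) (P : pred I) (F : I -> R[i]) :
  complex.Re (\sum_(i <- s | P i) F i) = \sum_(i <- s | P i) complex.Re (F i).
Proof. exact: (raddf_sum (@complex.Re R)). Qed.

(** The terms are split according to the sign of their real part. *)
Lemma abs_sum_re (s : seq nat) c e : uniq s ->
  (forall s', uniq s' -> {subset s' <= s} -> cnorm (\sum_(k <- s') c k) <= e) ->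
  \sum_(k <- s) `|complex.Re (c k)| <= 2 * e.
Proof.
move=> us H; rewrite (bigID (fun k => 0 <= complex.Re (c k))) /=.
have half (P : pred nat) : `|\sum_(k <- s | P k) complex.Re (c k)| <= e.
  rewrite -Re_sum -big_filter; apply: (le_trans (normRe_cnorm _)); apply: H.
    exact: filter_uniq.
  by move=> k; rewrite mem_filter => /andP[].
have -> : \sum_(k <- s | 0 <= complex.Re (c k)) `|complex.Re (c k)| =
    \sum_(k <- s | 0 <= complex.Re (c k)) complex.Re (c k).
  by apply: eq_bigr => k k0; rewrite ger0_norm.
have -> : \sum_(k <- s | ~~ (0 <= complex.Re (c k))) `|complex.Re (c k)| =
    - \sum_(k <- s | ~~ (0 <= complex.Re (c k))) complex.Re (c k).
  by rewrite -sumrN; apply: eq_bigr => k; rewrite -ltNge => k0; rewrite ltr0_norm.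
have := half (fun k => 0 <= complex.Re (c k)).
have := half (fun k => ~~ (0 <= complex.Re (c k))).
by rewrite !ler_norml => /andP[? ?] /andP[? ?]; lra.
Qed.

Lemma abs_sum (s : seq nat) c e : uniq s ->
  (forall s', uniq s' -> {subset s' <= s} -> cnorm (\sum_(k <- s') c k) <= e) ->
  \sum_(k <- s) cnorm (c k) <= 4 * e.
Proof.
move=> us H.
apply: (@le_trans _ _ (\sum_(k <- s) (`|complex.Re (c k)| + `|complex.Im (c k)|))).
  by apply: ler_sum => k _; exact: cnorm_ReIm.
rewrite big_split /=; have H1 := abs_sum_re us H.
suff : \sum_(k <- s) `|complex.Im (c k)| <= 2 * e by lra.
have -> : \sum_(k <- s) `|complex.Im (c k)| = \sum_(k <- s) `|complex.Re ('i * c k)|.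
  apply: eq_bigr => k _; case: (c k) => x y /=.
  by rewrite mul0r mul1r sub0r normrN.
apply: abs_sum_re => // s' us' ss'.
by rewrite -mulr_sumr cnormM cnorm_i mul1r; exact: H.
Qed.

(** The value at the center is the mean of the values at roots of unity of large order. *)
Lemma poly_center_bound p (B : R) : (forall t, cnorm p.[expi t] <= B) -> cnorm p.[0] <= B.
Proof.
move=> pB; pose N := (size p).+1.
have NR : N%:R != 0 :> R by rewrite pnatr_eq0.
pose w k : R[i] := expi (k%:R * (2 * pi / N%:R)).
have wN k : w k ^+ N = 1.
  rewrite /w expiX (_ : N%:R * _ = k%:R * (2 * pi)); last by field.
  have := cis_int k (0 : R); rewrite add0r => /(congr1 (@cval R)).
  by rewrite /cval /= expi0 mulrC.
have w1 k : (0 < k < N)%N -> w k != 1.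
  move=> /andP[k0 kN]; apply/eqP => /(congr1 (@complex.Re R)) /= E.
  have p2 : 0 < 2 * pi :> R by rewrite mulr_gt0 // pi_gt0.
  have : k%:R * (2 * pi / N%:R) = 0 :> R.
    apply: (cos_eq1_lt2pi _ E); rewrite mulr_ge0 ?divr_ge0 ?(ltW p2) //=.
    by rewrite mulrA ltr_pdivrMr ?ltr0n // mulrC ltr_pM2l // ltr_nat.
  move/eqP; rewrite !mulf_eq0 invr_eq0 (negbTE NR) orbF.
  rewrite -mulf_eq0 (gt_eqF p2) orbF pnatr_eq0 => /eqP k00.
  by rewrite k00 in k0.
have geom k : (k < N)%N -> \sum_(j < N) w k ^+ j = if k == 0%N then N%:R else 0.
  move=> kN; case: eqP => [->|/eqP k0].
    rewrite -[N in RHS]card_ord -sumr_const; apply: eq_bigr => j _.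
    by rewrite /w mul0r expi0 expr1n.
  have := subrX1 (w k) N; rewrite wN subrr => /esym/eqP; rewrite mulf_eq0 subr_eq0.
  by rewrite (negbTE (w1 k _)) ?lt0n ?k0 //= => /eqP.
have mean : N%:R * p.[0] = \sum_(j < N) p.[w j].
  transitivity (\sum_(j < N) \sum_(k < N) p`_k * w k ^+ j).
    rewrite exchange_big /= (eq_bigr (fun k : 'I_N => p`_k * (if (k : nat) == 0%N then N%:R else 0))).
      by rewrite big_ord_recl /= big1 ?addr0 ?horner_coef0 1?mulrC // => i _; rewrite mulr0.
    by move=> k _; rewrite -mulr_sumr geom.
  apply: eq_bigr => j _; rewrite (@horner_coef_wide _ N) //; apply: eq_bigr => k _.
  by rewrite /w !expiX; congr (_ * expi _); ring.
have : cnorm (N%:R * p.[0]) <= N%:R * B.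
  rewrite mean; apply: (le_trans (cnorm_sum _ _ _)).
  rewrite -[N in N%:R]card_ord mulr_natl -sumr_const; apply: ler_sum => j _; exact: pB.
by rewrite cnormM -(rmorph_nat (real_complex R)) cnorm_real normr_nat ler_pM2l.
Qed.

(** One of z and - z is in the left half. If q is the series divided by its leading
    power, the polynomial approximations of q(z) q(- z) are small on the whole circle, and
    so is their value at 0, the square of the leading coefficient. *)
Lemma half_circle_uniqueness c :
  (forall e : R, 0 < e -> exists K, forall s, uniq s -> all (leq K) s ->
     cnorm (\sum_(k <- s) c k) <= e) ->
  (forall t : R, cos t <= 0 -> forall e : R, 0 < e -> exists K0, forall K, (K0 <= K)%N ->
     cnorm (\sum_(k < K) c k * expi (k%:R * t)) <= e) ->
  forall k, c k = 0.
Proof.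
move=> sc zc.
have tail (e : R) : 0 < e -> exists K, forall K', \sum_(K <= k < K') cnorm (c k) <= e.
  move=> e0; have [|K KP] := sc (e / 4); first by lra.
  exists K => K'; have := @abs_sum (index_iota K K') c (e / 4) (iota_uniq _ _).
  rewrite (_ : 4 * (e / 4) = e); last by field.
  move=> H; apply: H => s us ss; apply: KP => //.
  by apply/allP => k /ss; rewrite mem_index_iota => /andP[].
have [M M0 MP] : exists2 M : R, 0 < M & forall K, \sum_(k < K) cnorm (c k) <= M.
  have [K KP] := tail 1 ltr01.
  have S0 : 0 <= \sum_(0 <= k < K) cnorm (c k) by apply: sumr_ge0 => k _; exact: cnorm_ge0.
  exists (\sum_(0 <= k < K) cnorm (c k) + 1) => [|K']; first by lra.
  rewrite -(big_mkord xpredT (fun k => cnorm (c k))).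
  apply: (@le_trans _ _ (\sum_(0 <= k < maxn K K') cnorm (c k))).
    rewrite (big_cat_nat (leq0n K') (leq_maxr K K')) /= lerDl.
    by apply: sumr_ge0 => k _; exact: cnorm_ge0.
  by rewrite (big_cat_nat (leq0n K) (leq_maxl K K')) /= lerD2l.
move=> k0; apply/eqP/negPn/negP => ck0.
have ex0 : exists k, c k != 0 by exists k0.
case: (ex_minnP ex0) => m cm mP {k0 ck0 ex0}.
have cm0 : 0 < cnorm (c m) by rewrite lt_neqAle cnorm_ge0 andbT eq_sym; apply: contra_neq cm; exact: cnorm_eq0.
(* Chosen so that 2 e M is half of the square of the leading coefficient. *)
pose e : R := cnorm (c m) ^+ 2 / (4 * M).
have e0 : 0 < e by rewrite divr_gt0 // ?exprn_gt0 // mulr_gt0.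
have [K KP] := tail e e0.
pose q : {poly R[i]} := \poly_(n < K.+1) c (m + n)%N.
have qE t : cnorm q.[expi t] = cnorm (\sum_(k < m + K.+1) c k * expi (k%:R * t)).
  rewrite -(big_mkord xpredT (fun k => c k * expi (k%:R * t))).
  rewrite (big_cat_nat (leq0n m) (leq_addr _ _)) /= big_nat big1 ?add0r; last first.
    move=> k km; apply/eqP; rewrite mulf_eq0; apply/orP; left; apply/negPn/negP => ck.
    by have := mP _ ck; lia.
  rewrite -[X in index_iota X _]add0n big_addn addKn big_mkord horner_poly.
  transitivity (cnorm (expi (m%:R * t)) * cnorm (\sum_(i < K.+1) c (m + i)%N * expi t ^+ i)).
    by rewrite cnorm_expi mul1r.
  rewrite -cnormM mulr_sumr; congr cnorm.
  apply: eq_bigr => k _; rewrite expiX mulrCA -expiD -mulrDl -natrD.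
  by rewrite addnC.
have qM t : cnorm q.[expi t] <= M.
  rewrite qE; apply: le_trans (MP (m + K.+1)%N); apply: (le_trans (cnorm_sum _ _ _)).
  by apply: ler_sum => k _; rewrite cnormM cnorm_expi mulr1.
have ql t : cos t <= 0 -> cnorm q.[expi t] <= 2 * e.
  move=> ct; have [K0 K0P] := zc t ct e e0.
  have := K0P (maxn K0 (m + K.+1)) (leq_maxl _ _).
  rewrite qE -!(big_mkord xpredT (fun k => c k * expi (k%:R * t))).
  rewrite (big_cat_nat (leq0n (m + K.+1)) (leq_maxr K0 _)) /=.
  set S := \sum_(0 <= k < _) _; set T := \sum_(_ <= k < _) _ => ST.
  have : cnorm T <= e.
    apply: le_trans (KP (maxn K0 (m + K.+1))); apply: (le_trans (cnorm_sum _ _ _)).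
    have KK : (K <= m + K.+1)%N by lia.
    rewrite [leRHS](big_cat_nat KK (leq_maxr K0 _)) /=.
    apply: ler_wpDl; first by apply: sumr_ge0 => k _; exact: cnorm_ge0.
    by apply: ler_sum => k _; rewrite cnormM cnorm_expi mulr1.
  have := cnormD (S + T) (- T); rewrite addrK.
  have -> : cnorm (- T) = cnorm T by exact: (rnormN (T : R[i]^o)).
  by lra.
have := @poly_center_bound (q * (q \Po - 'X)) (2 * e * M).
rewrite hornerM horner_comp hornerN hornerX oppr0 cnormM.
have -> : cnorm q.[0] = cnorm (c m) by rewrite horner_coef0 coef_poly addn0.
have -> : 2 * e * M = cnorm (c m) ^+ 2 / 2 by rewrite /e; field; lra.
move=> H; have : cnorm (c m) * cnorm (c m) <= cnorm (c m) ^+ 2 / 2.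
  apply: H => t; rewrite hornerM horner_comp hornerN hornerX cnormM.
  have -> : - expi t = expi (t + pi) by rewrite expiD /expi cospi sinpi; apply/eqP; rewrite eq_complex /= !mulr0 subr0 add0r !mulrN1 !eqxx.
  have -> : cnorm (c m) ^+ 2 / 2 = 2 * e * M by rewrite /e; field; lra.
  have [ct|ct] := leP (cos t) 0.
    by apply: ler_pM; rewrite ?cnorm_ge0 ?qM ?ql.
  by rewrite mulrC; apply: ler_pM; rewrite ?cnorm_ge0 ?qM ?ql // cosDpi; lra.
by rewrite expr2; nra.
Qed.

End PowerSeries.

(** * Stress tensors and flows in a Virasoro representation *)

Section Closures.
Variable R : realType.
Implicit Types H : hilbert R.

Lemma closure_pair H (T : set (H * H)) x y : closure T (x, y) <->
  forall e : R, 0 < e -> exists2 p, T p & rnorm (x - p.1) < e /\ rnorm (y - p.2) < e.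
Proof.
split => [cT e e0|H0 B].
  have : nbhs (x, y) ([set p | rnorm (x - p.1) < e /\ rnorm (y - p.2) < e] : set (H * H)).
    exists ([set z | rnorm (x - z) < e], [set z | rnorm (y - z) < e]) => /=.
      by split; apply/nbhs_rnorm; exists e.
    by move=> [u v] /= [].
  by move=> /cT [p [Tp /= [? ?]]]; exists p.
move=> [[B1 B2] /= [/nbhs_rnorm [e1 e10 H1] /nbhs_rnorm [e2 e20 H2]] BB].
have [|p Tp [p1 p2]] := H0 (Num.min e1 e2); first by rewrite lt_min e10.
exists p; split => //; apply: BB; split => /=.
  by apply: H1 => /=; apply: lt_le_trans p1 _; rewrite ge_min lexx.
by apply: H2 => /=; apply: lt_le_trans p2 _; rewrite ge_min lexx orbT.
Qed.

Lemma unitary_dense_eq (H1 H2 : hilbert R) (W W' : H1 -> H2) (D : set H1) :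
  unitary W -> unitary W' -> dense D -> (forall x, D x -> W x = W' x) ->
  forall x, W x = W' x.
Proof.
move=> uW uW' dD WW x; apply: (@small_rnorm_eq R H2 _ _ 2) => // e e0.
have [y Dy xy] := dense_rnorm dD x e0.
have := rnorm_dist (W x) (W y) (W' x); rewrite -(unitaryB uW) (unitary_rnorm uW) (WW y) //.
by rewrite -(unitaryB uW') (unitary_rnorm uW') (rnormBC y x); lra.
Qed.

Lemma cvg_totally (I : choiceType) (V : normedModType R[i]) (f : {fset I} -> V) l :
  f @ totally --> l <-> forall e : R, 0 < e ->
    exists A, forall B, (A `<=` B)%fset -> rnorm (l - f B) < e.
Proof.
have FF : Filter (@totally I) by case: (@totally_filter I).
split=> [/cvg_rnorm fl e /fl [A _ AP]|H0]; first by exists A.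
by apply/cvg_rnorm => e /H0 [A AP]; exists A.
Qed.

Lemma has_deriv_rescale (V : normedModType R[i]) (f : R -> V) (r : R) d :
  has_deriv f 0 d -> has_deriv (fun s => f (r * s)) 0 (r%:C *: d).
Proof.
move=> fd e e0; have r1 : 0 < `|r| + 1 by rewrite ltr_wpDl.
have [d0 d00 dP] := fd (e / (`|r| + 1)) (divr_gt0 e0 r1).
exists (d0 / (`|r| + 1)) => [|h hd]; first exact: divr_gt0.
have rh : `|r * h| <= (`|r| + 1) * `|h| by rewrite normrM ler_wpM2r // lerDl.
have := dP (r * h); rewrite !add0r mulr0 => H.
rewrite scalerA -rmorphM [h * r]mulrC; apply: (le_trans (H _)).
  by apply: (le_lt_trans rh); rewrite mulrC -ltr_pdivlMr.
apply: (@le_trans _ _ (e / (`|r| + 1) * ((`|r| + 1) * `|h|))).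
  by rewrite ler_wpM2l // divr_ge0 // ltW.
by rewrite mulrA divfK // gt_eqF.
Qed.

End Closures.

(** The field is the image of the rotation field by k. *)
Lemma conjugate_rotation_flow (R : realType) (k : circle R -> circle R) : diff_plus k ->
  exists k', [/\ diff_plus k', cancel k k', cancel k' k &
    exists2 f, Csmooth (f \o @cis R) &
      forall r, time_one_flow (fun z => r * f z) (k \o rot r \o k')].
Proof.
move=> /lift_of_diff_plus [a la ->]; have [b [lb ba ab _]] := lift_inverse la.
have [a' [_ ba' _ da]] := lift_inverse lb.
have {a' ba' da} da t : is_derive t (1 : R) a (derive1 b (a t))^-1.
  have aa' : a = a' by apply/funext => s; rewrite -{1}(ba' s) ba.
  by rewrite aa'; exact: da.
exists (circle_of_lift b); split.
- exact: diff_plus_lift.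
- by move=> z; rewrite -(angleK z) !circle_of_lift_cis // ab.
- by move=> z; rewrite -(angleK z) !circle_of_lift_cis // ba.
- exists (lift_field b); first exact: smooth_lift_field.
  by move=> r; rewrite -lift_flowE //; exact: time_one_lift_flow.
Qed.

Section OneRep.
Variables (R : realType) (c : R) (H : hilbert R) (V : circle_map R -> H -> H).
Variables (Ut : {uniform R -> R} -> H -> H) (L : int -> set (H * H)) (Om : H).
Hypothesis vr : virasoro_rep c V Ut L Om.
Local Notation D := (finite_energy (L 0)).
Local Notation l n := (app (L n)).

Lemma mode_app n x y : L n (x, y) -> l n x = y.
Proof.
have [[[T00 Tl T0] _] _] := (vir_closed vr n, tt).
move=> Txy; rewrite /app; case: xgetP => [y' _ /= Txy'|/(_ y) //].
have := Tl (-1) _ _ Txy Txy'; rewrite /= !scaleN1r addNr => /T0 /eqP.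
by rewrite addrC subr_eq0 => /eqP.
Qed.

Lemma mode_graph n x : op_dom (L n) x -> L n (x, l n x).
Proof. by move=> [[x' y] Txy /= <-]; rewrite (mode_app Txy). Qed.

Lemma mode_dom_graph n x : D x -> L n (x, l n x).
Proof. by move=> /(vir_invariant vr n) [/mode_graph]. Qed.

Lemma finite_energy_eigen r x : L 0 (x, r *: x) -> D x.
Proof.
have [->|x0] := eqVneq x 0; move=> T.
  exists 0%N, (fun _ => 0), (fun _ => 0); split; last by rewrite big_ord0.
  by move=> [].
exists 1%N, (fun _ => 1), (fun _ => x); split; last by rewrite big_ord1 scale1r.
by move=> _; exists r.
Qed.

Lemma finite_energy_subspace : subspace D.
Proof.
split; first by exists 0%N, (fun _ => 0), (fun _ => 0); split; [case|rewrite big_ord0].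
move=> a _ _ [m [b [e [Se ->]]]] [n [b' [e' [Se' ->]]]].
exists (m + n)%N, (fun i : 'I_(m + n) => match fintype.split i with inl j => a * b j | inr j => b' j end),
  (fun i : 'I_(m + n) => match fintype.split i with inl j => e j | inr j => e' j end); split.
  by move=> i; case: (fintype.split i).
rewrite big_split_ord /= scaler_sumr; congr (_ + _); apply: eq_bigr => i _.
  by rewrite -[lshift n i]/(unsplit (inl i)) unsplitK scalerA.
by rewrite -[rshift m i]/(unsplit (inr i)) unsplitK.
Qed.

(** Finite energy vectors are combinations of eigenvectors, whose eigenvalues are
    nonnegative and therefore real. *)
Lemma finite_energy_ind (P : H -> Prop) : subspace P ->
  (forall (r : R) x, 0 <= r -> x != 0 -> L 0 (x, r%:C *: x) -> P x) -> forall x, D x -> P x.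
Proof.
move=> sP eP _ [n [a [e [Se ->]]]]; apply: subspace_sum => // i; apply: subspaceZ => //.
have [r er] := Se i; have := vir_lowest vr er; case: er => e0 eT.
case: r eT => r r' eT; rewrite lecE /= => /andP[/eqP r'0 r0]; move: eT; rewrite r'0.
exact: eP.
Qed.

Lemma virasoro_vacuum_module : vacuum_module D (fun n => l n) c Om.
Proof.
have gr v : L 0 (v, 0) -> exists a, v = a *: Om.
  move=> T; have : [set x | L 0 (x, 0)] v by [].
  by rewrite (vir_ground vr) => -[a _ <-]; exists a.
have TOm : L 0 (Om, 0).
  have : [set a *: Om | a in [set: R[i]]] Om by exists 1; rewrite ?scale1r.
  by rewrite -(vir_ground vr).
have DT := mode_dom_graph.
split.
- exact: finite_energy_subspace.
- exact: vir_dense vr.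
- by move=> n v /(vir_invariant vr n) [].
- move=> n a u v Du Dv; apply: mode_app.
  have [[_ Tl _] _] := vir_closed vr n.
  exact: Tl a _ _ (DT n u Du) (DT n v Dv).
- move=> n u v Du Dv; have := DT (- n) v Dv; rewrite -(vir_adjoint vr) => /(_ _ (DT n u Du)).
  by [].
- by move=> n m v; exact: vir_comm vr n m v.
- move=> r v Dv v0 E; have := @vir_lowest _ _ _ _ _ _ _ vr r%:C v.
  by rewrite lecR; apply; split=> //; rewrite -E; exact: DT.
- by move=> v Dv E; apply: gr; rewrite -E; exact: DT.
- by apply: (@finite_energy_eigen 0); rewrite scale0r.
- exact: mode_app.
- by move=> n n0; apply: mode_app; exact: vir_annihil vr n n0.
- by apply: (@complexI R); rewrite -rnormE (vir_unit vr).
Qed.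

(** The lift of the rotations, whose generator is the mode 0; being defined without
    phase ambiguity, it replaces the operators V (rot t) everywhere. *)
Definition energy_group (t : R) : H -> H := Ut (fun s => s + t).

Lemma mob_cover_translation (t : R) : @mob_cover R (fun s => s + t).
Proof.
split.
  by move=> s; apply: cvgD; [exact: cvg_id|exact: cvg_cst].
by exists (rot t); [exact: mob_rot|move=> s; rewrite rot_cis addrC].
Qed.

Lemma energy_group_unitary : unitary_group energy_group.
Proof.
have [[uU UD _] _] := vir_lift vr; split => [t|s t x].
  exact: uU (mob_cover_translation t).
have := UD _ _ (mob_cover_translation s) (mob_cover_translation t).
move=> /(congr1 (fun u => u x)) /= UE; rewrite /energy_group -[RHS]UE; congr (Ut _ x).
by apply/funext => z /=; rewrite -addrA [t + s]addrC.
Qed.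

Lemma energy_group_generator : generator energy_group = L 0.
Proof. by rewrite (vir_L0 vr). Qed.

Lemma energy_group_rot t : up_to_phase (energy_group t) (V (rot t)).
Proof.
have [_ lift] := vir_lift vr; apply: lift; first exact: mob_cover_translation.
  exact: mob_rot.
by move=> s; rewrite rot_cis addrC.
Qed.

Lemma energy_group_eigen (r : R) x t : L 0 (x, r%:C *: x) -> energy_group t x = expi (r * t) *: x.
Proof.
by rewrite -energy_group_generator => /(group_eigen energy_group_unitary) ->.
Qed.

Lemma energy_group_vacuum t : energy_group t Om = Om.
Proof.
have M := virasoro_vacuum_module; rewrite (@energy_group_eigen 0) ?mul0r ?expi0 ?scale1r //.
rewrite scale0r -(vm_vacuum0 M); apply: mode_graph.
by have [] := vir_invariant vr 0 (vm_vacuum M).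
Qed.

Lemma energy_group_dom t x : D x -> D (energy_group t x).
Proof.
have uG := group_unitary energy_group_unitary t.
have sD := finite_energy_subspace.
apply: (@finite_energy_ind (fun x => D (energy_group t x))).
  split=> [|a u v Du Dv]; first by rewrite (unitary0 uG); case: sD.
  by rewrite (unitaryZD uG); exact: sD.2.
move=> r u r0 u0 E; rewrite (energy_group_eigen t E); apply: subspaceZ => //.
exact: finite_energy_eigen E.
Qed.

(** The mode n lowers the energy by n. *)
Lemma energy_group_mode n t x : D x ->
  energy_group t (l n x) = expi (- (n%:~R * t)) *: l n (energy_group t x).
Proof.
move=> Dx; have M := virasoro_vacuum_module.
have uG := group_unitary energy_group_unitary t.
suff : D x /\ energy_group t (l n x) = expi (- (n%:~R * t)) *: l n (energy_group t x) by case.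
have sD := finite_energy_subspace.
move: x Dx; apply: finite_energy_ind.
  split=> [|a u v [Du Eu] [Dv Ev]]; first by rewrite (unitary0 uG) (vm0 M) scaler0 (unitary0 uG); split => //; case: sD.
  split; first exact: sD.2.
  rewrite (vm_linear M) // !(unitaryZD uG) (vm_linear M) //; try exact: energy_group_dom.
  by rewrite Eu Ev scalerDr !scalerA mulrC.
move=> r u r0 u0 E; have Du := finite_energy_eigen E; split => //.
have := vm_energy M n Du (mode_app E) => En.
have Dn := vm_stable M n Du.
have : L 0 (l n u, (r - n%:~R)%:C *: l n u).
  by rewrite -En; apply: mode_graph; have [] := vir_invariant vr 0 Dn.
move=> /(energy_group_eigen t) ->; rewrite (energy_group_eigen t E) (vmZ M) //.
by rewrite scalerA -expiD; congr (expi _ *: _); ring.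
Qed.

Lemma stress_scale f (r : R) x y : Csmooth (f \o @cis R) ->
  stress L D f (x, y) -> stress L D (fun z => r * f z) (x, r%:C *: y).
Proof.
move=> sf /closure_pair H0; apply/closure_pair => e e0.
have r1 : 0 < `|r| + 1 by rewrite ltr_wpDl.
have e1 : 0 < Num.min e (e / (`|r| + 1)) by rewrite lt_min e0 divr_gt0.
have [[u v] [/= Du cv] [xu yv]] := H0 _ e1.
exists (u, r%:C *: v).
  split => //=; apply/cvg_totally => d d0.
  have d1 := divr_gt0 d0 r1.
  have [A0 A0P] := (cvg_totally _ _).1 cv _ d1; exists A0 => A /A0P Ad.
  rewrite (_ : \sum_(n <- A) _ = r%:C *: \sum_(n <- A) fourier f n *: l n u).
    rewrite -scalerBr rnormZ cnorm_real.
    apply: (@le_lt_trans _ _ ((`|r| + 1) * rnorm (v - \sum_(n <- A) fourier f n *: l n u))).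
      by rewrite ler_wpM2r ?rnorm_ge0 // lerDl.
    by rewrite mulrC -ltr_pdivlMr.
  by rewrite scaler_sumr; apply: eq_bigr => n _; rewrite fourierZ // scalerA.
split => /=; first by apply: lt_le_trans xu _; rewrite ge_min lexx.
rewrite -scalerBr rnormZ cnorm_real.
apply: (@le_lt_trans _ _ ((`|r| + 1) * rnorm (y - v))).
  by rewrite ler_wpM2r ?rnorm_ge0 // lerDl.
rewrite mulrC -ltr_pdivlMr //; apply: lt_le_trans yv _.
by rewrite ge_min lexx orbT.
Qed.

(** The exponentials of the stress tensors of the fields r f are given one r at a time.
    They belong to the single group generated by the stress tensor of f, as the
    generators are proportional. *)
Lemma stress_group f (F : R -> circle R -> circle R) : Csmooth (f \o @cis R) ->
  (forall r, time_one_flow (fun z => r * f z) (F r)) ->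
  exists E, [/\ unitary_group E, generator E = stress L D f &
    forall r, up_to_phase (E r) (V (F r))].
Proof.
move=> sf fl.
have sr r : Csmooth ((fun z => r * f z) \o @cis R) := smoothM (smooth_cst r) sf.
have ex r : exists W, [/\ unitary_group W, generator W = stress L D (fun z => r * f z) &
    up_to_phase (W 1) (V (F r))].
  have [u [W [uW gW W1]] uV] := vir_exp vr (CsmoothW (sr r)) (fl r).
  by exists W; rewrite W1; split => //; exact: unitary_rep_group.
have [E [gE genE _]] := ex 1.
have genE' : generator E = stress L D f.
  by rewrite genE; congr stress; apply/funext => z; rewrite mul1r.
exists E; split => // r; have [W [gW genW WV]] := ex r.
suff -> : E r = W 1 by [].
pose E' s := E (r * s).
have gE' : unitary_group E'.
  by split => [t|s t x]; [exact: group_unitary gE _|rewrite /E' mulrDr (groupD gE)].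
have [_ dT _] := vir_stress_sa vr (CsmoothW sf).
apply/funext; rewrite -[E r]/(E (r)) -[in E r](mulr1 r) -/(E' 1).
apply: (unitary_dense_eq (group_unitary gE' 1) (group_unitary gW 1) dT).
move=> x [[x' y] Txy /= <-] {x}.
have G t : stress L D f (E' t x', E' t y).
  by rewrite -genE'; apply: generator_group => //; rewrite genE'.
apply: (group_agree (y := fun t => r%:C *: E' t y)) => // t.
  apply/(generatorP gE').
  have := G t; rewrite -genE' => /(generatorP gE) /(has_deriv_rescale r).
  by rewrite !scalerA mulrC.
by rewrite genW; apply: stress_scale.
Qed.

End OneRep.

Lemma energy_intertwine_dom (R : realType) (c : R) (H1 H2 : hilbert R)
    (V1 : circle_map R -> H1 -> H1) (Ut1 : {uniform R -> R} -> H1 -> H1)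
    (L1 : int -> set (H1 * H1)) (Om1 : H1) (L2 : int -> set (H2 * H2)) (W : H1 -> H2) :
  virasoro_rep c V1 Ut1 L1 Om1 -> unitary W ->
  (forall x y, L1 0 (x, y) -> L2 0 (W x, W y)) ->
  forall x, finite_energy (L1 0) x -> finite_energy (L2 0) (W x).
Proof.
move=> vr1 uW WL; have sD := finite_energy_subspace L2.
apply: (finite_energy_ind vr1 (P := fun x => finite_energy (L2 0) (W x))).
  split=> [|a x y Dx Dy]; first by rewrite (unitary0 uW); case: sD.
  by rewrite (unitaryZD uW); exact: sD.2.
move=> r x r0 x0 E; apply: (@finite_energy_eigen _ _ _ r%:C).
by rewrite -(unitaryZ uW); exact: WL.
Qed.

(** * Intertwiners and irreducibility *)

Section Intertwining.
Variables (R : realType) (c1 c2 : R) (H1 H2 : hilbert R).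
Variables (V1 : circle_map R -> H1 -> H1) (V2 : circle_map R -> H2 -> H2).
Variables (Ut1 : {uniform R -> R} -> H1 -> H1) (Ut2 : {uniform R -> R} -> H2 -> H2).
Variables (L1 : int -> set (H1 * H1)) (L2 : int -> set (H2 * H2)) (Om1 : H1) (Om2 : H2).
Hypothesis vr1 : virasoro_rep c1 V1 Ut1 L1 Om1.
Hypothesis vr2 : virasoro_rep c2 V2 Ut2 L2 Om2.
Variable W : H1 -> H2.
Hypothesis uW : unitary W.
Hypothesis WD : forall x, finite_energy (L1 0) x -> finite_energy (L2 0) (W x).
Hypothesis Wl : forall n x, finite_energy (L1 0) x -> W (app (L1 n) x) = app (L2 n) (W x).

Lemma stress_intertwine f x y : stress L1 (finite_energy (L1 0)) f (x, y) ->
  stress L2 (finite_energy (L2 0)) f (W x, W y).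
Proof.
move=> /closure_pair H0; apply/closure_pair => e /H0 [[u v] [/= Du cv] [xu yv]].
exists (W u, W v).
  split => /=; first exact: WD.
  apply/cvg_totally => d d0; have [A AP] := (cvg_totally _ _).1 cv d d0.
  exists A => B /AP; rewrite -(unitary_rnorm uW) (unitaryB uW) (unitary_sum uW).
  congr (rnorm (_ - _) < d); apply: eq_bigr => n _.
  by rewrite (unitaryZ uW) Wl.
by rewrite /= -!(unitaryB uW) !(unitary_rnorm uW).
Qed.

(** Matching the modes matches the stress tensors of all fields, hence their
    exponentials, which represent the flows. *)
Lemma flow_intertwine k k' t : diff_plus k -> cancel k k' -> cancel k' k ->
  exists m : R[i], `|m| = 1 /\
    forall x, W (V1 (k \o rot t \o k') x) = m *: V2 (k \o rot t \o k') (W x).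
Proof.
move=> dk kk kk'; have [k1 [_ kk1 k1k [f sf fl]]] := conjugate_rotation_flow dk.
have E : k' = k1 by apply/funext => z; rewrite -{1}(k1k z) kk.
have [E1 [gE1 G1 EV1]] := stress_group vr1 sf fl.
have [E2 [gE2 G2 EV2]] := stress_group vr2 sf fl.
have int x : W (E1 t x) = E2 t (W x).
  apply: (group_intertwine uW gE1 gE2).
    by move=> u v; rewrite G1 G2; exact: stress_intertwine.
  by rewrite G1; case: (vir_stress_sa vr1 (CsmoothW sf)).
have [m1 [n1 P1]] := phase_sym (EV1 t); have [m2 [n2 P2]] := EV2 t.
exists (m1 * m2); split; first by rewrite normrM n1 n2 mulr1.
by move=> x; rewrite E P1 (unitaryZ uW) int P2 scalerA.
Qed.

End Intertwining.

Section Schur.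
Variables (R : realType) (c : R) (H : hilbert R) (V : circle_map R -> H -> H).
Variables (Ut : {uniform R -> R} -> H -> H) (L : int -> set (H * H)) (Om : H).
Hypothesis vr : virasoro_rep c V Ut L Om.
Local Notation D := (finite_energy (L 0)).
Local Notation G := (energy_group Ut).

Let M := virasoro_vacuum_module vr.
Let gG := energy_group_unitary vr.
Let uV g (dg : diff_plus g) : unitary (V g) := let: And3 u _ _ := vir_proj_rep vr in u g dg.
Let VM g h (dg : diff_plus g) (dh : diff_plus h) : up_to_phase (V (g \o h)) (V g \o V h) :=
  let: And3 _ m _ := vir_proj_rep vr in m g h dg dh.

Lemma rep_id : up_to_phase (V id) id.
Proof.
have di := diff_plus_id R; have [m [m1 E]] := VM di di.
exists m^-1; split; first by rewrite normfV m1 invr1.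
move=> x; have u := uV di; apply: (unitary_inj u).
have mn := norm1_neq0 m1.
have Ex : V id x = m *: V id (V id x) := E x.
rewrite (unitaryZ u); transitivity (m^-1 *: (m *: V id (V id x))); last by rewrite -Ex.
by rewrite scalerA mulVf // scale1r.
Qed.

Lemma rep_inv g g' : diff_plus g -> diff_plus g' -> cancel g' g ->
  up_to_phase (V g \o V g') id.
Proof.
move=> dg dg' gg; apply: phase_trans rep_id; apply: phase_sym.
rewrite -[X in V X](_ : g \o g' = id); first exact: VM.
exact/funext.
Qed.

Lemma expi_trivial (s : R) : (forall t, expi (t * s) = 1) -> s = 0.
Proof.
move=> H0; apply/eqP/negPn/negP => s0.
have := congr1 (@complex.Re R) (H0 (pi / s)); rewrite divfK //= cospi.
by move=> E; have : (-1 : R) < 1 by []; rewrite E ltxx.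
Qed.

Lemma rep_conjugate g r r' : diff_plus g -> diff_plus r -> diff_plus r' ->
  g \o r = r' \o g -> up_to_phase (V g \o V r) (V r' \o V g).
Proof.
move=> dg dr dr' E; apply: phase_trans (phase_sym (VM dg dr)) _.
by rewrite [X in V X]E; exact: VM.
Qed.

Lemma scale_cancel (a b : R[i]) (x : H) : rnorm x != 0 -> a *: x = b *: x -> a = b.
Proof.
move=> x0 /eqP; rewrite -subr_eq0 -scalerBl scaler_eq0 subr_eq0 => /orP[/eqP //|/eqP x00].
by rewrite x00 rnorm0 eqxx in x0.
Qed.

Lemma unit_conj_eq (a m : R[i]) : `|m| = 1 -> a * m^* = 1 -> m = a.
Proof.
move=> m1 E; have mm : m^* * m = 1 by rewrite mulrC -normCK m1 expr1n.
by rewrite -[RHS]mulr1 -mm mulrA E mul1r.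
Qed.

(** Commuting up to phases with the rotations, Z shifts the energy by a constant. The
    images of the vacuum by Z and its inverse have opposite energies, which are both
    nonnegative. *)
Lemma vacuum_preserved (Z Z' : H -> H) : unitary Z -> cancel Z Z' -> cancel Z' Z ->
  (forall t, up_to_phase (Z \o G t) (G t \o Z)) -> exists a, Z Om = a *: Om.
Proof.
move=> uZ ZK KZ ZG.
have [Z1 [uZ' ZZ1 Z1Z _]] := unitary_inv uZ.
have {Z1 ZZ1 Z1Z} uZ' : unitary Z'.
  by rewrite (_ : Z' = Z1) //; apply/funext => x; rewrite -{1}(Z1Z x) ZK.
have Om0 : rnorm Om != 0 by rewrite (vm_unit M) oner_eq0.
have energy psi : rnorm psi != 0 -> (forall t, exists2 m, `|m| = 1 & G t psi = m *: psi) ->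
    exists2 r, 0 <= r & forall t, G t psi = expi (r * t) *: psi.
  move=> p0 pG; have [[r [x [r0 xE px]]]|no] := pselect (exists r x, [/\ 0 <= r,
      L 0 (x, r%:C *: x) & hdot x psi != 0]).
    exists r => // t; have [m m1 mE] := pG t; rewrite mE; congr (_ *: _).
    have := unitary_hdot (group_unitary gG t) x psi.
    rewrite mE (energy_group_eigen vr t xE) hdotZl hdotZr mulrA => E.
    by apply: (unit_conj_eq m1); apply: (mulIf px); rewrite mul1r.
  case/negP: p0; apply/eqP; suff -> : psi = 0 by exact: rnorm0.
  apply: (dense_ortho (vir_dense vr)) => x Dx; rewrite hdotC.
  suff -> : hdot x psi = 0 by rewrite rmorph0.
  move: x Dx; apply: (finite_energy_ind vr).
    split=> [|a u v Eu Ev]; first by rewrite hdot0l.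
    by rewrite hdotDl hdotZl Eu Ev mulr0 addr0.
  move=> r x r0 x0 E; apply/eqP/negPn/negP => xp; apply: no.
  by exists r, x.
have [r r0 rE] : exists2 r, 0 <= r & forall t, G t (Z Om) = expi (r * t) *: Z Om.
  apply: energy; first by rewrite (unitary_rnorm uZ).
  move=> t; have [m [m1 E]] := phase_sym (ZG t); exists m => //.
  by have := E Om; rewrite /= (energy_group_vacuum vr).
have [r' r'0 r'E] : exists2 r, 0 <= r & forall t, G t (Z' Om) = expi (r * t) *: Z' Om.
  apply: energy; first by rewrite (unitary_rnorm uZ').
  move=> t; have [m [m1 E]] := ZG t; exists m => //.
  have := E (Z' Om); rewrite /= KZ (energy_group_vacuum vr) => E1.
  by rewrite -[LHS]ZK E1 (unitaryZ uZ').
have rr : r' + r = 0.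
  apply: expi_trivial => t; have [m [m1 E]] := ZG t.
  have E1 := E Om; have E2 := E (Z' Om).
  rewrite /= (energy_group_vacuum vr) rE scalerA in E1.
  rewrite /= KZ (energy_group_vacuum vr) r'E (unitaryZ uZ) KZ in E2.
  have ZOm0 : rnorm (Z Om) != 0 by rewrite (unitary_rnorm uZ).
  rewrite mulrDr expiD [t * r']mulrC [t * r]mulrC (scale_cancel Om0 E2).
  by apply: (scale_cancel ZOm0); rewrite -E1 scale1r.
have {rr r'0 r'E} r00 : r = 0 by lra.
have : L 0 (Z Om, 0).
  rewrite -(energy_group_generator vr).
  have := @eigen_generator _ _ G 0 (Z Om) gG; rewrite scale0r; apply=> t.
  by rewrite rE r00.
move=> T; have : [set x | L 0 (x, 0)] (Z Om) by [].
by rewrite (vir_ground vr) => -[a _ <-]; exists a.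
Qed.

Lemma eigenvectors_orthogonal (B : H -> H) (a b : R[i]) x y : unitary B -> rnorm y != 0 ->
  B x = a *: x -> B y = b *: y -> hdot x y != 0 -> a = b.
Proof.
move=> uB y0 Bx By xy; have := unitary_hdot uB x y.
rewrite Bx By hdotZl hdotZr mulrA => E; apply/esym/unit_conj_eq.
  have := unitary_norm uB y; rewrite By normrZ => Ey.
  by apply: (@mulIf _ `|y|); [rewrite rnormE; apply: contra_neq y0 => /complexI|rewrite mul1r].
by apply: (mulIf xy); rewrite mul1r.
Qed.

(** By vacuum_preserved the translates of the vacuum are eigenvectors of B. The
    eigenvalue is locally constant, because nearby translates are not orthogonal, hence
    constant; the vectors on which B acts by this scalar form a closed invariant
    subspace. *)
Lemma schur (B : H -> H) : unitary B ->
  (forall k k' t, diff_plus k -> diff_plus k' -> cancel k k' -> cancel k' k ->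
     up_to_phase (B \o V (k \o rot t \o k')) (V (k \o rot t \o k') \o B)) ->
  exists2 a : R[i], `|a| = 1 & forall x, B x = a *: x.
Proof.
move=> uB BV; have Om0 : rnorm Om != 0 by rewrite (vm_unit M) oner_eq0.
have eig k : diff_plus k -> exists a, B (V k Om) = a *: V k Om.
  move=> dk; have [k' [dk' kk' k'k]] := diff_plus_inv dk.
  have uk := uV dk; have [S [uS kS Sk _]] := unitary_inv uk.
  have [B' [uB' BK KB _]] := unitary_inv uB.
  have [|||t|a aE] := @vacuum_preserved (S \o B \o V k) (S \o B' \o V k).
  - by apply: unitary_comp uk; exact: unitary_comp.
  - by move=> x /=; rewrite Sk BK kS.
  - by move=> x /=; rewrite Sk KB kS.
  - have dr := diff_plus_rot t; have dkr := diff_plus_comp dk dr.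
    have VS : up_to_phase (V k') S.
      have [m [m1 E]] := rep_inv dk dk' k'k; exists m; split=> // x.
      by rewrite -[LHS]kS -[V k (V k' x)]/((V k \o V k') x) E (unitaryZ uS).
    have VX : up_to_phase (V (k \o rot t \o k')) (V k \o G t \o S).
      apply: phase_trans (VM dkr dk') _; apply: phase_comp VS.
        by apply: unitary_comp (group_unitary gG t).
      apply: phase_trans (VM dk dr) _; apply: phase_compl => //.
      exact: phase_sym (energy_group_rot vr t).
    have BX : up_to_phase (B \o (V k \o G t \o S)) ((V k \o G t \o S) \o B).
      apply: phase_trans (phase_trans (BV k k' t dk dk' kk' k'k) (phase_compr _ VX)).
      exact/(phase_compl uB)/phase_sym.
    have [m [m1 E]] := BX; exists m; split=> // x.
    by have /= := E (V k x); rewrite kS => ->; rewrite (unitaryZ uS) kS.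
  by exists a; rewrite -(unitaryZ uk) -aE /= Sk.
pose a (k : circle R -> circle R) := hdot (B (V k Om)) (V k Om).
have aE k : diff_plus k -> B (V k Om) = a k *: V k Om.
  move=> dk; have [b bE] := eig k dk; rewrite /a bE hdotZl hdot_self.
  by rewrite (unitary_rnorm (uV dk)) (vm_unit M) expr1n mulr1.
have acst k : diff_plus k -> a k = a id.
  move: k; apply: diff_plus_locally_constant => k dk.
  have [_ _ cV] := vir_proj_rep vr; have cVk := cV k dk [:: Om] 1 ltr01.
  apply: (@filterS _ (nbhs (k : circle_map R)) _ _ _ _ cVk) => h near_k dh; have [m [m1 /(_ Om)]] := near_k dh.
  rewrite mem_seq1 eqxx => /(_ isT); rewrite rnormE ltcR => mE.
  apply: (eigenvectors_orthogonal uB _ (aE h dh) (aE k dk)).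
    by rewrite (unitary_rnorm (uV dk)) (vm_unit M) oner_eq0.
  (* Orthogonal unit vectors are at distance sqrt 2. *)
  apply/eqP => hk; have := rnorm_sqrD (m *: V h Om) (- V k Om).
  rewrite hdotNr hdotZl hk mulr0 oppr0 rnormN rnormZ !(unitary_rnorm (uV _)) //.
  rewrite (vm_unit M) (norm1P m).1 //=; have := rnorm_ge0 (m *: V h Om - V k Om); nra.
have aE' k : diff_plus k -> B (V k Om) = a id *: V k Om by move=> dk; rewrite aE // acst.
have a1 : `|a id| = 1.
  have di := diff_plus_id R; have := unitary_norm uB (V id Om).
  rewrite aE' // normrZ (unitary_norm (uV di)) (vir_unit vr) mulr1 //.
exists (a id) => //.
pose K : set H := [set x | forall g, diff_plus g -> B (V g x) = a id *: V g x].
have sK : subspace K.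
  split=> [g dg|b x y Kx Ky g dg]; first by rewrite (unitary0 (uV dg)) (unitary0 uB) scaler0.
  rewrite (unitaryZD (uV dg)) (unitaryZD uB) Kx // Ky // scalerDr !scalerA.
  by rewrite [a id * b]mulrC.
have cK : closed K.
  move=> x /closure_rnorm cx g dg; apply: (@small_rnorm_eq R H _ _ 2) => // e e0.
  have [y Ky xy] := cx e e0; have u := uV dg.
  have := rnorm_dist (B (V g x)) (B (V g y)) (a id *: V g x).
  rewrite -(unitaryB uB) -(unitaryB u) (unitary_rnorm uB) (unitary_rnorm u) Ky //.
  rewrite -scalerBr rnormZ (norm1P _).1 // mul1r -(unitaryB u) (unitary_rnorm u).
  by rewrite (rnormBC y x); lra.
have [|K0|KT] := vir_irreducible vr cK sK.1 sK.2.
- move=> g x dg Kx h dh; have [m [m1 E]] := VM dh dg.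
  have := Kx _ (diff_plus_comp dh dg); rewrite E (unitaryZ uB) scalerA mulrC -scalerA.
  move=> /(scalerI (norm1_neq0 m1)); exact.
- have : K Om by exact: aE'.
  by rewrite K0 => /= E; rewrite E rnorm0 eqxx in Om0.
- move=> x; have : K x by rewrite KT.
  have di := diff_plus_id R; move=> /(_ _ di).
  have [m [m1 E]] := rep_id; rewrite E (unitaryZ uB) scalerA mulrC -scalerA.
  by move=> /(scalerI (norm1_neq0 m1)).
Qed.

End Schur.

(** * Uniqueness of the vacuum representation *)

Section Cyclic.
Variables (R : realType) (c : R) (H : hilbert R) (V : circle_map R -> H -> H).
Variables (Ut : {uniform R -> R} -> H -> H) (L : int -> set (H * H)) (Om : H).
Hypothesis vr : virasoro_rep c V Ut L Om.
Local Notation D := (finite_energy (L 0)).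
Local Notation G := (energy_group Ut).
Local Notation l := (fun n => app (L n)).

Let M := virasoro_vacuum_module vr.
Let gG := energy_group_unitary vr.

Lemma word_span_energy t x : word_span l Om x -> word_span l Om (G t x).
Proof.
have uG := group_unitary gG t.
suff H0 : forall k x y, words l l Om Om k x y -> word_span l Om (G t x) by move=> [k /H0].
move=> {x} k x y; elim=> {k x y} [k a|k n x y w IH|k a x y x' y' _ IH _ IH'].
- rewrite (unitaryZ uG) (energy_group_vacuum vr).
  by apply: subspaceZ; [exact: word_span_subspace|exact: word_span_vacuum].
- rewrite (energy_group_mode vr); last by case: (words_dom M M w).
  by apply: subspaceZ; [exact: word_span_subspace|exact: word_span_mode].
- by rewrite (unitaryZD uG); exact: (word_span_subspace _ _).2.
Qed.

(** The reflection in the closed span of the words commutes with the modes, hence with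
    the flows up to phases, so that it is a scalar; it fixes the vacuum. *)
Lemma words_dense : dense (word_span l Om).
Proof.
have sW := word_span_subspace l Om.
pose K := closure (word_span l Om).
have sK : subspace K := subspace_closure sW.
have cK : closed K by exact: closed_closure.
have ex x : exists p, K p /\ forall k, K k -> hdot (x - p) k = 0.
  by have [p Kp pP] := orthogonal_projection x sK cK; exists p.
have [P PP] := choice ex; have {ex} KP x := (PP x).1; have PO x := (PP x).2; clear PP.
have uniq x p : K p -> (forall k, word_span l Om k -> hdot (x - p) k = 0) -> P x = p.
  move=> Kp pO; apply/eqP; rewrite -subr_eq0; apply/eqP/hdot_self_eq0.
  have Kd := subspaceB sK (KP x) Kp.
  have E : P x - p = (x - p) - (x - P x) by rewrite opprB [RHS]addrC addrA subrK.
  by rewrite {1}E hdotBl PO // subr0; exact: hdot_approx0 Kd pO.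
have Plin a x y : P (a *: x + y) = a *: P x + P y.
  apply: uniq => [|k /subset_closure Kk]; first exact: sK.2.
  by rewrite opprD addrACA -scalerBr hdotDl hdotZl !PO // mulr0 addr0.
have Pself x y : hdot (P x) y = hdot (P x) (P y).
  by apply/eqP; rewrite -subr_eq0 -hdotBr hdotC PO // rmorph0.
have Pself' x y : hdot x (P y) = hdot (P x) (P y).
  by apply/eqP; rewrite -subr_eq0 -hdotBl PO.
have PG t x : P (G t x) = G t (P x).
  have uG := group_unitary gG t; apply: uniq => [|k kW].
    apply/closure_rnorm => e e0; have [w Ww wx] := (closure_rnorm _ _).1 (KP x) e e0.
    exists (G t w); first exact: word_span_energy.
    by rewrite -(unitaryB uG) (unitary_rnorm uG).
  rewrite -(unitaryB uG) -(groupKN gG t k) (unitary_hdot uG); apply: PO.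
  by apply: subset_closure; exact: word_span_energy.
have P0 : P 0 = 0 by apply: uniq => [|k _]; rewrite ?subr0 ?hdot0l //; exact: sK.1.
have PZ a x : P (a *: x) = a *: P x by rewrite -[a *: x]addr0 Plin P0 addr0.
have PD x : D x -> D (P x).
  have sD := finite_energy_subspace L.
  move: x; apply: (finite_energy_ind vr (P := fun x => D (P x))).
    by split=> [|a x y Dx Dy]; [rewrite P0; case: sD|rewrite Plin; exact: sD.2].
  move=> r x r0 x0 E; apply: (@finite_energy_eigen _ _ _ r%:C).
  rewrite -(energy_group_generator vr); apply: eigen_generator => // t.
  by rewrite -PG (energy_group_eigen vr t E) PZ.
have orth n x k : D x -> word_span l Om k -> hdot (l n (x - P x)) k = 0.
  move=> Dx kW; have Dd := subspaceB (vm_subspace M) Dx (PD x Dx).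
  rewrite (vm_adjoint M) //; last exact: word_span_dom M _ kW.
  by apply: PO; apply: subset_closure; exact: word_span_mode.
have Pl n x : D x -> P (l n x) = l n (P x).
  move=> Dx; have DP := PD x Dx; apply: uniq => [|k kW]; last first.
    have := orth n x k Dx kW.
    by rewrite (vmB M).
  suff <- : P (l n (P x)) = l n (P x) by [].
  apply/esym/(dense_hdot_ext (vir_dense vr)) => y Dy.
  have Dln := vm_stable M n DP.
  rewrite Pself -Pself' -[in LHS](subrK (P y) y) hdotDr (vm_adjoint M) //; last first.
    exact: subspaceB (vm_subspace M) Dy (PD y Dy).
  rewrite (_ : hdot (P x) _ = 0) ?add0r // hdotC.
  by rewrite (hdot_approx0 (KP x)) ?rmorph0 // => k; exact: orth.
(* The reflection 2 P - 1. *)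
pose B x := P x + P x - x.
have PP x : P (P x) = P x by apply: uniq => // k _; rewrite subrr hdot0l.
have BB x : B (B x) = x.
  have PB : P (B x) = P x.
    have := Plin 1 (P x) (P x); rewrite !scale1r PP => PA.
    by rewrite /B -scaleN1r addrC Plin PA scaleN1r addKr.
  by rewrite {1}/B PB opprB addrC subrK.
have Blin a x y : B (a *: x + y) = a *: B x + B y.
  rewrite /B Plin opprD scalerBr scalerDr; move: (a *: P x) (P y) (a *: x) => u v w.
  by rewrite [u + v + _]addrACA [LHS]addrACA.
have uB : unitary B.
  split=> [|x y|y]; [exact: Blin| |by exists (B y)].
  rewrite /B !hdotBl !hdotDl !hdotBr !hdotDr !(Pself x y) !(Pself' x y).
  by ring.
have BOm : B Om = Om.
  have POm : P Om = Om.
    apply: uniq => [|k _]; last by rewrite subrr hdot0l.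
    by apply: subset_closure; exact: word_span_vacuum.
  by rewrite /B POm addrK.
have [|a a1 aE] := schur vr uB.
  move=> k k' t dk dk' kk' k'k.
  apply: (flow_intertwine vr vr uB) => //.
  - move=> x Dx; have sD := vm_subspace M; have Px := PD x Dx.
    by apply: subspaceB => //; exact: subspaceD.
  - move=> n x Dx; have Px := PD x Dx.
    have D2 : D (P x + P x) := subspaceD (vm_subspace M) Px Px.
    by rewrite /B Pl // (vmB M) // (vmD M).
have {}a1 : a = 1.
  apply: (@scale_cancel _ _ _ _ Om); first by rewrite (vm_unit M) oner_eq0.
  by rewrite -aE BOm scale1r.
apply: rnorm_dense => x; apply/closure_rnorm.
suff <- : P x = x by exact: KP.
have := aE x; rewrite a1 scale1r => /eqP; rewrite subr_eq => /eqP E.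
apply: (@scalerI _ _ (1 + 1 : R[i])); first by rewrite -[1 + 1]/(2%:R) pnatr_eq0.
by rewrite !scalerDl !scale1r.
Qed.

End Cyclic.

(** Matching words gives a unitary W that matches the modes. For a diffeomorphism g, the
    operator comparing W V1(g) with V2(g) W commutes up to phases with all the conjugates
    of rotations, the conjugation by g permuting them, and is a scalar. *)
Lemma virasoro_rep_unique (R : realType) (c : R) (H1 H2 : hilbert R)
    (V1 : circle_map R -> H1 -> H1) (V2 : circle_map R -> H2 -> H2)
    (Ut1 : {uniform R -> R} -> H1 -> H1) (Ut2 : {uniform R -> R} -> H2 -> H2)
    (L1 : int -> set (H1 * H1)) (L2 : int -> set (H2 * H2)) (Om1 : H1) (Om2 : H2) :
  virasoro_rep c V1 Ut1 L1 Om1 -> virasoro_rep c V2 Ut2 L2 Om2 ->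
  exists W : H1 -> H2, [/\ unitary W, W Om1 = Om2 & forall g, diff_plus g ->
    exists m : R[i], `|m| = 1 /\ forall x, W (V1 g x) = m *: V2 g (W x)].
Proof.
move=> vr1 vr2.
have M1 := virasoro_vacuum_module vr1; have M2 := virasoro_vacuum_module vr2.
set l1 := fun n => app (L1 n) in M1; set l2 := fun n => app (L2 n) in M2.
pose T : set (H1 * H2) := [set p | exists k, words l1 l2 Om1 Om2 k p.1 p.2].
have [||||W uW WT] := @unitary_extension R H1 H2 T.
- move=> a [x y] [x' y'] [k w] [k' w']; exists (k + k')%N.
  by apply: WordComb; [apply: words_leq w; exact: leq_addr|apply: words_leq w'; exact: leq_addl].
- move=> [x y] [k /= w]; have := words_gram M1 M2 w w; rewrite !hdot_self => /complexI.
  by move=> /eqP; rewrite eqrXn2 ?rnorm_ge0 // => /eqP.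
- rewrite (_ : _ @` _ = word_span l1 Om1); first exact: (words_dense vr1).
  apply/seteqP; split=> [_ [[x y] [k /= w] <-]|x [k w]].
    by exists k; exact: words_left w.
  by have [y w'] := words_exr l2 Om2 w; exists (x, y) => //; exists k.
- rewrite (_ : _ @` _ = word_span l2 Om2); first exact: (words_dense vr2).
  apply/seteqP; split=> [_ [[x y] [k /= w] <-]|y [k w]].
    by exists k; exact: words_right w.
  by have [x w'] := words_exl l1 Om1 w; exists (x, y) => //; exists k.
have Ww k x y : words l1 l2 Om1 Om2 k x y -> W x = y.
  by move=> w; apply: (WT (x, y)); exists k.
have WOm : W Om1 = Om2.
  by apply: (Ww 0%N); have := WordVacuum l1 l2 Om1 Om2 0 1; rewrite !scale1r.
have [W' [uW' WK KW _]] := unitary_inv uW.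
have Wgroup t x : W (energy_group Ut1 t x) = energy_group Ut2 t (W x).
  have u1 := group_unitary (energy_group_unitary vr1) t.
  have u2 := group_unitary (energy_group_unitary vr2) t.
  apply: (unitary_dense_eq (unitary_comp uW u1) (unitary_comp u2 uW) (words_dense vr1)).
  move=> {}x [k w]; have [y {}w] := words_exr l2 Om2 w; rewrite /=.
  suff [k' w'] : exists k, words l1 l2 Om1 Om2 k (energy_group Ut1 t x) (energy_group Ut2 t y).
    by rewrite (Ww _ _ _ w) (Ww _ _ _ w').
  elim: w => {k x y} [k a|k n x y w [k' IH]|k a x y x' y' _ [k1 w1] _ [k2 w2]].
  - exists 0%N; rewrite (unitaryZ u1) (unitaryZ u2).
    by rewrite (energy_group_vacuum vr1) (energy_group_vacuum vr2); exact: WordVacuum.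
  - have [Dx Dy] := words_dom M1 M2 w; exists k'.+1.
    rewrite (energy_group_mode vr1) // (energy_group_mode vr2) //.
    by apply: wordsZ; exact: WordMode.
  - exists (k1 + k2)%N; rewrite (unitaryZD u1) (unitaryZD u2).
    by apply: WordComb; [apply: words_leq w1; exact: leq_addr|apply: words_leq w2; exact: leq_addl].
have WD : forall x, finite_energy (L1 0) x -> finite_energy (L2 0) (W x).
  apply: (energy_intertwine_dom vr1 uW) => x y.
  rewrite -(energy_group_generator vr1) -(energy_group_generator vr2).
  exact: (generator_intertwine uW (energy_group_unitary vr1) (energy_group_unitary vr2) Wgroup).
have Wl n x : finite_energy (L1 0) x -> W (app (L1 n) x) = app (L2 n) (W x).
  move=> Dx; apply: (dense_hdot_ext (words_dense vr2)) => y [k w].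
  have [z {}w] := words_exl l1 Om1 w; have [Dz Dy] := words_dom M1 M2 w.
  rewrite -{1}(Ww _ _ _ w) (unitary_hdot uW) (vm_adjoint M1) //.
  rewrite (vm_adjoint M2) //; last exact: WD.
  by rewrite -(unitary_hdot uW) (Ww _ _ _ (WordMode (- n) w)).
exists W; split=> // g dg.
have [uV1 _ _] := vir_proj_rep vr1; have [uV2 _ _] := vir_proj_rep vr2.
have u1 := uV1 g dg; have u2 := uV2 g dg.
have [S [uS SK KS _]] := unitary_inv u2.
have [g' [dg' gg' g'g]] := diff_plus_inv dg.
(* The operator W^-1 V2(g)^-1 W V1(g). *)
have [||a a1 aE] := schur vr1 (B := W' \o S \o W \o V1 g).
- by apply: unitary_comp u1; apply: unitary_comp uW; exact: unitary_comp.
- move=> k k' t dk dk' kk' k'k.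
  set r := k \o rot t \o k'; pose r' := (g \o k) \o rot t \o (k' \o g').
  have dr : diff_plus r by do 2?apply: diff_plus_comp => //; exact: diff_plus_rot.
  have dr' : diff_plus r'.
    by apply: diff_plus_comp; apply: diff_plus_comp => //;
      [exact: diff_plus_comp|exact: diff_plus_rot].
  have rg : g \o r = r' \o g by apply/funext => z; rewrite /r' /r /= gg'.
  have [m1 [n1 P1]] := rep_conjugate vr1 dg dr dr' rg.
  have [m2 [n2 P2]] := phase_sym (rep_conjugate vr2 dg dr dr' rg).
  have [m3 [n3 P3]] : exists m : R[i], `|m| = 1 /\ forall x, W (V1 r' x) = m *: V2 r' (W x).
    apply: (flow_intertwine vr1 vr2 uW WD Wl); first exact: diff_plus_comp.
      by move=> z /=; rewrite gg' kk'.
    by move=> z /=; rewrite k'k g'g.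
  have [m4 [n4 P4]] := flow_intertwine vr1 vr2 uW WD Wl t dk kk' k'k.
  have m4n := norm1_neq0 n4.
  exists (m1 * m3 * m2 / m4); split; first by rewrite !normrM normfV n1 n2 n3 n4 invr1 !mulr1.
  move=> x; have /= -> := P1 x.
  rewrite (unitaryZ uW) P3 -[in X in V2 r' X](KS (W (V1 g x))).
  have /= -> := P2 (S (W (V1 g x))).
  rewrite !(unitaryZ uS) SK !(unitaryZ uW') -[in X in V2 r X](KW (S (W (V1 g x)))).
  have -> y : V2 r (W y) = m4^-1 *: W (V1 r y) by rewrite P4 scalerA mulVf // scale1r.
  by rewrite (unitaryZ uW') WK !scalerA.
- exists a; split=> // x; by rewrite -(unitaryZ u2) -(unitaryZ uW) -aE /= KW KS.
Qed.

(** * Products of unitary groups and sums over the integers *)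

Section ProductCurves.
Variables (R : realType) (H : hilbert R).
Implicit Types (U E : R -> H -> H) (x y z : H) (e : R).

Lemma has_deriv_hdotr (f : R -> H) t d z : has_deriv f t d ->
  has_deriv ((fun s => hdot z (f s)) : R -> (R[i])^o) t (hdot z d).
Proof.
move=> fd e e0; have z0 : 0 < rnorm z + 1 by have := rnorm_ge0 z; lra.
have [r r0 fr] := fd _ (divr_gt0 e0 z0).
exists r => // h hr; rewrite /GRing.scale /= -[h%:C]conj_real -hdotZr -!hdotBr.
apply: (le_trans (cauchy_schwarz _ _)).
apply: (@le_trans _ _ ((rnorm z + 1) * (e / (rnorm z + 1) * `|h|))).
  by rewrite ler_pM ?rnorm_ge0 ?fr // lerDl.
by rewrite mulrA mulrCA mulfV ?mulr1 // gt_eqF.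
Qed.

Lemma group_continuous U x e : unitary_group U -> dense (op_dom (generator U)) -> 0 < e ->
  exists2 r, 0 < r & forall h, `|h| < r -> rnorm (U h x - x) <= e.
Proof.
move=> gU dU e0; have e4 : 0 < e / 4 by lra.
have [_ [[y w] /= Tyw <-] xy] := dense_rnorm dU x e4.
have /(generatorP gU) yd := Tyw; have [r r0 yr] := yd 1 ltr01.
have w1 : 0 < rnorm w + 1 by have := rnorm_ge0 w; lra.
exists (Num.min r (e / 4 / (rnorm w + 1))); first by rewrite lt_min r0 divr_gt0.
move=> h; rewrite lt_min => /andP[hr he]; have := yr h hr.
rewrite add0r (group0 gU) mul1r => H1.
have uU := group_unitary gU h.
have h1 : `|h| * (rnorm w + 1) < e / 4 by rewrite -ltr_pdivlMr.
have : rnorm (U h y - y) <= e / 4.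
  have := rnormD (U h y - y - h%:C *: ('i *: w)) (h%:C *: ('i *: w)).
  rewrite subrK !rnormZ cnorm_i mul1r cnorm_real => H2.
  apply: (le_trans H2); apply: (le_trans (lerD H1 (lexx _))).
  by apply: le_trans (ltW h1); rewrite mulrDr mulr1 addrC.
have -> : U h x - x = U h (x - y) + (U h y - y) + (y - x).
  by rewrite (unitaryB uU) !addrA !subrK.
move=> H2; have := rnormD (U h (x - y) + (U h y - y)) (y - x).
have := rnormD (U h (x - y)) (U h y - y).
by rewrite (unitary_rnorm uU) (rnormBC y); lra.
Qed.

(** The derivative of the inner factor is moved by U s, which tends strongly to the
    identity. *)
Lemma has_deriv_product U E x a b : unitary_group U -> unitary_group E ->
  dense (op_dom (generator U)) -> generator U (x, a) -> generator E (x, b) ->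
  has_deriv (fun s => U s (E (- s) x)) 0 ('i *: (a - b)).
Proof.
move=> gU gE dU /(generatorP gU) xa /(generatorP gE) xb e e0.
have e3 : 0 < e / 3 by lra.
have [r1 r10 P1] := xa _ e3; have [r2 r20 P2] := xb _ e3.
have [r3 r30 P3] := group_continuous b gU dU e3.
exists (Num.min r1 (Num.min r2 r3)) => [|h]; first by rewrite !lt_min r10 r20.
rewrite !lt_min => /and3P[h1 h2 h3].
have := P1 h h1; have := P2 (- h); rewrite normrN => /(_ h2); have := P3 h h3.
rewrite !add0r oppr0 !(group0 gE) !(group0 gU) => Q3 Q2 Q1.
have uU := group_unitary gU h.
have -> : U h (E (- h) x) - x - h%:C *: ('i *: (a - b)) =
    (U h x - x - h%:C *: ('i *: a)) + U h (E (- h) x - x - (- h)%:C *: ('i *: b))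
      - (h%:C * 'i) *: (U h b - b).
  rewrite rmorphN scaleNr opprK !scalerA (unitaryD uU) (unitaryB uU) (unitaryZ uU).
  by apply: hdot_ext => t; rewrite !(hdotDl, hdotNl, hdotZl); ring.
have := rnormB ((U h x - x - h%:C *: ('i *: a)) + U h (E (- h) x - x - (- h)%:C *: ('i *: b)))
   ((h%:C * 'i) *: (U h b - b)).
have := rnormD (U h x - x - h%:C *: ('i *: a)) (U h (E (- h) x - x - (- h)%:C *: ('i *: b))).
rewrite (unitary_rnorm uU) rnormZ cnormM cnorm_i mulr1 cnorm_real.
have : `|h| * rnorm (U h b - b) <= `|h| * (e / 3) by rewrite ler_wpM2l.
lra.
Qed.

End ProductCurves.

Section OneSidedSums.
Variables (R : realType) (V : normedModType R[i]).

(** Converts the convergence along finite sets of integers into the two hypotheses of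
    half_circle_uniqueness. *)
Lemma one_sided_sums (u : int -> V) l :
  \sum_(n <- (A : {fset int})) u n @[A --> totally] --> l ->
  (forall n : int, 0 < n -> u n = 0) -> forall e : R, 0 < e ->
  exists N : nat, (forall K, (N <= K)%N -> rnorm (l - \sum_(k < K) u (- k%:Z)) <= e) /\
    (forall s : seq nat, uniq s -> all (leq N) s -> rnorm (\sum_(k <- s) u (- k%:Z)) <= e).
Proof.
move=> /cvg_totally ul u0 e e0; have e2 : 0 < e / 2 by lra.
have [A0 A0P] := ul _ e2.
pose N := (\max_(n <- A0) `|n|%N).+1.
have NP n : n \in A0 -> (`|n| < N)%N.
  by move=> nA; rewrite ltnS; exact: (leq_bigmax_seq (F := fun n : int => `|n|%N) n).
have sumP (s : seq int) : uniq s -> {subset A0 <= s} -> rnorm (l - \sum_(n <- s) u n) < e / 2.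
  move=> us ss; pose B := seq_fset tt s.
  have Bs : perm_eq B s.
    by apply: uniq_perm => [||n]; rewrite ?seq_fset_uniq ?seq_fsetE.
  have := A0P B; rewrite (perm_big _ Bs) /=; apply; apply/fsubsetP => n nA.
  by rewrite (perm_mem Bs) ss.
have negs (s : seq nat) : uniq s -> uniq [seq - k%:Z | k <- s].
  by move=> us; rewrite map_inj_uniq // => k k'; lia.
exists N; split=> [K NK|s us sN].
  pose s : seq int := [seq n <- A0 | 0 < n] ++ [seq - k%:Z | k <- index_iota 0 K].
  have := sumP s; rewrite /s big_cat /= big_filter big1 ?add0r; last by move=> n; exact: u0.
  rewrite big_map big_mkord => H1; apply/ltW; apply: lt_le_trans (H1 _ _) _; last by lra.
    rewrite cat_uniq filter_uniq ?fset_uniq // negs ?iota_uniq // andbT /=.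
    apply/hasPn => _ /mapP [k _ ->] /=; rewrite mem_filter; apply/negP => /andP[+ _]; lia.
  move=> n nA; rewrite mem_cat mem_filter nA andbT; have := NP n nA.
  case: (ltP 0 n) => //= n0 nN; apply/mapP; exists `|n|%N; last by lia.
  by rewrite mem_index_iota; lia.
have H1 := sumP A0 (fset_uniq A0) (fun _ => id).
have := sumP (A0 ++ [seq - k%:Z | k <- s]); rewrite big_cat big_map => H2.
have {}H2 : rnorm (l - (\sum_(n <- A0) u n + \sum_(k <- s) u (- k%:Z))) < e / 2.
  apply: H2; last by move=> n nA; rewrite mem_cat nA.
  rewrite cat_uniq fset_uniq negs // andbT /=; apply/hasPn => _ /mapP [k ks ->].
  apply/negP => /NP; have /allP /(_ k ks) := sN; lia.
have := rnormB (l - \sum_(n <- A0) u n) (l - (\sum_(n <- A0) u n + \sum_(k <- s) u (- k%:Z))).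
rewrite (_ : l - _ - _ = \sum_(k <- s) u (- k%:Z)); first by lra.
by rewrite !opprD !opprK addrACA subrr add0r addKr.
Qed.

End OneSidedSums.

Section TotalSums.
Variables (R : realType) (H : hilbert R).

Lemma cvg_totally_hdot (u : int -> H) w z :
  \sum_(n <- (A : {fset int})) u n @[A --> totally] --> w ->
  (\sum_(n <- (A : {fset int})) (hdot (u n) z : (R[i])^o)) @[A --> totally] --> (hdot w z : (R[i])^o).
Proof.
move=> /cvg_totally uw; apply/cvg_totally => e e0.
have z0 : 0 < rnorm z + 1 by have := rnorm_ge0 z; lra.
have [A AP] := uw _ (divr_gt0 e0 z0); exists A => B /AP H1.
rewrite -hdot_suml -hdotBl; apply: (le_lt_trans (cauchy_schwarz _ _)).
apply: (@le_lt_trans _ _ (rnorm (w - \sum_(n <- B) u n) * (rnorm z + 1))).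
  by rewrite ler_wpM2l ?rnorm_ge0 // lerDl.
by rewrite -ltr_pdivlMr.
Qed.

Lemma cvg_totally_unitary (H' : hilbert R) (U : H -> H') (u : int -> H) w : unitary U ->
  \sum_(n <- (A : {fset int})) u n @[A --> totally] --> w ->
  \sum_(n <- (A : {fset int})) U (u n) @[A --> totally] --> U w.
Proof.
move=> uU /cvg_totally uw; apply/cvg_totally => e /uw [A AP]; exists A => B /AP.
by rewrite -(unitary_sum uU) -(unitaryB uU) (unitary_rnorm uU).
Qed.

Lemma cvg_totally_single (V : normedModType R[i]) (u : int -> V) (n0 : int) w :
  \sum_(n <- (A : {fset int})) u n @[A --> totally] --> w ->
  (forall n, n != n0 -> u n = 0) -> w = u n0.
Proof.
move=> /cvg_totally uw u0; apply: (@small_rnorm_eq R V _ _ 1) => // e e0.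
have [A AP] := uw e e0; have := AP (n0 |` A)%fset (fsubsetU1 _ _).
rewrite (bigD1_seq n0) ?fset_uniq ?fset1U1 //= big1 // addr0 mul1r; exact: ltW.
Qed.

End TotalSums.

(** * Unitaries that match the Moebius representations *)

Section RepFacts.
Variables (R : realType) (c : R) (H : hilbert R) (V : circle_map R -> H -> H).
Variables (Ut : {uniform R -> R} -> H -> H) (L : int -> set (H * H)) (Om : H).
Hypothesis vr : virasoro_rep c V Ut L Om.
Local Notation D := (finite_energy (L 0)).
Local Notation G := (energy_group Ut).
Local Notation l n := (app (L n)).

Let M := virasoro_vacuum_module vr.

Lemma stress_degree1 (f : circle R -> R) (A b1 b2 : R) x :
  (forall t, f (cis t) = A + 2 * (b1 * cos t - b2 * sin t)) -> D x ->
  stress L D f (x, A%:C *: l 0 x + (b1 +i* b2) *: l 1 x + (b1 -i* b2) *: l (-1) x).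
Proof.
move=> fE Dx; apply: subset_closure; split=> //=; apply/cvg_totally => e e0.
exists [fset 0; 1; -1]%fset => B /fsubsetP AB.
rewrite (_ : \sum_(n <- B) _ = A%:C *: l 0 x + (b1 +i* b2) *: l 1 x + (b1 -i* b2) *: l (-1) x).
  by rewrite subrr rnorm0.
have fn n := fourier_degree1 n fE.
rewrite (bigID (fun n : int => n \in [:: 0; 1; -1])) /= [X in _ + X]big1 ?addr0; last first.
  move=> n; rewrite !inE fn => /norP[/negbTE -> /norP[/negbTE -> /negbTE ->]].
  by rewrite scale0r.
rewrite -big_filter (perm_big [:: 0; 1; -1]) /=; last first.
  apply: uniq_perm => // [|n]; first by rewrite filter_uniq ?fset_uniq.
  rewrite mem_filter; apply: andb_idr => n3; apply: AB.
  by move: n3; rewrite !inE orbA.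
by rewrite !big_cons big_nil addr0 !fn /= addrA.
Qed.

(** Fixing the vacuum removes the phase. *)
Lemma mobius_group_rep (U : circle_map R -> H -> H) (E : R -> H -> H)
    (F : R -> circle R -> circle R) : unitary_group E -> generator E (Om, 0) ->
  (forall t, mob (F t)) -> (forall t, up_to_phase (E t) (V (F t))) ->
  (forall g, mob g -> up_to_phase (U g) (V g)) -> (forall g, mob g -> U g Om = Om) ->
  forall t x, E t x = U (F t) x.
Proof.
move=> gE EOm mF EV UV UOm t x; apply: (@phase_fix _ _ _ _ Om).
- exact: phase_trans (EV t) (phase_sym (UV _ (mF t))).
- have := @group_eigen _ _ E 0 Om gE; rewrite scale0r => /(_ EOm t).
  by rewrite mul0r expi0 scale1r.
- exact: UOm.
- by rewrite (vm_unit M) oner_eq0.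
Qed.

Lemma energy_vacuum_generator : generator G (Om, 0).
Proof.
have M0 := vm_vacuum0 M; rewrite (energy_group_generator vr) -M0.
exact: (mode_dom_graph vr 0 (vm_vacuum M)).
Qed.

End RepFacts.

Section MobiusIntertwining.
Variables (R : realType) (c1 c2 : R) (H1 H2 : hilbert R).
Variables (V1 : circle_map R -> H1 -> H1) (V2 : circle_map R -> H2 -> H2).
Variables (Ut1 : {uniform R -> R} -> H1 -> H1) (Ut2 : {uniform R -> R} -> H2 -> H2).
Variables (L1 : int -> set (H1 * H1)) (L2 : int -> set (H2 * H2)) (Om1 : H1) (Om2 : H2).
Hypothesis vr1 : virasoro_rep c1 V1 Ut1 L1 Om1.
Hypothesis vr2 : virasoro_rep c2 V2 Ut2 L2 Om2.
Variables (U1 : circle_map R -> H1 -> H1) (U2 : circle_map R -> H2 -> H2).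
Hypothesis UV1 : forall g, mob g -> up_to_phase (U1 g) (V1 g).
Hypothesis UV2 : forall g, mob g -> up_to_phase (U2 g) (V2 g).
Hypothesis UOm1 : forall g, mob g -> U1 g Om1 = Om1.
Hypothesis UOm2 : forall g, mob g -> U2 g Om2 = Om2.
Variable W : H1 -> H2.
Hypothesis uW : unitary W.
Hypothesis WU : forall g, mob g -> forall x, W (U1 g x) = U2 g (W x).

Lemma mobius_group_intertwine (E1 : R -> H1 -> H1) (E2 : R -> H2 -> H2)
    (F : R -> circle R -> circle R) : unitary_group E1 -> unitary_group E2 ->
  generator E1 (Om1, 0) -> generator E2 (Om2, 0) -> (forall t, mob (F t)) ->
  (forall t, up_to_phase (E1 t) (V1 (F t))) -> (forall t, up_to_phase (E2 t) (V2 (F t))) ->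
  (forall t x, W (E1 t x) = E2 t (W x)) /\
  (forall x y, generator E1 (x, y) -> generator E2 (W x, W y)).
Proof.
move=> gE1 gE2 EOm1 EOm2 mF EV1 EV2.
have int t x : W (E1 t x) = E2 t (W x).
  rewrite (mobius_group_rep vr1 gE1 EOm1 mF EV1 UV1 UOm1).
  by rewrite (mobius_group_rep vr2 gE2 EOm2 mF EV2 UV2 UOm2) WU.
by split=> // x y; exact: generator_intertwine.
Qed.

Lemma mobius_energy_intertwine :
  (forall t x, W (energy_group Ut1 t x) = energy_group Ut2 t (W x)) /\
  (forall x y, L1 0 (x, y) -> L2 0 (W x, W y)).
Proof.
rewrite -(energy_group_generator vr1) -(energy_group_generator vr2).
apply: (@mobius_group_intertwine _ _ (@rot R)).
- exact: energy_group_unitary vr1.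
- exact: energy_group_unitary vr2.
- exact: energy_vacuum_generator vr1.
- exact: energy_vacuum_generator vr2.
- exact: mob_rot.
- exact: energy_group_rot vr1.
- exact: energy_group_rot vr2.
Qed.

Lemma mobius_dom x : finite_energy (L1 0) x -> finite_energy (L2 0) (W x).
Proof. exact: (energy_intertwine_dom vr1 uW mobius_energy_intertwine.2). Qed.

Lemma mobius_mode0 x : finite_energy (L1 0) x -> W (app (L1 0) x) = app (L2 0) (W x).
Proof.
move=> Dx; apply/esym/(mode_app vr2)/mobius_energy_intertwine.2.
exact: (mode_dom_graph vr1).
Qed.

(** The fields A + 2 Re (B z) generate conjugates of the rotation group by Moebius maps;
    their exponentials fix the vacuum, which leaves no phase, so that W intertwines
    them. *)
Lemma mobius_field (a1 a2 b1 b2 : R) (p := a1 * b1 + a2 * b2) (q := a2 * b1 - a1 * b2) :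
  a1 ^+ 2 + a2 ^+ 2 - (b1 ^+ 2 + b2 ^+ 2) = 1 -> forall x, finite_energy (L1 0) x ->
  (p +i* q) *: W (app (L1 1) x) + (p -i* q) *: W (app (L1 (-1)) x) =
  (p +i* q) *: app (L2 1) (W x) + (p -i* q) *: app (L2 (-1)) (W x).
Proof.
move=> ab1 x Dx; pose a : R[i] := a1 +i* a2; pose b : R[i] := b1 +i* b2.
have ab : `|a| ^+ 2 - `|b| ^+ 2 = 1 by rewrite -!add_Re2_Im2 /= -rmorphB /= ab1.
have ab' : `|a^*| ^+ 2 - `|- b| ^+ 2 = 1 by rewrite norm_conjC normrN.
have [g gab] := mobius_exists ab; have [h hab] := mobius_exists ab'.
have mg : mob g by apply/mobius_ofP; exists a, b.
have mh : mob h by apply/mobius_ofP; exists a^*, (- b).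
have [gh hg] := mobius_of_inv gab hab.
have [e le gE] := lift_of_diff_plus (mob_diff_plus mg).
have [e' [le' ee' e'e de']] := lift_inverse le.
have hE : h = circle_of_lift e'.
  apply/funext => z; rewrite -{2}(hg z) gE -(angleK (h z)) !circle_of_lift_cis //.
  by rewrite e'e.
pose A : R := a1 ^+ 2 + a2 ^+ 2 + b1 ^+ 2 + b2 ^+ 2.
have fE t : lift_field e (cis t) = A + 2 * (p * cos t - q * sin t).
  rewrite lift_field_cis // (@mobius_lift_derive _ a b) -?gE //.
  have -> : b^* * expi t + a^* = (b1 * cos t + b2 * sin t + a1) +i* (b1 * sin t - b2 * cos t - a2).
    by apply/eqP; rewrite eq_complex /=; apply/andP; split; apply/eqP; ring.
  rewrite -add_Re2_Im2 /= /A /p /q; have cs := cos2Dsin2 t.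
  transitivity ((b1 ^+ 2 + b2 ^+ 2) * (cos t ^+ 2 + sin t ^+ 2) + a1 ^+ 2 + a2 ^+ 2
    + 2 * ((a1 * b1 + a2 * b2) * cos t - (a2 * b1 - a1 * b2) * sin t)); first by ring.
  by rewrite cs; ring.
have mF t : mob (lift_flow e' e t).
  rewrite lift_flowE // -gE -hE; apply: mob_comp => //; apply: mob_comp => //.
  exact: mob_rot.
have fl r := time_one_lift_flow r le' le e'e de'.
have sf := smooth_lift_field le.
have [E1 [gE1 G1 EV1]] := stress_group vr1 sf fl.
have [E2 [gE2 G2 EV2]] := stress_group vr2 sf fl.
have vac (c : R) (H : hilbert R) V Ut L (Om : H) : virasoro_rep c V Ut L Om ->
    stress L (finite_energy (L 0)) (lift_field e) (Om, 0).
  move=> vr; have M := virasoro_vacuum_module vr.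
  have := stress_degree1 fE (vm_vacuum M).
  rewrite (vm_vacuum0 M) (vm_annihil M (isT : (0 : int) < 1)) (vm_vacuumN1 M).
  by rewrite !scaler0 !addr0.
have v1 := vac _ _ _ _ _ _ vr1; have v2 := vac _ _ _ _ _ _ vr2.
rewrite -G1 in v1; rewrite -G2 in v2.
have [_ int] := mobius_group_intertwine gE1 gE2 v1 v2 mF EV1 EV2.
have T1 := stress_degree1 fE Dx; have T2 := stress_degree1 fE (mobius_dom Dx).
rewrite -G1 in T1; rewrite -G2 in T2.
have := generator_unique gE2 (int _ _ T1) T2.
rewrite !(unitaryD uW) !(unitaryZ uW) mobius_mode0 // -!addrA; exact: addrI.
Qed.

(** The maps with parameters a = sqrt 2 and b = 1 or i give two independent combinations
    of the modes 1 and - 1. *)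
Lemma mobius_modeN1 x : finite_energy (L1 0) x ->
  W (app (L1 (-1)) x) = app (L2 (-1)) (W x).
Proof.
move=> Dx; pose s : R := Num.sqrt 2.
have s2 : s ^+ 2 = 2 by rewrite sqr_sqrtr.
have s0 : s != 0 by rewrite gt_eqF // sqrtr_gt0.
have := @mobius_field s 0 1 0 _ x Dx; have := @mobius_field s 0 0 1 _ x Dx.
rewrite !expr0n !expr1n s2 !(mulr0, mul0r, mulr1, addr0, subr0, add0r, sub0r) /=.
move: (W (app (L1 1) x)) (W (app (L1 (-1)) x)) (app (L2 1) (W x)) (app (L2 (-1)) (W x)).
move=> u v u' v' /(_ ltac:(lra)) E2 /(_ ltac:(lra)) E1.
have sC : s%:C != 0 :> R[i] by apply/eqP => /complexI /eqP; rewrite (negbTE s0).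
have F1 : u + v = u' + v'.
  apply: (scalerI sC); rewrite !scalerDr.
  have -> : s%:C = s +i* 0 by [].
  by move: E1; rewrite oppr0.
have F2 : v - u = v' - u'.
  have siC : s%:C * 'i != 0 :> R[i] by rewrite mulf_neq0 // -normr_eq0 norm_i oner_eq0.
  apply: (scalerI siC); rewrite !scalerBr.
  have -> : s%:C * 'i = 0 +i* s by apply/eqP; rewrite eq_complex /=; apply/andP; split; apply/eqP; ring.
  move: E2; rewrite opprK.
  have -> : 0 +i* (- s) = - (0 +i* s) :> R[i] by apply/eqP; rewrite eq_complex /= oppr0 !eqxx.
  by rewrite !scaleNr ![- _ + _]addrC.
have : v + v = v' + v'.
  by have := congr2 +%R F2 F1; rewrite !addrA !subrK.
move=> E; apply: (@scalerI _ _ (1 + 1 : R[i])); first by rewrite -[1 + 1]/(2%:R) pnatr_eq0.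
by rewrite !scalerDl !scale1r.
Qed.

End MobiusIntertwining.

(** * Locality *)

Lemma bumped_flow (R : realType) : exists (g : circle R -> R) (F : R -> circle R -> circle R),
  [/\ forall t, g (cis t) = bumped t,
      forall r, time_one_flow (fun z => r * g z) (F r),
      forall r, diff_plus (F r) &
      forall r z, `|r| <= 1 / 20 -> - (3 / 4) <= complex.Re (cval z) ->
        F r (rot (- r) z) = z].
Proof.
have [b [C [C0 lb db]]] := bumped_lift R; have [a [la ba ab da]] := lift_inverse lb.
exists (fun z => C * lift_field b z), (fun r => lift_flow a b (C * r)); split.
- by move=> t; rewrite lift_field_cis // db invf_div mulrC divfK // gt_eqF.
- move=> r; have := time_one_lift_flow (C * r) la lb ab da.
  congr (time_one_flow _ _); apply/funext => z.
  by rewrite mulrA [r * C]mulrC.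
- by move=> r; apply: diff_plus_lift; exact: lift_flow_lift.
- by move=> r z; exact: bumped_flow_local.
Qed.

Lemma group_adjoint (R : realType) (H : hilbert R) (U : R -> H -> H) t x y :
  unitary_group U -> hdot (U t x) y = hdot x (U (- t) y).
Proof. by move=> gU; rewrite -{1}(groupKN gU t y) (unitary_hdot (group_unitary gU t)). Qed.

(** The derivative at s = 0 of the commutation of X with E s G (- s), paired with the
    vacuum and v: G does not move the vacuum, but both generators act on v. *)
Lemma local_pairing (R : realType) (H : hilbert R) (G E : R -> H -> H) (X : H -> H)
    (Om v a b w : H) (r : R) : unitary_group G -> unitary_group E ->
  dense (op_dom (generator G)) -> unitary X -> generator G (v, a) -> generator E (v, b) ->
  generator E (Om, w) -> 0 < r ->
  (forall s, `|s| < r -> X (E s Om) = E s (G (- s) (X Om))) ->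
  hdot (X w) v = hdot (X Om) (b - a).
Proof.
move=> gG gE dG uX Gv Ev EOm r0 XE.
have /(generatorP gE) dOm := EOm.
have d1 := has_deriv_hdotl v (has_deriv_isometry (unitaryZD uX) (unitary_rnorm uX) dOm).
have d2 := has_deriv_hdotr (X Om) (has_deriv_product gG gE dG Gv Ev).
have d3 := has_deriv_near r0 _ d1.
have := has_deriv_unique (d3 _ _) d2; move/(_ _); rewrite (unitaryZ uX) hdotZl hdotZr.
move=> E0; have {}E0 : 'i * hdot (X w) v = ('i)^* * hdot (X Om) (a - b).
  apply: E0 => s sr; rewrite XE // (group_adjoint _ _ _ gE) (group_adjoint _ _ _ gG).
  by rewrite opprK.
have i0 : 'i != 0 :> R[i] by rewrite -normr_eq0 norm_i oner_eq0.
apply: (mulfI i0); rewrite E0 -[b - a]opprB hdotNr mulrN -mulNr; congr (_ * _).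
by apply/eqP; rewrite eq_complex /= oppr0 !eqxx.
Qed.

Section PhaseProducts.
Variables (R : realType) (c : R) (H : hilbert R) (V : circle_map R -> H -> H).
Variables (Ut : {uniform R -> R} -> H -> H) (L : int -> set (H * H)) (Om : H).
Hypothesis vr : virasoro_rep c V Ut L Om.

Lemma rep_comp_phase u w g h : diff_plus g -> diff_plus h ->
  up_to_phase u (V g) -> up_to_phase w (V h) -> up_to_phase (u \o w) (V (g \o h)).
Proof.
move=> dg dh ug wh; have [uV VM _] := vir_proj_rep vr.
exact: phase_trans (phase_comp (uV g dg) ug wh) (phase_sym (VM g h dg dh)).
Qed.

End PhaseProducts.

Section LocalRelation.
Variables (R : realType) (c1 c2 : R) (H1 H2 : hilbert R).
Variables (V1 : circle_map R -> H1 -> H1) (V2 : circle_map R -> H2 -> H2).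
Variables (Ut1 : {uniform R -> R} -> H1 -> H1) (Ut2 : {uniform R -> R} -> H2 -> H2).
Variables (L1 : int -> set (H1 * H1)) (L2 : int -> set (H2 * H2)) (Om1 : H1) (Om2 : H2).
Hypothesis vr1 : virasoro_rep c1 V1 Ut1 L1 Om1.
Hypothesis vr2 : virasoro_rep c2 V2 Ut2 L2 Om2.
Variables (W : H1 -> H2) (W' : H2 -> H1).
Hypotheses (uW : unitary W) (uW' : unitary W') (WK : cancel W W') (KW : cancel W' W).
Hypothesis WG : forall t x, W (energy_group Ut1 t x) = energy_group Ut2 t (W x).
Local Notation G := (energy_group Ut1).

Definition locally_commute : Prop := forall (I J : set (circle R)) k k',
  is_arc I -> is_arc J -> I `&` J = set0 -> diff_plus k -> diff_plus k' ->
  (forall z, opposite I z -> k z = z) -> (forall z, opposite J z -> k' z = z) ->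
  forall x, V1 k (W' (V2 k' (W x))) = W' (V2 k' (W (V1 k x))).
Hypothesis comm : locally_commute.

Variables (F : R -> circle R -> circle R) (E1 : R -> H1 -> H1) (E2 : R -> H2 -> H2).
Hypothesis dF : forall r, diff_plus (F r).
Hypothesis locF : forall r z, `|r| <= 1 / 20 -> - (3 / 4) <= complex.Re (cval z) ->
  F r (rot (- r) z) = z.
Hypotheses (gE1 : unitary_group E1) (gE2 : unitary_group E2).
Hypotheses (EV1 : forall r, up_to_phase (E1 r) (V1 (F r)))
           (EV2 : forall r, up_to_phase (E2 r) (V2 (F r))).

(** A rotated copy of E r G (- r), localized in a cap around the angle pi + al. *)
Definition rotated_local (al r : R) : H1 -> H1 := G al \o E1 r \o G (- r) \o G (- al).

Lemma transported_group : unitary_group (fun t x => W' (E2 t (W x))).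
Proof.
split=> [t|s t x]; last by rewrite KW (groupD gE2).
exact: unitary_comp uW' (unitary_comp (group_unitary gE2 t) uW).
Qed.

Lemma rotated_local_unitary al r : unitary (rotated_local al r).
Proof.
have gG := energy_group_unitary vr1.
have uG t := group_unitary gG t.
exact: unitary_comp (unitary_comp (unitary_comp (uG al) (group_unitary gE1 r)) (uG _)) (uG _).
Qed.

(** At a distance of at least a quarter turn, the rotated copies of E r G (- r) and
    E s G (- s) are localized in disjoint arcs and commute. *)
Lemma local_commutation (al r s : R) x : cos al <= 0 -> `|r| <= 1 / 20 -> `|s| <= 1 / 20 ->
  rotated_local al r (W' (E2 s (W (G (- s) x)))) =
  W' (E2 s (W (G (- s) (rotated_local al r x)))).
Proof.
move=> cal r1 s1.
have dr t := @diff_plus_rot R t.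
pose k := rot al \o F r \o rot (- r) \o rot (- al).
pose k' := F s \o rot (- s).
have d2 := diff_plus_comp (dr al) (dF r); have d3 := diff_plus_comp d2 (dr (- r)).
have dk : diff_plus k := diff_plus_comp d3 (dr (- al)).
have dk' : diff_plus k' := diff_plus_comp (dF s) (dr (- s)).
have e1 t := energy_group_rot vr1 t.
have p2 := rep_comp_phase vr1 (dr al) (dF r) (e1 al) (EV1 r).
have p3 := rep_comp_phase vr1 d2 (dr (- r)) p2 (e1 (- r)).
have [m [m1 Xk]] := rep_comp_phase vr1 d3 (dr (- al)) p3 (e1 (- al)).
have [m' [m'1 Ak]] := rep_comp_phase vr2 (dF s) (dr (- s)) (EV2 s) (energy_group_rot vr2 (- s)).
have {}Xk y : rotated_local al r y = m *: V1 k y := Xk y.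
have {}Ak y : E2 s (W (G (- s) y)) = m' *: V2 k' (W y) by rewrite WG; exact: Ak (W y).
have [uV1 _ _] := vir_proj_rep vr1; have [uV2 _ _] := vir_proj_rep vr2.
rewrite !Ak !Xk !(unitaryZ uW') (unitaryZ uW) (unitaryZ (uV1 k dk)) (unitaryZ (uV2 k' dk')).
rewrite (unitaryZ uW') !scalerA mulrC; congr (_ *: _).
apply: (@comm (cap (pi + al) (3 / 4)) (cap pi (3 / 4))) => //.
- by apply: cap_arc; lra.
- by apply: cap_arc; lra.
- by apply: cap_disjoint; rewrite addrAC subrr add0r.
- move=> z /opposite_cap zI; rewrite /k /= locF //; first by rewrite rotD subrr rot0.
  have -> : cval (rot (- al) z) = - (expi (- (pi + al)) * cval z).
    rewrite opprD expiD (_ : expi (- pi) = -1) ?mulN1r ?mulNr ?opprK //.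
    by rewrite /expi cosN sinN cospi sinpi oppr0; apply/eqP; rewrite eq_complex /= oppr0 !eqxx.
  by rewrite raddfN lerN2.
- move=> z /opposite_cap zI; apply: locF => //; move: zI.
  have -> : expi (- pi) = -1 :> R[i].
    by rewrite /expi cosN sinN cospi sinpi oppr0; apply/eqP; rewrite eq_complex /= oppr0 !eqxx.
  by rewrite mulN1r raddfN lerNl.
Qed.

(** What local_pairing extracts from local_commutation, for the stress tensor brought
    from the second representation by W. *)
Lemma local_relation (al r : R) v a b w : cos al <= 0 -> `|r| <= 1 / 20 ->
  L1 0 (v, a) -> generator E2 (W v, W b) -> generator E2 (W Om1, W w) ->
  hdot (rotated_local al r w) v = hdot (rotated_local al r Om1) (b - a).
Proof.
move=> cal r1 va vb Ow; have gG := energy_group_unitary vr1.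
have gen x y : generator E2 (W x, W y) -> generator (fun t x => W' (E2 t (W x))) (x, y).
  rewrite -{2}[x]WK -{2}[y]WK; apply: generator_intertwine => //.
    exact: transported_group.
  by move=> t z; rewrite KW.
have r20 : 0 < 1 / 20 :> R by lra.
apply: (local_pairing gG transported_group _ (rotated_local_unitary al r) _ (gen _ _ vb)
  (gen _ _ Ow) r20).
- rewrite (energy_group_generator vr1).
  apply: rnorm_dense => x e e0; have [y Dy xy] := dense_rnorm (vir_dense vr1) x e0.
  by exists y => //; exists (y, app (L1 0) y) => //; exact: (mode_dom_graph vr1).
- by rewrite (energy_group_generator vr1).
- move=> s sr; rewrite -{1}(energy_group_vacuum vr1 (- s)); apply: local_commutation => //.
  exact: ltW.
Qed.

End LocalRelation.

(** * The central charge *)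

Lemma cvg_totally_unique (R : realType) (H : hilbert R) (u : {fset int} -> H) (x y : H) :
  u A @[A --> totally] --> x -> u A @[A --> totally] --> y -> x = y.
Proof.
move=> /cvg_totally ux /cvg_totally uy; apply: (@small_rnorm_eq R H _ _ 2) => // e e0.
have [A AP] := ux e e0; have [B BP] := uy e e0.
have := AP (A `|` B)%fset (fsubsetUl _ _); have := BP (A `|` B)%fset (fsubsetUr _ _).
by have := rnorm_dist x (u (A `|` B)%fset) y; rewrite (rnormBC (u _) y); lra.
Qed.

(** The mode n lowers the energy by n, and eigenvectors for distinct energies are
    orthogonal. *)
Lemma mode_orthogonal (R : realType) (H : hilbert R) (D : set H) l (c : R) (Om v : H) (r : R)
    (n : int) : vacuum_module D l c Om -> D v -> l 0 v = r%:C *: v -> n != 0 ->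
  hdot (l n v) v = 0.
Proof.
move=> M Dv E n0; have Dn := vm_stable M n Dv.
have := vm_adjoint M 0 Dn Dv; rewrite oppr0 (vm_energy M n Dv E) E hdotZl hdotZr conj_real.
move=> /eqP; rewrite -subr_eq0 -mulrBl mulf_eq0 rmorphB /= addrAC subrr add0r oppr_eq0.
by move=> /orP[/eqP/complexI/eqP|/eqP //]; rewrite intr_eq0 (negbTE n0).
Qed.

Lemma mode_energy_pairing (R : realType) (H : hilbert R) (D : set H) l (c : R) (Om v w : H)
    (r : R) (f : int -> R[i]) : vacuum_module D l c Om -> D v -> l 0 v = r%:C *: v ->
  \sum_(n <- (A : {fset int})) f n *: l n v @[A --> totally] --> w ->
  hdot w v = f 0 * r%:C * hdot v v.
Proof.
move=> M Dv E /(cvg_totally_hdot (z := v)) fw; rewrite (cvg_totally_single (n0 := 0) fw).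
  by rewrite E !hdotZl mulrA.
by move=> n n0; rewrite hdotZl (mode_orthogonal M Dv E n0) mulr0.
Qed.

Section CentralCharge.
Variables (R : realType) (c1 c2 : R) (H1 H2 : hilbert R).
Variables (V1 : circle_map R -> H1 -> H1) (V2 : circle_map R -> H2 -> H2).
Variables (Ut1 : {uniform R -> R} -> H1 -> H1) (Ut2 : {uniform R -> R} -> H2 -> H2).
Variables (L1 : int -> set (H1 * H1)) (L2 : int -> set (H2 * H2)) (Om1 : H1) (Om2 : H2).
Hypothesis vr1 : virasoro_rep c1 V1 Ut1 L1 Om1.
Hypothesis vr2 : virasoro_rep c2 V2 Ut2 L2 Om2.
Variables (U1 : circle_map R -> H1 -> H1) (U2 : circle_map R -> H2 -> H2).
Hypothesis UV1 : forall g, mob g -> up_to_phase (U1 g) (V1 g).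
Hypothesis UV2 : forall g, mob g -> up_to_phase (U2 g) (V2 g).
Hypothesis UOm1 : forall g, mob g -> U1 g Om1 = Om1.
Hypothesis UOm2 : forall g, mob g -> U2 g Om2 = Om2.
Variables (W : H1 -> H2) (W' : H2 -> H1) (m : R[i]).
Hypotheses (uW : unitary W) (uW' : unitary W') (WK : cancel W W') (KW : cancel W' W).
Hypothesis WU : forall g, mob g -> forall x, W (U1 g x) = U2 g (W x).
Hypotheses (m1 : `|m| = 1) (WOm : W Om1 = m *: Om2).
Local Notation D1 := (finite_energy (L1 0)).
Local Notation D2 := (finite_energy (L2 0)).
Local Notation G := (energy_group Ut1).

Lemma transported_dom : [set x | D2 (W x)] = D1.
Proof.
have W'U g : mob g -> forall x, W' (U2 g x) = U1 g (W' x).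
  by move=> mg x; apply: (unitary_inj uW); rewrite KW WU // KW.
apply/seteqP; split=> x /= Dx; last exact: (mobius_dom vr1 vr2 UV1 UV2 UOm1 UOm2 uW WU).
by rewrite -[x]WK; exact: (mobius_dom vr2 vr1 UV2 UV1 UOm2 UOm1 uW' W'U).
Qed.

Lemma transported_module : vacuum_module D1 (fun n x => W' (app (L2 n) (W x))) c2 Om1.
Proof.
rewrite -transported_dom.
exact: vacuum_module_transport uW uW' WK KW m1 WOm (virasoro_vacuum_module vr2).
Qed.

(** With T and T' the stress tensors of the localized field g, and lam the ratio of
    T' Om and T Om, locality makes the rotated vectors T Om orthogonal to
    y = (T' - L0) v - conj(lam) (T - L0) v for half of the angles. As functions of the
    angle these pairings are power series, so that every coefficient vanishes; the one
    of v = L(-2) Om is a nonzero multiple of (1 - conj(lam)). *)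
Lemma central_charge_eq : 0 < c1 -> locally_commute V1 V1 id id ->
  locally_commute V1 V2 W W' -> c1 = c2.
Proof.
move=> c10 comm1 comm2.
have M1 := virasoro_vacuum_module vr1; have M2 := transported_module.
set l1 : int -> H1 -> H1 := fun n => app (L1 n) in M1.
set l2 : int -> H1 -> H1 := fun n x => _ in M2.
have [WG WL0] := mobius_energy_intertwine vr1 vr2 UV1 UV2 UOm1 UOm2 uW WU.
have [lam lamE] : exists a, forall n : int, l2 n Om1 = (if n <= -2 then a else 1) *: l1 n Om1.
  apply: (modes_proportional M1 M2 (words_dense vr1) c10) => x Dx; rewrite /l2.
    by rewrite -(mobius_mode0 vr1 vr2 UV1 UV2 UOm1 UOm2 uW WU) // WK.
  by rewrite -(mobius_modeN1 vr1 vr2 UV1 UV2 UOm1 UOm2 uW WU) // WK.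
have DOm := vm_vacuum M1; pose v := l1 (-2) Om1.
have Dv : D1 v := vm_stable M1 (-2) DOm.
have E1v : l1 0 v = 2%:C *: v.
  have := vm_energy M1 (-2) DOm (r := 0); rewrite scale0r => -> //; last exact: vm_vacuum0 M1.
  by rewrite sub0r mulrNz opprK.
have E2v : l2 0 v = 2%:C *: v.
  by rewrite /l2 -(mobius_mode0 vr1 vr2 UV1 UV2 UOm1 UOm2 uW WU) // WK.
have [g [F [gE fl dF locF]]] := bumped_flow R.
have sg : Csmooth (g \o @cis R).
  by rewrite (_ : _ \o _ = @bumped R); [exact: bumped_smooth|exact/funext].
have [f0 f2] := fourier_bumped gE.
have [e1 [ge1 G1 eV1]] := stress_group vr1 sg fl.
have [e2 [ge2 G2 eV2]] := stress_group vr2 sg fl.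
have core1 x : D1 x -> exists2 w, generator e1 (x, w) &
    \sum_(n <- (A : {fset int})) fourier g n *: l1 n x @[A --> totally] --> w.
  move=> Dx; have [w xw] := vir_stress_cvg vr1 (CsmoothW sg) Dx.
  by exists w; [rewrite G1; exact: subset_closure|exact: xw.2].
have core2 x : D1 x -> exists2 w, generator e2 (W x, W w) &
    \sum_(n <- (A : {fset int})) fourier g n *: l2 n x @[A --> totally] --> w.
  rewrite -{1}transported_dom => Dx; have [w xw] := vir_stress_cvg vr2 (CsmoothW sg) Dx.
  exists (W' w); first by rewrite KW G2; exact: subset_closure.
  have /cvg_totally H0 := cvg_totally_unitary uW' xw.2; apply/cvg_totally => e /H0 [A AP].
  exists A => B /AP; congr (rnorm (_ - _) < e); apply: eq_bigr => n _.
  by rewrite (unitaryZ uW').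
have [w1 gw1 cw1] := core1 _ DOm; have [w2 gw2 cw2] := core2 _ DOm.
have [t1 gt1 ct1] := core1 _ Dv; have [t2 gt2 ct2] := core2 _ Dv.
(* Only the modes of index at most - 2 contribute to either vector. *)
have w21 : w2 = lam *: w1.
  apply: (cvg_totally_unique cw2); apply/cvg_totally => e e0.
  have lam1 : 0 < cnorm lam + 1 by have := cnorm_ge0 lam; lra.
  have [A AP] := (cvg_totally _ _).1 cw1 _ (divr_gt0 e0 lam1); exists A => B /AP H0.
  rewrite (_ : \sum_(n <- B) _ = lam *: \sum_(n <- B) fourier g n *: l1 n Om1).
    rewrite -scalerBr rnormZ.
    apply: (@le_lt_trans _ _ ((cnorm lam + 1) * rnorm (w1 - \sum_(n <- B) fourier g n *: l1 n Om1))).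
      by rewrite ler_wpM2r ?rnorm_ge0 // lerDl.
    by rewrite mulrC -ltr_pdivlMr.
  rewrite scaler_sumr; apply: eq_bigr => n _; rewrite lamE; case: ifP => n2.
    by rewrite !scalerA mulrC.
  suff -> : l1 n Om1 = 0 by rewrite !scaler0.
  have [n0|n0] := ltP 0 n; first exact: (vm_annihil M1 n0).
  have [->|n1] := eqVneq n 0; first exact: (vm_vacuum0 M1).
  by have -> : n = -1 by [lia]; exact: (vm_vacuumN1 M1).
pose y := (t2 - l1 0 v) - lam^* *: (t1 - l1 0 v).
have Lv := mode_dom_graph vr1 0 Dv.
have ortho al r : cos al <= 0 -> `|r| <= 1 / 20 -> hdot (rotated_local Ut1 e1 al r Om1) y = 0.
  move=> cal r1.
  have R1 := local_relation vr1 vr1 (@unitary_id _ _) (@unitary_id _ _) (fun _ => erefl)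
    (fun _ => erefl) (fun _ _ => erefl) comm1 dF locF ge1 ge1 eV1 eV1 cal r1 Lv gt1 gw1.
  have R2 := local_relation vr1 vr2 uW uW' WK KW WG comm2 dF locF ge1 ge2 eV1 eV2 cal r1 Lv gt2 gw2.
  rewrite /y hdotBr -R2 hdotZr conjCK -R1 w21.
  by rewrite (unitaryZ (rotated_local_unitary vr1 ge1 al r)) hdotZl subrr.
have gG := energy_group_unitary vr1.
(* Derivation in r at 0. *)
have perp al : cos al <= 0 -> hdot (G al w1) y = 0.
  move=> cal; have uG := group_unitary gG al.
  have /(generatorP ge1) d1 := gw1.
  have d2 := has_deriv_hdotl y (has_deriv_isometry (unitaryZD uG) (unitary_rnorm uG) d1).
  have r20 : 0 < 1 / 20 :> R by lra.
  have d3 := has_deriv_near r20 _ d2.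
  have := has_deriv_unique (d3 (fun=> 0) _) (@has_deriv_cst _ (R[i])^o 0 0).
  rewrite (unitaryZ uG) hdotZl => H0.
  have /eqP : 'i * hdot (G al w1) y = 0.
    apply: H0 => s sr; have := ortho al s cal (ltW sr).
    by rewrite /rotated_local /= !(energy_group_vacuum vr1).
  by rewrite mulf_eq0 -[_ == 0 as X in X || _]normr_eq0 norm_i oner_eq0 => /eqP.
pose c (k : nat) := fourier g (- k%:Z) * hdot (l1 (- k%:Z) Om1) y.
have c0 : forall k, c k = 0.
  apply: half_circle_uniqueness.
    move=> e e0; have := cvg_totally_hdot (z := y) cw1 => cy.
    have [n n0|N [_ NP]] := one_sided_sums cy _ e0.
      by rewrite (vm_annihil M1 n0) scaler0 hdot0l.
    exists N => s us sN; have := NP s us sN; congr (rnorm _ <= _).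
    by apply: eq_bigr => k _; rewrite hdotZl.
  move=> t ct e e0; have := cvg_totally_hdot (z := y) (cvg_totally_unitary (group_unitary gG t) cw1).
  rewrite perp // => cy.
  have uG := group_unitary gG t.
  have [n n0|N [NP _]] := one_sided_sums cy _ e0.
    by rewrite (vm_annihil M1 n0) scaler0 (unitary0 uG) hdot0l.
  exists N => K /NP; rewrite sub0r rnormN; congr (rnorm _ <= _).
  apply: eq_bigr => k _; rewrite (unitaryZ uG) (energy_group_mode vr1) //.
  rewrite (energy_group_vacuum vr1) !hdotZl mulrNz mulNr opprK.
  by rewrite mulrCA [RHS]mulrC.
(* The coefficient of exp (2 i t) in the series. *)
have vy : hdot y v = 0.
  have := c0 2%N; rewrite /c => /eqP; rewrite mulf_eq0 (negbTE f2) /= => /eqP E.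
  by rewrite hdotC E rmorph0.
have vv : hdot v v = (c1 / 12 * 6)%:C.
  by have := vm_norm_mode M1 (isT : (1 : int) < 2).
have vv0 : hdot v v != 0.
  by rewrite vv; apply/eqP => /complexI /eqP; rewrite gt_eqF // mulr_gt0 // divr_gt0.
have lam1 : lam = 1.
  move: vy; rewrite /y hdotBl hdotZl !hdotBl.
  rewrite (mode_energy_pairing M1 Dv E1v ct1) (mode_energy_pairing M2 Dv E2v ct2) E1v hdotZl.
  set q := fourier g 0; move=> E.
  have : (1 - lam^*) * ((q - 1) * 2%:C * hdot v v) = 0 by rewrite -[RHS]E; ring.
  have q0 : (q - 1) * 2%:C * hdot v v != 0.
    rewrite !mulf_neq0 // ?subr_eq0; first exact/eqP.
    by apply/eqP => /complexI /eqP; rewrite pnatr_eq0.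
  move=> /eqP; rewrite mulf_eq0 (negbTE q0) orbF subr_eq0 => /eqP E'.
  by rewrite -[lam]conjCK -E' rmorph1.
have := vm_norm_mode M2 (isT : (1 : int) < 2).
rewrite lamE /= lam1 scale1r -/v vv => /complexI.
rewrite -[((2 : int) ^+ 3 - 2)%:~R]/(6 : R); lra.
Qed.

End CentralCharge.

(** * Virasoro nets *)

Section OperatorAlgebras.
Variables (R : realType) (H1 H2 : hilbert R) (W : H1 -> H2) (W' : H2 -> H1).
Hypotheses (uW : unitary W) (uW' : unitary W') (WK : cancel W W') (KW : cancel W' W).

Lemma unitary_bounded (H : hilbert R) (u : H -> H) : unitary u -> bounded_op u.
Proof. by move=> uu; split; [case: uu|exact: unitary_continuous]. Qed.

Lemma bounded_conj (a : H1 -> H1) : bounded_op a -> bounded_op (W \o a \o W').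
Proof.
move=> [la ca]; split.
  by move=> r x y; rewrite /= (unitaryZD uW') la (unitaryZD uW).
move=> x; apply: continuous_comp; first exact: (unitary_continuous uW').
by apply: continuous_comp; [exact: ca|exact: (unitary_continuous uW)].
Qed.

Lemma commutant_conj (S1 : set (H1 -> H1)) (S2 : set (H2 -> H2)) (a : H1 -> H1) :
  (forall b2, S2 b2 -> exists b1 m, [/\ S1 b1, `|m| = 1 & forall x, W (b1 x) = m *: b2 (W x)]) ->
  commutant S1 a -> commutant S2 (W \o a \o W').
Proof.
move=> SS [ba ca]; split; first exact: bounded_conj.
move=> b2 /SS [b1 [m [Sb1 m1 bb]]]; apply/funext => y /=.
have m0 := norm1_neq0 m1.
have b2E x : b2 (W x) = m^-1 *: W (b1 x) by rewrite bb scalerA mulVf // scale1r.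
have aZ r x : a (r *: x) = r *: a x.
  have [la _] := ba; have a0 : a 0 = 0 by have := la (-1) 0 0; rewrite scaler0 addr0 scaleN1r addNr.
  by have := la r x 0; rewrite !addr0 a0 addr0.
rewrite b2E -{1}(KW y) b2E (unitaryZ uW') WK aZ (unitaryZ uW).
by have /= -> := congr1 (fun f => f (W' y)) (ca b1 Sb1).
Qed.

End OperatorAlgebras.

(** Phases do not affect commutants, so that the conjugation by W exchanges the
    commutants, and then the bicommutants. *)
Lemma bicommutant_conj (R : realType) (H1 H2 : hilbert R) (W : H1 -> H2) (W' : H2 -> H1)
    (S1 : set (H1 -> H1)) (S2 : set (H2 -> H2)) :
  unitary W -> unitary W' -> cancel W W' -> cancel W' W ->
  (forall b2, S2 b2 -> exists b1 m, [/\ S1 b1, `|m| = 1 & forall x, W (b1 x) = m *: b2 (W x)]) ->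
  (forall b1, S1 b1 -> exists b2 m, [/\ S2 b2, `|m| = 1 & forall x, W (b1 x) = m *: b2 (W x)]) ->
  (fun a => W \o a \o W') @` commutant (commutant S1) = commutant (commutant S2).
Proof.
move=> uW uW' WK KW S21 S12.
have S12' b1 : S1 b1 -> exists b2 m, [/\ S2 b2, `|m| = 1 & forall x, W' (b2 x) = m *: b1 (W' x)].
  move=> /S12 [b2 [m [Sb2 m1 bb]]]; exists b2, m^-1; split=> //; first by rewrite normfV m1 invr1.
  move=> x; apply: (unitary_inj uW); rewrite (unitaryZ uW) bb !KW scalerA mulVf ?scale1r //.
  exact: norm1_neq0.
have conj12 b : commutant S1 b -> commutant S2 (W \o b \o W') := commutant_conj uW uW' WK KW S21.
have conj21 b : commutant S2 b -> commutant S1 (W' \o b \o W) := commutant_conj uW' uW KW WK S12'.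
apply/seteqP; split=> [_ [a Sa <-]|a Sa].
  apply: (commutant_conj uW uW' WK KW _ Sa) => b2 Sb2.
  exists (W' \o b2 \o W), 1; split; [exact: conj21|exact: normr1|].
  by move=> x; rewrite /= KW scale1r.
exists (W' \o a \o W); last by apply/funext => x /=; rewrite !KW.
apply: (commutant_conj uW' uW KW WK _ Sa) => b1 Sb1.
exists (W \o b1 \o W'), 1; split; [exact: conj12|exact: normr1|].
by move=> x; rewrite /= WK scale1r.
Qed.

Definition local_maps (R : realType) (I : set (circle R)) : set (circle_map R) :=
  [set g | diff_plus g /\ forall z, opposite I z -> g z = z].

Lemma local_in_algebra (R : realType) (H : hilbert R) (V : circle_map R -> H -> H)
    (I : set (circle R)) g : proj_rep V -> local_maps I g ->
  commutant (commutant [set V h | h in local_maps I]) (V g).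
Proof.
move=> [uV _ _] Ig; split; first by apply: unitary_bounded; exact: uV Ig.1.
by move=> b [_ bV]; apply/esym/bV; exists g.
Qed.

Lemma same_charge_iso (R : realType) (c : R) (N1 N2 : mobius_net R) :
  is_virasoro_net c N1 -> is_virasoro_net c N2 -> net_iso N1 N2.
Proof.
move=> [V1 [Ut1 [L1 [vr1 A1 UV1]]]] [V2 [Ut2 [L2 [vr2 A2 UV2]]]].
have [W [uW WOm WV]] := virasoro_rep_unique vr1 vr2.
have [W' [uW' WK KW W'E]] := unitary_inv uW.
exists W; rewrite -W'E; split=> // [I aI|g mg].
  rewrite A1 // A2 //; apply: bicommutant_conj => // _ [g Ig <-].
    by have [m [m1 E]] := WV g Ig.1; exists (V1 g), m; split=> //; exists g.
  by have [m [m1 E]] := WV g Ig.1; exists (V2 g), m; split=> //; exists g.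
have dg := mob_diff_plus mg.
have [uU1 _ _] := net_mob_rep N1.
have uWUW : unitary (W \o net_rep N1 g \o W') by apply: unitary_comp uW'; apply: unitary_comp => //; exact: uU1.
apply/funext; apply: (phase_fix (x := net_vac N2)).
- have [m1 [n1 P1]] := UV1 g mg; have [m2 [n2 P2]] := WV g dg.
  have [m3 [n3 P3]] := phase_sym (UV2 g mg).
  exists (m1 * m2 * m3); split; first by rewrite !normrM n1 n2 n3 !mulr1.
  by move=> x; rewrite /= P1 (unitaryZ uW) P2 KW P3 !scalerA mulrA.
- by rewrite /= -{1}WOm WK net_vac_inv.
- exact: net_vac_inv.
- by rewrite (vm_unit (virasoro_vacuum_module vr2)) oner_eq0.
Qed.

Lemma iso_same_charge (R : realType) (c1 c2 : R) (N1 N2 : mobius_net R) : 0 < c1 ->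
  is_virasoro_net c1 N1 -> is_virasoro_net c2 N2 -> net_iso N1 N2 -> c1 = c2.
Proof.
move=> c10 [V1 [Ut1 [L1 [vr1 A1 UV1]]]] [V2 [Ut2 [L2 [vr2 A2 UV2]]]] [W [uW WA WU]].
have [W' [uW' WK KW W'E]] := unitary_inv uW; rewrite -W'E in WA WU.
have WU' g : mob g -> forall x, W (net_rep N1 g x) = net_rep N2 g (W x).
  by move=> mg x; rewrite -(WU g mg) /= WK.
have [m [m1 WOm]] : exists m : R[i], `|m| = 1 /\ W (net_vac N1) = m *: net_vac N2.
  apply: net_vac_unique; first by rewrite (unitary_norm uW) net_vac_unit.
  by move=> g mg; rewrite -WU' // net_vac_inv.
have in1 I g : is_arc I -> local_maps I g -> net_alg N1 I (V1 g).
  by move=> aI Ig; rewrite A1 //; apply: local_in_algebra Ig; exact: vir_proj_rep vr1.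
have in2 I g : is_arc I -> local_maps I g -> net_alg N1 I (W' \o V2 g \o W).
  move=> aI Ig.
  have : net_alg N2 I (V2 g) by rewrite A2 //; apply: local_in_algebra Ig; exact: vir_proj_rep vr2.
  rewrite -WA // => -[a Aa E]; suff <- : a = W' \o V2 g \o W by [].
  by rewrite -E; apply/funext => x /=; rewrite !WK.
apply: (central_charge_eq vr1 vr2 UV1 UV2 (@net_vac_inv _ N1) (@net_vac_inv _ N2) uW uW' WK KW
  WU' m1 WOm c10) => I J k k' aI aJ IJ dk dk' Ik Jk' x.
  have := net_locality aI aJ IJ (in1 I k aI (conj dk Ik)) (in1 J k' aJ (conj dk' Jk')).
  by move=> /(congr1 (fun f => f x)).
have := net_locality aI aJ IJ (in1 I k aI (conj dk Ik)) (in2 J k' aJ (conj dk' Jk')).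
by move=> /(congr1 (fun f => f x)).
Qed.

Lemma admissible_gt0 (R : realType) (c : R) : admissible c -> 0 < c.
Proof.
case=> [[m [m0 ->]]|]; last exact: lt_le_trans.
have mR : 1 <= m%:R :> R by rewrite ler1n.
rewrite subr_gt0 ltr_pdivrMr ?mulr_gt0 //; nra.
Qed.

Theorem corollary3p4 (R : realType) (c1 c2 : R)
    (adm1 : admissible c1) (adm2 : admissible c2)
    (N1 N2 : mobius_net R)
    (vir1 : is_virasoro_net c1 N1) (vir2 : is_virasoro_net c2 N2) :
  net_iso N1 N2 <-> c1 = c2.
Proof.
split=> [|c12]; first exact: iso_same_charge (admissible_gt0 adm1) vir1 vir2.
by rewrite c12 in vir1; exact: same_charge_iso vir1 vir2.
Qed.
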